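(* Let $0<p\le\infty$ and let $a\subset\mathbb{D}$ be a subset of the unit disk. Then $a$ is sampling for $H^p(\mathbb{D})$ if and only if $\lambda_1$-almost every point $e^{i\theta}\in\partial\mathbb{D}$ is a nontangential limit point of $a$.
   Context: $\mathbb{D}$ is the open unit disk in $\mathbb{C}$ and $\lambda_1$ is the one-dimensional Lebesgue measure on the unit circle $\partial\mathbb{D}$. For $0<p<\infty$, $H^p(\mathbb{D})$ is the set of holomorphic functions $f$ on $\mathbb{D}$ with $\|f\|_p:=\left(\sup_{r<1}\int_0^{2\pi}|f(re^{i\theta})|^p\,\frac{d\theta}{2\pi}\right)^{1/p}<\infty$; for $p=\infty$, $H^\infty(\mathbb{D})$ is the set of bounded holomorphic functions on $\mathbb{D}$ with $\|f\|_\infty:=\sup_{\mathbb{D}}|f|$. For functions on the unit circle, $\|\cdot\|_p$ denotes the usual $L^p(\frac{d\theta}{2\pi})$ (quasi-)norm. For $\alpha>0$, the Stolz angle with vertex $e^{i\theta}$ is $\Gamma_\alpha(e^{i\theta}):=\{z\in\mathbb{D}:\frac{|e^{i\theta}-z|}{1-|z|}<1+\alpha\}$. An aperture $\alpha>0$ is fixed once and for all, and for $a\subset\mathbb{D}$ and $f$ defined on $\mathbb{D}$ one sets $$M_a(f)(e^{i\theta}):=\sup_{z\in\Gamma_\alpha(e^{i\theta})\cap a}|f(z)|,$$ with the convention that the supremum over the empty set is $0$. Sampling: the set $a$ is sampling for $H^p(\mathbb{D})$ iff there exists a constant $C>0$ such that $\|M_a(f)\|_p\ge C\|f\|_p$ for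 every $f\in H^p(\mathbb{D})$. Nontangential limit point: a point $e^{i\theta}$ of the circle is a nontangential limit point of $a$ iff it lies in the closure of $\Gamma_\beta(e^{i\theta})\cap a$ for some $\beta>0$ (where $\beta$ may depend on $e^{i\theta}$ and need not equal the fixed $\alpha$). *)

(* Defs.v *)
From HB Require Import structures.
From mathcomp Require Import all_boot all_order all_algebra.
From mathcomp Require Import all_classical all_reals all_analysis.
From mathcomp Require Import complex.

Set Implicit Arguments.
Unset Strict Implicit.
Unset Printing Implicit Defensive.

Import Order.TTheory GRing.Theory Num.Theory.
Import numFieldNormedType.Exports.
Import Normc.

Local Open Scope classical_set_scope.
Local Open Scope ring_scope.
Local Open Scope complex_scope.

(* The regular module [R[i]^o] is the complex plane carrying the topology of
   its norm, and complex scalars: [derivable f z 1] for [f : R[i]^o -> R[i]^o]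
   is complex differentiability at [z]. The norm of [R[i]] takes values in
   [R[i]]; [normc] is its real-valued version. *)

Section Disk.
Context {R : realType}.
Implicit Types (t alpha : R) (z zeta : R[i]^o) (a : set R[i]^o).

Definition disk : set R[i]^o := [set z | normc z < 1].

Definition expi t : R[i]^o := cos t +i* sin t.

Definition holomorphic_on_disk (f : R[i]^o -> R[i]^o) : Prop :=
  forall z, disk z -> derivable f z 1.

Definition stolz alpha zeta : set R[i]^o :=
  disk `&` [set z | normc (zeta - z) / (1 - normc z) < 1 + alpha].

Definition nontangential_limit_point a zeta : Prop :=
  exists2 beta : R, 0 < beta & closure (stolz beta zeta `&` a) zeta.

(* All the moduli are nonnegative, so taking the maximum with 0 only matters
   when [stolz alpha zeta `&` a] is empty, in which case [ereal_sup] is [-oo]. *)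
Definition maximal_fun alpha a (f : R[i]^o -> R[i]^o) zeta : \bar R :=
  Order.max 0%E
    (ereal_sup [set (normc (f z))%:E | z in stolz alpha zeta `&` a]).

End Disk.

(* The unit circle is parametrized by [expi] on [0, 2 pi[: [arc_length] is the
   one-dimensional Lebesgue measure in that parametrization, [dtheta2pi] is
   d theta / (2 pi). *)
Section CircleMeasure.
Context {R : realType}.

Definition arc_domain : set (measurableTypeR R) := `[0, 2 * pi[%classic.

Lemma measurable_arc_domain : measurable arc_domain.
Proof. exact: measurable_itv. Qed.

Definition arc_length : {measure set (measurableTypeR R) -> \bar R} :=
  mrestr lebesgue_measure measurable_arc_domain.

Lemma inv_2pi_ge0 : 0 <= (2 * pi)^-1 :> R.
Proof. by rewrite invr_ge0 mulr_ge0// pi_ge0. Qed.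

Definition dtheta2pi : {measure set (measurableTypeR R) -> \bar R} :=
  mscale (NngNum inv_2pi_ge0) arc_length.

End CircleMeasure.

Section Hardy.
Context {R : realType}.
Implicit Types (p : \bar R) (f : R[i]^o -> R[i]^o).

(* Only used for [0 < p], where the last branch is [p = +oo]. *)
Definition hardy_norm p f : \bar R :=
  match p with
  | q%:E =>
      (ereal_sup
         [set \int[dtheta2pi]_t (normc (f (r%:C * expi t)%R) `^ q)%:E
         | r in [set r : R | (0 <= r < 1)%R]] `^ q^-1)%E
  | _ => ereal_sup [set (normc (f z))%:E | z in disk]
  end.

Definition hardy_space p : set (R[i]^o -> R[i]^o) :=
  [set f | holomorphic_on_disk f /\ (hardy_norm p f < +oo)%E].

Definition circle_norm p (g : R[i]^o -> \bar R) : \bar R :=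
  Lnorm dtheta2pi p (fun t => g (expi t)).

Definition sampling (alpha : R) p (a : set R[i]^o) : Prop :=
  exists2 C : R, 0 < C & forall f, hardy_space p f ->
    (C%:E * hardy_norm p f <= circle_norm p (maximal_fun alpha a f))%E.

End Hardy.

(* Main.v *)
(* Sufficiency. For [f] in [H^p] the averages of [|f(r e^it)|^p] increase with
   [r]: on a circle, [log max (|f|, c)] is approximated by the real part of a
   holomorphic function, so [|f|^p] is majorized by the squared modulus of a
   holomorphic function whose mean is almost the same. Limits of Herglotz
   transforms along an ultrafilter give a holomorphic [P] with [|f|^p <= Re P],
   and multiplying [f] by a power of [1 / (1 + e P)] reduces everything to a
   bounded function. A bounded [f] has nontangential limits almost everywhere,
   by the Hardy-Littlewood maximal inequality applied to the lacunary blocks of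
   its Taylor series. By the Lebesgue density theorem almost every nontangential
   limit point is a limit point within the fixed aperture, so that the maximal
   function dominates the limit there and [C = 1] works by dominated convergence.

   Necessity. If the points whose Stolz angle avoids [a] near the boundary fill
   a set of positive measure, let [K] be the part of it in a half circle and [v]
   the harmonic measure of the complement of [K]. Then [v] is bounded below on
   [a], whereas the mean of [v] over [r K] tends to 0, so [exp (- N (v + i v~))]
   is uniformly exponentially small on [a] with norms bounded below. *)
Require Import Defs.
From HB Require Import structures.
From mathcomp Require Import all_boot all_order all_algebra.
From mathcomp Require Import all_classical all_reals all_analysis.
From mathcomp Require Import complex measurable_realfun ess_sup_inf.
From mathcomp Require Import ring lra.

Import Order.TTheory GRing.Theory Num.Theory.
Import numFieldNormedType.Exports.
Import Normc.

Local Open Scope classical_set_scope.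
Local Open Scope ring_scope.
Local Open Scope complex_scope.

Local Notation Re := complex.Re.
Local Notation Im := complex.Im.

(** * Complex moduli, exponentials and derivatives *)

(** No boundary function is ever formed: boundary behaviour is a Cauchy condition inside Stolz
    angles, and radial points r e^it are compared directly with points of [a]. Squares are the pivot
    of the sufficiency part. By Parseval the mean of |G|^2 over a circle is a sum of |a_n|^2 r^(2n),
    visibly increasing in r; an arbitrary exponent p, in particular p < 1 where no convexity helps,
    is reduced to this by a zero-free G with |G|^2 close to |f|^p. The constant c in log max (|f|,
    c) is there because f may vanish. Harmonic majorants are only needed to be finite, not sharp:
    they serve to build a multiplier of modulus at most 1, which cannot increase the maximal
    function, and this is why C = 1 survives. The case p = +oo is reached through powers of f and
    finite exponents. In the necessity part, the half circle guarantees that the complement of K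
    carries at least half of the mass, which bounds v from below at the points of [a] far from the
    boundary; near the boundary the bound comes from the arc of vertices whose Stolz angle contains
    the point. The radius is chosen after N, so that the factor N in the exponent is harmless. *)

(* Locked: unification would otherwise compare complex numbers by unfolding
   products down to real and imaginary parts. *)
HB.lock Definition ei {R : realType} (t : R) : R[i] := cos t +i* sin t.
HB.lock Definition cexp {R : realType} (z : R[i]) : R[i] := (expR (Re z))%:C * ei (Im z).

Section ComplexModulus.
Context {R : realType}.
Implicit Types (x y t : R) (z w : R[i]).

Lemma normc_ge0 z : 0 <= normc z.
Proof. by case: z => x y; exact: sqrtr_ge0. Qed.

Lemma normc_sqr z : normc z ^+ 2 = Re z ^+ 2 + Im z ^+ 2.
Proof. by case: z => x y; rewrite /= sqr_sqrtr // addr_ge0 ?sqr_ge0. Qed.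

Lemma normc_eq0 z : (normc z == 0) = (z == 0).
Proof.
by apply/eqP/eqP => [/eq0_normc //|->]; exact: (@normc0 R).
Qed.

Lemma normc_gt0 z : (0 < normc z) = (z != 0).
Proof. by rewrite lt_def normc_ge0 andbT normc_eq0. Qed.

Lemma normcR x : normc x%:C = `|x|.
Proof. by rewrite /= expr0n /= addr0 sqrtr_sqr. Qed.

Lemma normcX z n : normc (z ^+ n) = normc z ^+ n.
Proof.
elim: n => [|n IH]; first by rewrite !expr0; exact: (@normc1 R).
by rewrite !exprS normcM IH.
Qed.

Lemma normcB z w : normc (z - w) = normc (w - z).
Proof. by rewrite -normcN opprB. Qed.

Lemma normc_conj z : normc (conjc z) = normc z.
Proof. by case: z => x y; rewrite /= sqrrN. Qed.

Lemma mulc_conj z : z * conjc z = (normc z ^+ 2)%:C.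
Proof.
rewrite normc_sqr; case: z => x y /=; apply/eqP; rewrite eq_complex /=.
by apply/andP; split; apply/eqP; ring.
Qed.

Lemma normRe_le z : `|Re z| <= normc z.
Proof.
rewrite -(ler_pXn2r (n := 2)) ?nnegrE ?normc_ge0 // normc_sqr real_normK ?num_real //.
by rewrite lerDl sqr_ge0.
Qed.

Lemma normIm_le z : `|Im z| <= normc z.
Proof.
rewrite -(ler_pXn2r (n := 2)) ?nnegrE ?normc_ge0 // normc_sqr real_normK ?num_real //.
by rewrite lerDr sqr_ge0.
Qed.

Lemma Re_le_normc z : Re z <= normc z.
Proof. exact: le_trans (ler_norm _) (normRe_le z). Qed.

Lemma normc_le_ReIm z : normc z <= `|Re z| + `|Im z|.
Proof.
rewrite -(ler_pXn2r (n := 2)) ?nnegrE ?normc_ge0 ?addr_ge0 // normc_sqr.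
rewrite sqrrD !real_normK ?num_real // lerD2r lerDl.
by rewrite mulrn_wge0 // mulr_ge0.
Qed.

Lemma normcBB z w : `|normc z - normc w| <= normc (z - w).
Proof.
rewrite ler_norml lerBlDr lerNl opprB andbC lerBlDr; apply/andP; split.
  by rewrite -{1}(subrK w z) le_normcD.
by rewrite normcB -{1}(subrK z w) le_normcD.
Qed.

Lemma Re_mulr x z : Re (x%:C * z) = x * Re z.
Proof. by case: z => a b; rewrite /= mul0r subr0. Qed.

Lemma Im_mulr x z : Im (x%:C * z) = x * Im z.
Proof. by case: z => a b; rewrite /= mul0r addr0. Qed.

Lemma ReM z w : Re (z * w) = Re z * Re w - Im z * Im w.
Proof. by case: z => a b; case: w. Qed.

Lemma ImM z w : Im (z * w) = Re z * Im w + Im z * Re w.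
Proof. by case: z => a b; case: w => c d; rewrite /= . Qed.

Lemma ReDc z w : Re (z + w) = Re z + Re w.
Proof. by case: z => a b; case: w. Qed.

Lemma ImDc z w : Im (z + w) = Im z + Im w.
Proof. by case: z => a b; case: w. Qed.

Lemma ReNc z : Re (- z) = - Re z. Proof. by case: z. Qed.
Lemma ImNc z : Im (- z) = - Im z. Proof. by case: z. Qed.
Lemma ReJ z : Re (conjc z) = Re z. Proof. by case: z. Qed.
Lemma ImJ z : Im (conjc z) = - Im z. Proof. by case: z. Qed.

Lemma complex_eqP z w : Re z = Re w -> Im z = Im w -> z = w.
Proof. by case: z => a b; case: w => c d /= -> ->. Qed.

(** Reduces a bound on a modulus to a bound on a real part: the rotation can be moved inside an
    integral, which gives |int f| <= int |f| below. *)
Lemma normc_rotate z : exists2 w, normc w = 1 & w * z = (normc z)%:C.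
Proof.
have [->|z0] := eqVneq z 0.
  exists 1; first exact: (@normc1 R).
  by rewrite mulr0 (@normc0 R).
exists (conjc z / (normc z)%:C).
  rewrite normcM normc_conj normcV normcR ger0_norm ?normc_ge0 //.
  by rewrite divff // normc_eq0.
have nz0 : (normc z)%:C != 0 :> R[i] by rewrite eq_complex /= eqxx andbT normc_eq0.
rewrite mulrAC [_ * z]mulrC mulc_conj expr2 rmorphM /=.
by rewrite mulfK.
Qed.

Lemma Re_ei t : Re (ei t) = cos t. Proof. by rewrite ei.unlock. Qed.
Lemma Im_ei t : Im (ei t) = sin t. Proof. by rewrite ei.unlock. Qed.

Lemma expi_ei t : expi t = ei t. Proof. by rewrite ei.unlock. Qed.

Lemma cexpE z : cexp z = (expR (Re z))%:C * ei (Im z).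
Proof. by rewrite cexp.unlock. Qed.

Lemma eiE t : ei t = cexp (t *i).
Proof. by rewrite cexpE /= expR0 mul1r. Qed.

Lemma cexpD z w : cexp (z + w) = cexp z * cexp w.
Proof.
case: z => a b; case: w => c d; rewrite !cexpE !ei.unlock /= expRD cosD sinD.
by apply: complex_eqP; rewrite /= ; ring.
Qed.

Lemma cexp0 : cexp (0 : R[i]) = 1.
Proof.
by rewrite cexpE ei.unlock; apply: complex_eqP; rewrite /= expR0 cos0 sin0 ?mul0r ?mulr0 ?mulr1 ?subr0 ?addr0.
Qed.

Lemma normc_expi t : normc (ei t) = 1.
Proof.
by rewrite ei.unlock /= cos2Dsin2 sqrtr1.
Qed.

Lemma normc_cexp z : normc (cexp z) = expR (Re z).
Proof.
by rewrite cexpE normcM normcR ger0_norm ?expR_ge0 // (normc_expi (Im z)) mulr1.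
Qed.

Lemma eiD s t : ei (s + t) = ei s * ei t.
Proof.
by rewrite !eiE -cexpD; congr cexp; apply: complex_eqP; rewrite /= ?addr0.
Qed.

Lemma ei0 : ei 0 = 1 :> R[i].
Proof. by rewrite eiE cexp0. Qed.

Lemma eiX t n : ei t ^+ n = ei (t *+ n).
Proof.
elim: n => [|n IH]; first by rewrite mulr0n expr0 ei0.
by rewrite exprS mulrS eiD IH.
Qed.

Lemma ei_neq0 t : ei t != 0 :> R[i].
Proof. by rewrite -normc_gt0 normc_expi. Qed.

Lemma ei_mulJ t : ei t * conjc (ei t) = 1.
Proof. by rewrite mulc_conj normc_expi expr1n. Qed.

Lemma eiV t : (ei t)^-1 = conjc (ei t) :> R[i].
Proof. by apply: (mulfI (ei_neq0 t)); rewrite ei_mulJ divff ?ei_neq0. Qed.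

Lemma ei_period t : ei (t + 2 * pi) = ei t.
Proof.
have -> : ei (t + 2 * pi) = ei t * ei (pi *+ 2) by rewrite eiD mulr_natl.
have -> : ei (pi *+ 2) = 1 :> R[i] by rewrite ei.unlock cos2pi sin2pi.
by rewrite mulr1.
Qed.

Lemma ei_period_int t (k : int) : ei (t + k%:~R * (2 * pi)) = ei t.
Proof.
have P n (s : R) : ei (s + n%:R * (2 * pi)) = ei s.
  elim: n s => [|n IH] s; first by rewrite mul0r addr0.
  by rewrite -natr1 mulrDl mul1r addrA ei_period IH.
case: k => n; first exact: P.
by rewrite NegzE mulrNz mulNr -(P n.+1 (_ - _)) subrK.
Qed.

Lemma ei_mod t : exists s (k : int),
  [/\ 0 <= s, s < 2 * pi, t = s + k%:~R * (2 * pi) & ei t = ei s].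
Proof.
have p0 : 0 < 2 * pi :> R by rewrite mulr_gt0 ?pi_gt0.
pose k := Num.floor (t / (2 * pi)).
exists (t - k%:~R * (2 * pi)), k; split.
- by rewrite subr_ge0 -ler_pdivlMr // floor_le_tmp.
- rewrite ltrBlDr -{1}[2 * pi]mul1r -mulrDl -ltr_pdivrMr // [1 + _]addrC.
  by rewrite (_ : k%:~R + 1 = (k + 1)%:~R) ?floorD1_gt // intrD.
- by rewrite subrK.
by rewrite -{1}(subrK (k%:~R * (2 * pi)) t) ei_period_int.
Qed.

End ComplexModulus.

(** * Complex derivatives in epsilon form and the exponential *)

Section Derivatives.

(** Multiplying the difference quotient by [|h|] removes the division, so that [h = 0] needs no
    exception. The generic field lets one equivalence serve the real functions [expR], [cos], [sin]
    and the complex plane. *)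
Lemma is_deriveP_eps (K : numFieldType) (f : K^o -> K^o) (z d : K^o) :
  is_derive z 1 f d <->
  forall e : K, 0 < e -> exists2 r : K, 0 < r &
    forall h, `|h| < r -> `|f (z + h) - f z - d * h| <= e * `|h|.
Proof.
have quot (h : K^o) : h != 0 ->
    `|d - h^-1 *: ((f \o shift z) (h *: 1) - f z)| * `|h|
    = `|f (z + h) - f z - d * h|.
  move=> h0; rewrite -normrM distrC mulrBl; congr (`|_ - _|).
  rewrite /= [h *: 1]mulr1 [h + z]addrC.
  by rewrite -[_ *: _]/(_ * _ : K) mulrC mulrA mulfV // mul1r.
split=> [[df dE] e e0|H].
  move: df => /cvgrPdist_le /(_ e e0).
  rewrite near_withinE => /nbhs_normP[r /= r0 Hr].
  exists r => // h hr.
  have [->|h0] := eqVneq h 0.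
    by rewrite addr0 subrr mulr0 subrr normr0 mulr0.
  have := Hr h; rewrite /ball_ /= sub0r normrN => /(_ hr h0) le.
  by rewrite -quot // ler_wpM2r // -dE.
suff H2 : (fun h => h^-1 *: ((f \o shift z) (h *: 1) - f z)) @ 0^' --> d.
  by apply: DeriveDef; [apply/cvg_ex; exists d|exact: cvg_lim].
apply/cvgrPdist_le => e e0; rewrite near_withinE; apply/nbhs_normP.
have [r r0 Hr] := H e e0; exists r => //= h; rewrite /ball_ /= sub0r normrN => hr h0.
rewrite -(ler_pM2r (x := `|h|)) ?normr_gt0 //.
by rewrite quot // Hr.
Qed.

Context {R : realType}.
Implicit Types (z w h d : R[i]) (f g : R[i] -> R[i]).

Lemma nbhs_normcP (P : set R[i]^o) (z : R[i]^o) :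
  nbhs z P <-> exists2 r : R, 0 < r & forall w, normc (w - z) < r -> P w.
Proof.
split=> [/nbhs_normP[r /= r0 Hr]|[r r0 Hr]].
  move: r0; rewrite ltcE /= => /andP[/eqP Imr Rer]; exists (Re r) => // w wr.
  apply: Hr; rewrite /ball_ /= ltcE /=; apply/andP; split; first exact/eqP.
  by rewrite -/(normc (z - w)) normcB.
apply: (proj2 (nbhs_normP z P)); exists r%:C => /=; first by rewrite ltcR.
move=> w; rewrite /ball_ /= => wr; apply: Hr.
by rewrite normcB -ltcR.
Qed.

(** Moduli, radii and tolerances are real here, whereas the norm of [R[i]] and the epsilons of its
    topology are elements of [R[i]]; [is_derive_cderP] reconciles the two. *)
Definition cder f z d := forall e : R, 0 < e -> exists2 r : R, 0 < r &
  forall h, normc h < r -> normc (f (z + h) - f z - d * h) <= e * normc h.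

Definition ccont f z := forall e : R, 0 < e -> exists2 r : R, 0 < r &
  forall w, normc (w - z) < r -> normc (f w - f z) < e.

Lemma is_derive_cderP (f : R[i]^o -> R[i]^o) (z d : R[i]^o) :
  is_derive z 1 f d <-> cder f z d.
Proof.
split=> [/is_deriveP_eps H e e0|H].
  have [|r] := H e%:C; first by rewrite ltcR.
  rewrite ltcE /= => /andP[/eqP Imr Rer] Hr; exists (Re r) => // h hr.
  have := Hr h; rewrite -lecR rmorphM; apply.
  by rewrite ltcE /=; apply/andP; split => //; apply/eqP.
apply/is_deriveP_eps => e; rewrite ltcE /= => /andP[/eqP Ime Ree].
have [r r0 Hr] := H _ Ree; exists r%:C; first by rewrite ltcR.
move=> h hr; have {}hr : normc h < r by rewrite -ltcR.
have := Hr h hr; rewrite -lecR rmorphM /=.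
by rewrite (_ : e = (Re e)%:C) //; apply: complex_eqP.
Qed.

Lemma derivable_cderP f z :
  derivable (f : R[i]^o -> R[i]^o) (z : R[i]^o) 1 <-> exists d, cder f z d.
Proof.
split=> [/derivableP/is_derive_cderP H|[d /is_derive_cderP[]//]].
by eexists; exact: H.
Qed.

Lemma cder_ccont f z d : cder f z d -> ccont f z.
Proof.
move=> /(_ 1 ltr01)[r r0 H] e e0.
have K0 : 0 < 1 + normc d by rewrite ltr_wpDr ?normc_ge0.
exists (Num.min r (e / (1 + normc d))); first by rewrite lt_min r0 divr_gt0.
move=> w; rewrite lt_min ltr_pdivlMr // => /andP[wr we].
have := H (w - z) wr; rewrite mul1r addrCA subrr addr0 => le.
rewrite (le_lt_trans _ we) // mulrC mulrDl mul1r.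
rewrite -[f w - f z](subrK (d * (w - z))) (le_trans (le_normcD _ _)) //.
by rewrite normcM lerD2r.
Qed.

Definition cdiff f z := exists d, cder f z d.

Lemma cdiff_ccont f z : cdiff f z -> ccont f z.
Proof. by case=> d; exact: cder_ccont. Qed.

Lemma cdiff_comp f g z : cdiff f z -> cdiff g (f z) -> cdiff (fun x => g (f x)) z.
Proof.
move=> /derivable_cderP/derivable1_diffP df /derivable_cderP/derivable1_diffP dg.
by apply/derivable_cderP/derivable1_diffP; exact: (differentiable_comp df dg).
Qed.

Lemma cdiffM f g z : cdiff f z -> cdiff g z -> cdiff (fun x => f x * g x) z.
Proof.
move=> /derivable_cderP df /derivable_cderP dg.
by have /derivable_cderP := derivableM df dg.
Qed.

Lemma cdiffD f g z : cdiff f z -> cdiff g z -> cdiff (fun x => f x + g x) z.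
Proof.
move=> /derivable_cderP df /derivable_cderP dg.
by have /derivable_cderP := derivableD df dg.
Qed.

Lemma cdiffV f z : f z != 0 -> cdiff f z -> cdiff (fun x => (f x)^-1) z.
Proof.
move=> f0 /derivable_cderP df; by have /derivable_cderP := derivableV f0 df.
Qed.

Lemma cdiff_cst (k : R[i]) z : cdiff (fun=> k) z.
Proof.
by apply/derivable_cderP; exact: derivable_cst.
Qed.

Lemma cdiff_id z : cdiff (fun x => x) z.
Proof.
by apply/derivable_cderP; exact: derivable_id.
Qed.

Lemma cdiffX f z n : cdiff f z -> cdiff (fun x => f x ^+ n) z.
Proof.
move=> df; elim: n => [|n IH].
  by under eq_fun do rewrite expr0; exact: cdiff_cst.
by under eq_fun do rewrite exprS; exact: cdiffM.
Qed.

Lemma cdiffMl (a : R[i]) z : cdiff (fun x => a * x) z.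
Proof. by apply: cdiffM; [exact: cdiff_cst|exact: cdiff_id]. Qed.

Lemma derive_expR0 : is_derive (0 : R^o) 1 (expR : R^o -> R^o) 1.
Proof. by have := is_derive_expR (0 : R); rewrite expR0. Qed.

(** By the functional equation only the derivative at 0 matters; there the first-order expansions of
    the real functions exp, cos and sin are combined. *)
Lemma cder_cexp z : cder cexp z (cexp z).
Proof.
suff D0 : cder cexp 0 1.
  move=> e e0; have e'0 : 0 < e / expR (Re z) by rewrite divr_gt0 ?expR_gt0.
  have [r r0 H] := D0 _ e'0; exists r => // h /H.
  rewrite add0r cexp0 cexpD mul1r.
  rewrite -{2}[cexp z]mulr1 -!mulrBr normcM normc_cexp => le.
  by rewrite -ler_pdivlMl ?expR_gt0 // mulrA [_^-1 * _]mulrC.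
move=> e e0.
(* The errors of the real and imaginary parts are at most [3 * k * n] each, so [k <= e / 10] leaves
   room. [k <= 1] gives [|E| <= 2], and [n < k / 2] turns the quadratic term [2 * n * n] into
   [k * n]. *)
pose k := Num.min 1 (e / 10).
have k0 : 0 < k by rewrite lt_min ltr01 divr_gt0.
have k1 : k <= 1 by rewrite ge_min lexx.
have ke : k <= e / 10 by rewrite ge_min lexx orbT.
have [r1 r10 H1] := proj1 (is_deriveP_eps _ _ _ _) derive_expR0 _ k0.
have [r2 r20 H2] := proj1 (is_deriveP_eps _ _ _ _) (is_derive_cos (0 : R)) _ k0.
have [r3 r30 H3] := proj1 (is_deriveP_eps _ _ _ _) (is_derive_sin (0 : R)) _ k0.
exists (Num.min (k / 2) (Num.min r1 (Num.min r2 r3))).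
  by rewrite !lt_min divr_gt0 //= r10 r20 r30.
move=> h; rewrite !lt_min => /and4P[hk hr1 hr2 hr3].
set x := Re h; set y := Im h.
have xh : `|x| <= normc h := normRe_le h.
have yh : `|y| <= normc h := normIm_le h.
have := H1 x (le_lt_trans xh hr1); have := H2 y (le_lt_trans yh hr2).
have := H3 y (le_lt_trans yh hr3).
rewrite !add0r expR0 cos0 sin0 !mul1r subr0 oppr0 mul0r subr0.
set S := sin y; set C := cos y; set E := expR x => HS HC HE.
set n := normc h in hk hr1 hr2 hr3 xh yh *.
have n0 : 0 <= n by exact: normc_ge0.
rewrite cexp0 (le_trans (normc_le_ReIm _)) //.
have -> : Re (cexp h - 1 - h) = (E - 1 - x) + E * (C - 1).
  by rewrite !ReDc !ReNc cexpE Re_mulr Re_ei /= -/x -/y -/E -/C; ring.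
have -> : Im (cexp h - 1 - h) = E * (S - y) + (E - 1) * y.
  by rewrite !ImDc !ImNc cexpE Im_mulr Im_ei /= -/x -/y -/E -/S; ring.
have kn : k * n <= n by rewrite ler_piMl.
have HEx : `|E - 1| <= 2 * n.
  rewrite -[E - 1](subrK x) (le_trans (ler_normD _ _)) // mulr_natl mulr2n lerD //.
  by rewrite (le_trans HE) // (le_trans _ kn) // ler_wpM2l // ltW.
have E2 : `|E| <= 2.
  rewrite -[E](subrK 1) (le_trans (ler_normD _ _)) // normr1.
  by rewrite -lerBrDr (le_trans HEx) //; lra.
have b1 : `|E - 1 - x| <= k * n by rewrite (le_trans HE) // ler_wpM2l // ltW.
have b2 : `|C - 1| <= k * n by rewrite (le_trans HC) // ler_wpM2l // ltW.
have b3 : `|S - y| <= k * n by rewrite (le_trans HS) // ler_wpM2l // ltW.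
have c1 : `|E * (C - 1)| <= 2 * (k * n) by rewrite normrM ler_pM.
have c2 : `|E * (S - y)| <= 2 * (k * n) by rewrite normrM ler_pM.
have c3 : `|(E - 1) * y| <= k * n.
  rewrite normrM (le_trans (ler_pM _ _ HEx yh)) //.
  by rewrite ler_wpM2r // ; lra.
have := ler_normD (E - 1 - x) (E * (C - 1)).
have := ler_normD (E * (S - y)) ((E - 1) * y).
have : k * n <= e / 10 * n by rewrite ler_wpM2r.
have : 0 <= e * n by rewrite mulr_ge0 // ltW.
lra.
Qed.

Lemma cdiff_cexp z : cdiff cexp z.
Proof. by exists (cexp z); exact: cder_cexp. Qed.

Definition holo f := forall z, normc z < 1 -> cdiff f z.

Lemma holoP (f : R[i]^o -> R[i]^o) : holomorphic_on_disk f <-> holo f.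
Proof.
by split=> H z z1; [apply/derivable_cderP/H|apply/derivable_cderP; exact: H].
Qed.

End Derivatives.

(** * Series with geometric bounds *)

Section ComplexSeries.
Context {R : realType}.
Implicit Types (a c : nat -> R[i]) (z w : R[i]) (r q K : R).

(** Summed by components because the limits are taken in [R]. The value is meaningful only for
    convergent series; it is evaluated where the terms decay geometrically. *)
Definition csum a : R[i] :=
  limn (series (fun n => Re (a n))) +i* limn (series (fun n => Im (a n))).

Lemma Re_sum (I : Type) (s : seq I) (P : pred I) (F : I -> R[i]) :
  Re (\sum_(i <- s | P i) F i) = \sum_(i <- s | P i) Re (F i).
Proof. by apply: (big_morph (fun z : R[i] => Re z) (fun x y => ReDc x y) _). Qed.

Lemma Im_sum (I : Type) (s : seq I) (P : pred I) (F : I -> R[i]) :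
  Im (\sum_(i <- s | P i) F i) = \sum_(i <- s | P i) Im (F i).
Proof. by apply: (big_morph (fun z : R[i] => Im z) (fun x y => ImDc x y) _). Qed.

Lemma geometric_partial q N M : 0 <= q < 1 -> (N <= M)%N ->
  \sum_(N <= n < M) q ^+ n <= q ^+ N / (1 - q).
Proof.
move=> /andP[q0 q1] NM; have d0 : 0 < 1 - q by rewrite subr_gt0.
rewrite ler_pdivlMr // -(subnKC NM); elim: (M - N)%N => [|m IH].
  by rewrite addn0 big_geq // mul0r exprn_ge0.
have -> : (\sum_(N <= n < N + m.+1) q ^+ n) * (1 - q) = q ^+ N - q ^+ (N + m.+1).
  elim: m {IH} => [|m IH].
    by rewrite addn1 big_nat1 mulrBr mulr1 exprSr.
  by rewrite addnS big_nat_recr ?leq_addr //= mulrDl IH mulrBr mulr1 -exprSr addnS addrA subrK.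
by rewrite gerBl exprn_ge0.
Qed.

Lemma real_geometric_cvg (u : nat -> R) K q : 0 <= q < 1 -> 0 <= K ->
  (forall n, `|u n| <= K * q ^+ n) ->
  forall N, `|limn (series u) - \sum_(n < N) u n| <= K * q ^+ N / (1 - q).
Proof.
move=> /andP[q0 q1] K0 Hu N.
have cu : cvgn (series u).
  apply: normed_cvg; apply: (series_le_cvg (v_ := geometric K q)) => //.
  - by move=> n /=.
  - by move=> n; rewrite /geometric /= mulr_ge0 // exprn_ge0.
  - by apply: is_cvg_geometric_series; rewrite ger0_norm.
rewrite -[X in _ - X](big_mkord xpredT u) -/(series u N).
have cN : (fun M => `|series u M - series u N|) @ \oo --> `|limn (series u) - series u N|.
  by apply: cvg_norm; apply: cvgB => //; exact: cvg_cst.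
rewrite -(cvg_lim _ cN) //; apply: limr_le; first exact: (cvgP _ cN).
near=> M; have NM : (N <= M)%N by near: M; exact: nbhs_infty_ge.
rewrite sub_series NM -mulrA (le_trans (ler_norm_sum _ _ _)) //.
rewrite (le_trans (ler_sum _ (fun i _ => Hu i))) // -mulr_sumr ler_wpM2l //.
by apply: geometric_partial => //; rewrite q0.
Unshelve. all: by end_near. Qed.

Lemma csum_tail a K q : 0 <= q < 1 -> 0 <= K ->
  (forall n, normc (a n) <= K * q ^+ n) ->
  forall N, normc (csum a - \sum_(n < N) a n) <= 2 * K * q ^+ N / (1 - q).
Proof.
move=> q01 K0 Ha N; rewrite (le_trans (normc_le_ReIm _)) //.
rewrite ReDc ImDc ReNc ImNc Re_sum Im_sum /=.
rewrite (_ : 2 * K * _ / _ = K * q ^+ N / (1 - q) + K * q ^+ N / (1 - q)); last by ring.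
apply: lerD; apply: real_geometric_cvg => // n; apply: le_trans (Ha n).
  exact: normRe_le.
exact: normIm_le.
Qed.

Lemma le_geometric_eq0 (x K q : R) : 0 <= q < 1 ->
  (forall N, x <= K * q ^+ N) -> x <= 0.
Proof.
move=> /andP[q0 q1] H.
have cq : (fun N => K * q ^+ N) @ \oo --> K * 0.
  by apply: cvgMr; apply: cvg_expr; rewrite ger0_norm.
rewrite mulr0 in cq.
rewrite -(cvg_lim _ cq) //; apply: limr_ge; first exact: (cvgP _ cq).
by apply: nearW => N; exact: H.
Qed.

(** The hypothesis alone makes the terms decay geometrically, a term being the difference of two
    consecutive remainders. A function is thus identified with a power series by one remainder
    estimate, without a separate convergence proof. *)
Lemma csum_unique a w K q : 0 <= q < 1 -> 0 <= K ->
  (forall N, normc (w - \sum_(n < N) a n) <= K * q ^+ N) -> w = csum a.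
Proof.
move=> q01 K0 H; have [q0 q1] := andP q01; have d0 : 0 < 1 - q by rewrite subr_gt0.
have Ha n : normc (a n) <= (2 * K) * q ^+ n.
  have -> : a n = (w - \sum_(i < n) a i) - (w - \sum_(i < n.+1) a i).
    by rewrite big_ord_recr /=; ring.
  rewrite (le_trans (le_normcD _ _)) // normcN mulr_natl mulrnAl mulr2n lerD //.
  by rewrite (le_trans (H _)) // ler_wpM2l // exprS ler_piMl ?exprn_ge0 // ltW.
have K20 : 0 <= 2 * K by rewrite mulr_ge0.
have T := csum_tail a _ _ q01 K20 Ha.
apply/eqP; rewrite -subr_eq0 -normc_eq0 eq_le normc_ge0 andbT.
apply: (@le_geometric_eq0 _ (K + 2 * (2 * K) / (1 - q)) q q01) => N.
have -> : w - csum a = (w - \sum_(i < N) a i) - (csum a - \sum_(i < N) a i) by ring.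
rewrite (le_trans (le_normcD _ _)) // normcN mulrDl lerD //.
by rewrite (le_trans (T N)) // mulrAC.
Qed.

Definition ps c z : R[i] := csum (fun n => c n * z ^+ n).

Lemma ps_tail c r K z : 0 < r -> 0 <= K -> (forall n, normc (c n) * r ^+ n <= K) ->
  normc z < r -> forall N,
  normc (ps c z - \sum_(n < N) c n * z ^+ n)
    <= 2 * K * (normc z / r) ^+ N / (1 - normc z / r).
Proof.
move=> r0 K0 Hc zr; apply: csum_tail => //.
  by rewrite divr_ge0 ?normc_ge0 ?ltW //= ltr_pdivrMr // mul1r.
move=> n; rewrite normcM normcX expr_div_n mulrA ler_pdivlMr ?exprn_gt0 //.
by rewrite mulrAC ler_wpM2r // exprn_ge0 ?normc_ge0.
Qed.

End ComplexSeries.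

(** * Averages and Fourier coefficients on the circle *)

Section Conjugation.
Context {R : realType}.
Implicit Types z w : R[i].

Lemma conjcM z w : conjc (z * w) = conjc z * conjc w.
Proof. exact: rmorphM. Qed.

Lemma conjcX z n : conjc (z ^+ n) = conjc z ^+ n.
Proof. exact: rmorphXn. Qed.

Lemma conjcB z w : conjc (z - w) = conjc z - conjc w.
Proof. exact: rmorphB. Qed.

Lemma conjc_sum (I : Type) (s : seq I) (P : pred I) (F : I -> R[i]) :
  conjc (\sum_(i <- s | P i) F i) = \sum_(i <- s | P i) conjc (F i).
Proof. exact: rmorph_sum. Qed.

End Conjugation.

Section ComplexIntegral.
Context d (T : measurableType d) (R : realType) (mu : {measure set T -> \bar R}).
Variable D : set T.
Hypothesis mD : measurable D.
Implicit Types (f g : T -> R[i]) (u : T -> R).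

Definition cintegrable f :=
  mu.-integrable D (EFin \o (fun x => Re (f x))) /\
  mu.-integrable D (EFin \o (fun x => Im (f x))).

Definition cint f : R[i] :=
  (\int[mu]_(x in D) Re (f x)) +i* (\int[mu]_(x in D) Im (f x)).

Lemma rintegrableD u v : mu.-integrable D (EFin \o u) -> mu.-integrable D (EFin \o v) ->
  mu.-integrable D (EFin \o (fun x => u x + v x)).
Proof. by move=> iu iv; have := integrableD mD iu iv. Qed.

Lemma rintegrableB u v : mu.-integrable D (EFin \o u) -> mu.-integrable D (EFin \o v) ->
  mu.-integrable D (EFin \o (fun x => u x - v x)).
Proof. by move=> iu iv; have := integrableB mD iu iv. Qed.

Lemma rintegrableZ (k : R) u : mu.-integrable D (EFin \o u) ->
  mu.-integrable D (EFin \o (fun x => k * u x)).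
Proof. by move=> iu; have := integrableZl mD k iu. Qed.

Lemma eq_cintegrable f g : (forall x, D x -> f x = g x) -> cintegrable f -> cintegrable g.
Proof.
move=> fg [h1 h2]; split; [apply: eq_integrable h1|apply: eq_integrable h2] => //= x /set_mem Dx;
 by rewrite /= fg.
Qed.

Lemma eq_cint f g : (forall x, D x -> f x = g x) -> cint f = cint g.
Proof.
by move=> fg; congr Complex; apply: eq_Rintegral => x /set_mem Dx; rewrite fg.
Qed.

Lemma cintegrableD f g : cintegrable f -> cintegrable g -> cintegrable (fun x => f x + g x).
Proof.
move=> [f1 f2] [g1 g2]; split.
  by under [X in EFin \o X]eq_fun do rewrite ReDc; exact: rintegrableD.
by under [X in EFin \o X]eq_fun do rewrite ImDc; exact: rintegrableD.
Qed.

Lemma cintD f g : cintegrable f -> cintegrable g ->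
  cint (fun x => f x + g x) = cint f + cint g.
Proof.
move=> [f1 f2] [g1 g2]; apply: complex_eqP; rewrite /= -RintegralD //.
  by apply: eq_Rintegral => x _; rewrite ReDc.
by apply: eq_Rintegral => x _; rewrite ImDc.
Qed.

Lemma cintegrableZ (k : R[i]) f : cintegrable f -> cintegrable (fun x => k * f x).
Proof.
move=> [f1 f2]; split.
  under [X in EFin \o X]eq_fun do rewrite ReM.
  by apply: rintegrableB; apply: rintegrableZ.
under [X in EFin \o X]eq_fun do rewrite ImM.
by apply: rintegrableD; apply: rintegrableZ.
Qed.

Lemma cintZ (k : R[i]) f : cintegrable f -> cint (fun x => k * f x) = k * cint f.
Proof.
move=> [f1 f2]; apply: complex_eqP; rewrite /= ?ReM ?ImM /= -?RintegralZl //.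
  rewrite -RintegralB //; do ?exact: rintegrableZ.
  by apply: eq_Rintegral => x _; rewrite ReM.
rewrite -RintegralD //; do ?exact: rintegrableZ.
by apply: eq_Rintegral => x _; rewrite ImM.
Qed.

Lemma cintegrableN f : cintegrable f -> cintegrable (fun x => - f x).
Proof.
by move=> /(cintegrableZ (-1)) H; apply: eq_cintegrable H => x _; rewrite mulN1r.
Qed.

Lemma cintN f : cintegrable f -> cint (fun x => - f x) = - cint f.
Proof.
by move=> H; rewrite -mulN1r -cintZ //; apply: eq_cint => x _; rewrite mulN1r.
Qed.

Lemma cintB f g : cintegrable f -> cintegrable g ->
  cint (fun x => f x - g x) = cint f - cint g.
Proof. by move=> hf hg; rewrite cintD ?cintN //; exact: cintegrableN. Qed.

Lemma cint0 : cint (fun _ => 0) = 0.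
Proof. by rewrite /cint /= Rintegral_cst // mul0r. Qed.

Lemma cintegrable0 : cintegrable (fun _ => 0).
Proof. by split; exact: integrable0. Qed.

Lemma cintegrable_sum (I : eqType) (s : seq I) (F : I -> T -> R[i]) :
  (forall i, i \in s -> cintegrable (F i)) -> cintegrable (fun x => \sum_(i <- s) F i x).
Proof.
elim: s => [|i s IH] H.
  by under eq_fun do rewrite big_nil; exact: cintegrable0.
under eq_fun do rewrite big_cons; apply: cintegrableD; first by apply: H; rewrite mem_head.
by apply: IH => j js; apply: H; rewrite in_cons js orbT.
Qed.

Lemma cint_sum (I : eqType) (s : seq I) (F : I -> T -> R[i]) :
  (forall i, i \in s -> cintegrable (F i)) ->
  cint (fun x => \sum_(i <- s) F i x) = \sum_(i <- s) cint (F i).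
Proof.
elim: s => [|i s IH] H.
  by rewrite big_nil; under eq_fun do rewrite big_nil; exact: cint0.
rewrite big_cons -IH; last by move=> j js; apply: H; rewrite in_cons js orbT.
rewrite -cintD; first by apply: eq_cint => x _; rewrite big_cons.
  by apply: H; rewrite mem_head.
by apply: cintegrable_sum => j js; apply: H; rewrite in_cons js orbT.
Qed.

Lemma Re_cint f : Re (cint f) = \int[mu]_(x in D) Re (f x).
Proof. by []. Qed.

Lemma cintJ f : cintegrable f -> cint (fun x => conjc (f x)) = conjc (cint f).
Proof.
move=> [f1 f2]; apply: complex_eqP => /=.
  by apply: eq_Rintegral => x _; rewrite ReJ.
rewrite -[RHS]mulN1r -RintegralZl //.
by apply: eq_Rintegral => x _; rewrite ImJ mulN1r.
Qed.

Lemma measurable_normc (E : set T) f :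
  measurable_fun E (fun x => Re (f x)) -> measurable_fun E (fun x => Im (f x)) ->
  measurable_fun E (fun x => normc (f x)).
Proof.
move=> m1 m2.
have -> : (fun x => normc (f x)) = Num.sqrt \o (fun x => Re (f x) ^+ 2 + Im (f x) ^+ 2).
  by apply/funext => x /=; case: (f x).
apply: measurableT_comp; first by apply: continuous_measurable_fun; exact: sqrt_continuous.
by apply: measurable_funD; apply: measurable_funX.
Qed.

Lemma cintegrable_normc f : cintegrable f -> mu.-integrable D (EFin \o (fun x => normc (f x))).
Proof.
move=> [f1 f2].
apply: (le_integrable mD (g := EFin \o (fun x => `|Re (f x)| + `|Im (f x)|))) => //.
- apply/measurable_EFinP; apply: measurable_normc.
    by case/integrableP : f1 => /measurable_EFinP.
  by case/integrableP : f2 => /measurable_EFinP.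
- move=> x Dx /=; rewrite lee_fin ger0_norm ?normc_ge0 // [leRHS]ger0_norm ?addr_ge0 //.
  exact: normc_le_ReIm.
by apply: rintegrableD; apply: integrable_norm.
Qed.

Lemma le_normc_cint f : cintegrable f -> normc (cint f) <= \int[mu]_(x in D) normc (f x).
Proof.
move=> H; have [w w1 wE] := normc_rotate (cint f).
have -> : normc (cint f) = Re (cint (fun x => w * f x)) by rewrite cintZ // wE.
rewrite Re_cint; apply: le_Rintegral => //.
- by case: (cintegrableZ w _ H).
- exact: cintegrable_normc.
- by move=> x _; rewrite (le_trans (Re_le_normc _)) // normcM w1 mul1r.
Qed.

End ComplexIntegral.

(** [dtheta2pi] gives no mass to the complement of [0, 2 pi[, so integrating over the whole line is
    averaging over the circle. *)
HB.lock Definition avg {R : realType} (u : R -> R) : R := \int[dtheta2pi]_t u t.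
HB.lock Definition cavg {R : realType} (f : R -> R[i]) : R[i] :=
  cint _ _ _ (@dtheta2pi R) setT f.

(** * Averages, orthogonality and Bessel's inequality on the circle *)

Section CircleAverage.
Context {R : realType}.
Implicit Types (u v : R -> R) (f g : R -> R[i]) (t M r : R).
Local Notation mu := (@dtheta2pi R).

Lemma dtheta2pi_setT : mu setT = 1%E.
Proof.
rewrite /dtheta2pi /= /mscale /= /mrestr setTI /arc_domain.
rewrite lebesgue_measure_itv /= lte_fin mulr_gt0 ?pi_gt0 // oppr0 adde0 -EFinM mulVf //.
by rewrite gt_eqF // mulr_gt0 ?pi_gt0.
Qed.

(** A class closed under algebraic operations and integrable for the probability measure
    [dtheta2pi]; the integrability conditions of averages are discharged through it. *)
Definition bmeas u := measurable_fun [set: R] u /\ exists M, forall t, `|u t| <= M.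

Lemma bmeas_integrable u : bmeas u -> mu.-integrable setT (EFin \o u).
Proof.
move=> [mu_ [M HM]]; apply: measurable_bounded_integrable => //.
  by rewrite dtheta2pi_setT ltry.
exists M; split; first exact: num_real.
by move=> x Mx t _; exact: le_trans (HM t) (ltW Mx).
Qed.

Lemma bmeas_cst (k : R) : bmeas (fun=> k).
Proof. by split; [exact: measurable_cst|exists `|k|]. Qed.

Lemma bmeasD u v : bmeas u -> bmeas v -> bmeas (fun t => u t + v t).
Proof.
move=> [mu1 [M HM]] [mv [N HN]]; split; first exact: measurable_funD.
by exists (M + N) => t; rewrite (le_trans (ler_normD _ _)) // lerD.
Qed.

Lemma bmeasM u v : bmeas u -> bmeas v -> bmeas (fun t => u t * v t).
Proof.
move=> [mu1 [M HM]] [mv [N HN]]; split; first exact: measurable_funM.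
by exists (M * N) => t; rewrite normrM ler_pM.
Qed.

Lemma bmeasN u : bmeas u -> bmeas (fun t => - u t).
Proof.
by move=> H; under eq_fun do rewrite -mulN1r; apply: bmeasM => //; exact: bmeas_cst.
Qed.

Lemma bmeasB u v : bmeas u -> bmeas v -> bmeas (fun t => u t - v t).
Proof. by move=> hu hv; apply: bmeasD => //; apply: bmeasN. Qed.

Lemma bmeasX u n : bmeas u -> bmeas (fun t => u t ^+ n).
Proof.
move=> H; elim: n => [|n IH].
  by under eq_fun do rewrite expr0; exact: bmeas_cst.
by under eq_fun do rewrite exprS; exact: bmeasM.
Qed.

Definition cbmeas f := bmeas (fun t => Re (f t)) /\ bmeas (fun t => Im (f t)).

Lemma cbmeas_normc f : cbmeas f -> bmeas (fun t => normc (f t)).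
Proof.
move=> [[m1 [M1 H1]] [m2 [M2 H2]]]; split; first exact: (measurable_normc _ _ _ _ f m1 m2).
exists (M1 + M2) => t; rewrite ger0_norm ?normc_ge0 //.
by rewrite (le_trans (normc_le_ReIm _)) // lerD.
Qed.

Lemma cbmeas_bound f : cbmeas f -> exists2 M, 0 <= M & forall t, normc (f t) <= M.
Proof.
move=> /cbmeas_normc[_ [M HM]]; exists M.
  exact: le_trans (normr_ge0 _) (HM 0).
by move=> t; apply: le_trans (HM t); exact: ler_norm.
Qed.

Lemma cbmeas_cintegrable f : cbmeas f -> cintegrable _ _ _ mu setT f.
Proof. by move=> [h1 h2]; split; exact: bmeas_integrable. Qed.

Lemma cbmeas_cst (k : R[i]) : cbmeas (fun=> k).
Proof. by split; exact: bmeas_cst. Qed.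

Lemma cbmeasD f g : cbmeas f -> cbmeas g -> cbmeas (fun t => f t + g t).
Proof.
move=> [? ?] [? ?]; split.
  by under eq_fun do rewrite ReDc; exact: bmeasD.
by under eq_fun do rewrite ImDc; exact: bmeasD.
Qed.

Lemma cbmeasM f g : cbmeas f -> cbmeas g -> cbmeas (fun t => f t * g t).
Proof.
move=> [? ?] [? ?]; split.
  by under eq_fun do rewrite ReM; apply: bmeasB; exact: bmeasM.
by under eq_fun do rewrite ImM; apply: bmeasD; exact: bmeasM.
Qed.

Lemma cbmeasN f : cbmeas f -> cbmeas (fun t => - f t).
Proof.
by move=> H; under eq_fun do rewrite -mulN1r; apply: cbmeasM => //; exact: cbmeas_cst.
Qed.

Lemma cbmeasB f g : cbmeas f -> cbmeas g -> cbmeas (fun t => f t - g t).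
Proof. by move=> hu hv; apply: cbmeasD => //; apply: cbmeasN. Qed.

Lemma cbmeasJ f : cbmeas f -> cbmeas (fun t => conjc (f t)).
Proof.
move=> [? ?]; split.
  by under eq_fun do rewrite ReJ.
by under eq_fun do rewrite ImJ; exact: bmeasN.
Qed.

Lemma cbmeasX f n : cbmeas f -> cbmeas (fun t => f t ^+ n).
Proof.
move=> H; elim: n => [|n IH].
  by under eq_fun do rewrite expr0; exact: cbmeas_cst.
by under eq_fun do rewrite exprS; exact: cbmeasM.
Qed.

Lemma cbmeas_sum (I : Type) (s : seq I) (F : I -> R -> R[i]) :
  (forall i, cbmeas (F i)) -> cbmeas (fun t => \sum_(i <- s) F i t).
Proof.
move=> H; elim: s => [|i s IH].
  by under eq_fun do rewrite big_nil; exact: cbmeas_cst.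
by under eq_fun do rewrite big_cons; exact: cbmeasD.
Qed.

Lemma cbmeas_real u : bmeas u -> cbmeas (fun t => (u t)%:C).
Proof. by move=> H; split => //=; exact: bmeas_cst. Qed.

Lemma cbmeas_expi : cbmeas (fun t => ei t).
Proof.
split; [under eq_fun do rewrite Re_ei|under eq_fun do rewrite Im_ei]; split.
- by apply: continuous_measurable_fun; exact: continuous_cos.
- by exists 1 => t; rewrite ler_norml cos_le1 cos_geN1.
- by apply: continuous_measurable_fun; exact: continuous_sin.
- by exists 1 => t; rewrite ler_norml sin_le1 sin_geN1.
Qed.

Lemma Re_cavg f : Re (cavg f) = avg (fun t => Re (f t)).
Proof. by rewrite cavg.unlock avg.unlock. Qed.

Lemma Im_cavg f : Im (cavg f) = avg (fun t => Im (f t)).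
Proof. by rewrite cavg.unlock avg.unlock. Qed.

Lemma avgD u v : bmeas u -> bmeas v -> avg (fun t => u t + v t) = avg u + avg v.
Proof. by move=> hu hv; rewrite avg.unlock; apply: RintegralD => //; exact: bmeas_integrable. Qed.

Lemma avgB u v : bmeas u -> bmeas v -> avg (fun t => u t - v t) = avg u - avg v.
Proof. by move=> hu hv; rewrite avg.unlock; apply: RintegralB => //; exact: bmeas_integrable. Qed.

Lemma avgZ k u : bmeas u -> avg (fun t => k * u t) = k * avg u.
Proof. by move=> hu; rewrite avg.unlock; apply: RintegralZl => //; exact: bmeas_integrable. Qed.

Lemma avg_cst (k : R) : avg (fun=> k) = k.
Proof. by rewrite avg.unlock Rintegral_cst // [mu _]dtheta2pi_setT mulr1. Qed.

Lemma le_avg u v : bmeas u -> bmeas v -> (forall t, u t <= v t) -> avg u <= avg v.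
Proof. by move=> hu hv uv; rewrite avg.unlock; apply: le_Rintegral => //; exact: bmeas_integrable. Qed.

Lemma avg_ge0 u : (forall t, 0 <= u t) -> 0 <= avg u.
Proof. by move=> H; rewrite avg.unlock; apply: Rintegral_ge0. Qed.

Lemma avg_le u M : bmeas u -> (forall t, u t <= M) -> avg u <= M.
Proof. by move=> hu H; rewrite -[leRHS]avg_cst; apply: le_avg => //; exact: bmeas_cst. Qed.

Lemma eq_avg u v : u =1 v -> avg u = avg v.
Proof. by move=> /funext ->. Qed.

Lemma eq_cavg f g : f =1 g -> cavg f = cavg g.
Proof. by move=> /funext ->. Qed.

Lemma cavgD f g : cbmeas f -> cbmeas g -> cavg (fun t => f t + g t) = cavg f + cavg g.
Proof. by move=> hf hg; rewrite cavg.unlock; apply: cintD => //; exact: cbmeas_cintegrable. Qed.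

Lemma cavgB f g : cbmeas f -> cbmeas g -> cavg (fun t => f t - g t) = cavg f - cavg g.
Proof. by move=> hf hg; rewrite cavg.unlock; apply: cintB => //; exact: cbmeas_cintegrable. Qed.

Lemma cavgZ k f : cbmeas f -> cavg (fun t => k * f t) = k * cavg f.
Proof. by move=> hf; rewrite cavg.unlock; apply: cintZ => //; exact: cbmeas_cintegrable. Qed.

Lemma cavgJ f : cbmeas f -> cavg (fun t => conjc (f t)) = conjc (cavg f).
Proof. by move=> hf; rewrite cavg.unlock; apply: cintJ => //; exact: cbmeas_cintegrable. Qed.

Lemma cavg_sum (I : eqType) (s : seq I) (F : I -> R -> R[i]) : (forall i, cbmeas (F i)) ->
  cavg (fun t => \sum_(i <- s) F i t) = \sum_(i <- s) cavg (F i).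
Proof. by move=> H; rewrite cavg.unlock; apply: cint_sum => // i _; exact: cbmeas_cintegrable. Qed.

Lemma cavg_cst (k : R[i]) : cavg (fun=> k) = k.
Proof. by apply: complex_eqP; rewrite ?Re_cavg ?Im_cavg avg_cst. Qed.

Lemma cavg_real u : cavg (fun t => (u t)%:C) = (avg u)%:C.
Proof. by apply: complex_eqP; rewrite ?Re_cavg ?Im_cavg ?avg_cst. Qed.

Lemma le_normc_cavg f : cbmeas f -> normc (cavg f) <= avg (fun t => normc (f t)).
Proof. by move=> hf; rewrite cavg.unlock avg.unlock; apply: le_normc_cint => //; exact: cbmeas_cintegrable. Qed.

Lemma normc_cavg_le f M : cbmeas f -> (forall t, normc (f t) <= M) -> normc (cavg f) <= M.
Proof.
move=> hf H; rewrite (le_trans (le_normc_cavg _ hf)) //.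
by apply: avg_le => //; exact: cbmeas_normc.
Qed.

Lemma cos_lip s t : `|cos s - cos t| <= `|s - t|.
Proof.
wlog st : s t / t <= s.
  by move=> H; case: (leP t s) => [/H //|/ltW /H]; rewrite distrC [leRHS]distrC.
have [|c _ ->] := @MVT_segment R cos (fun x => - sin x) t s st.
  by apply: continuous_subspaceT => x; exact: continuous_cos.
by rewrite normrM ler_piMl // normrN ler_norml sin_le1 sin_geN1.
Qed.

Lemma sin_lip s t : `|sin s - sin t| <= `|s - t|.
Proof.
wlog st : s t / t <= s.
  by move=> H; case: (leP t s) => [/H //|/ltW /H]; rewrite distrC [leRHS]distrC.
have [|c _ ->] := @MVT_segment R sin cos t s st.
  by apply: continuous_subspaceT => x; exact: continuous_sin.
by rewrite normrM ler_piMl // ler_norml cos_le1 cos_geN1.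
Qed.

Lemma ei_lip s t : normc (ei s - ei t) <= 2 * `|s - t|.
Proof.
rewrite (le_trans (normc_le_ReIm _)) // mulr_natl mulr2n ReDc ImDc ReNc ImNc !Re_ei !Im_ei.
by apply: lerD; [exact: cos_lip|exact: sin_lip].
Qed.

Lemma continuous_ReIm f t : (forall e : R, 0 < e -> exists2 dl : R, 0 < dl &
    forall s, `|s - t| < dl -> normc (f s - f t) < e) ->
  {for t, continuous (fun s => Re (f s) : R)} /\ {for t, continuous (fun s => Im (f s) : R)}.
Proof.
move=> H; split; apply/cvgrPdist_lt => e /H[dl dl0 Hd];
  apply/nbhs_normP; exists dl => // s /=; rewrite distrC => /Hd le;
  rewrite distrC (le_lt_trans _ le) //.
  by rewrite -ReNc -ReDc normRe_le.
by rewrite -ImNc -ImDc normIm_le.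
Qed.

Lemma periodic_mod u : (forall s t, ei s = ei t -> u s = u t) ->
  forall t, exists2 s, s \in `[0, 2 * pi] & u t = u s.
Proof.
move=> H t; have [s [k [s0 s1 _ E]]] := ei_mod t.
by exists s; [rewrite in_itv /= s0 ltW|exact: H].
Qed.

(** Periodicity, in the form [ei s = ei t -> u s = u t], brings every value back to the compact
    interval [0, 2 pi], where the extreme value theorem bounds it. *)
Lemma bmeas_continuous_periodic u : continuous u ->
  (forall s t, ei s = ei t -> u s = u t) -> bmeas u.
Proof.
move=> cu pu; split; first exact: continuous_measurable_fun.
have p0 : 0 <= 2 * pi :> R by rewrite mulr_ge0 ?pi_ge0.
have cnu : {within `[0, 2 * pi], continuous (fun t => `|u t|)}.
  by apply: continuous_subspaceT => t; apply: cvg_norm; exact: cu.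
have [c cin Hc] := EVT_max p0 cnu.
exists `|u c| => t; have [s sin ->] := periodic_mod _ pu t.
exact: Hc.
Qed.

Lemma cbmeas_circle (F : R[i] -> R[i]) (c : R[i]) :
  (forall t, ccont F (c * ei t)) -> cbmeas (fun t => F (c * ei t)).
Proof.
move=> H.
have cF t : {for t, continuous (fun s => Re (F (c * ei s)) : R)} /\
            {for t, continuous (fun s => Im (F (c * ei s)) : R)}.
  apply: continuous_ReIm => e e0; have [dl dl0 Hd] := H t e e0.
  have K0 : 0 < 2 * (normc c + 1) by rewrite mulr_gt0 // ltr_wpDl ?normc_ge0.
  exists (dl / (2 * (normc c + 1))); first by rewrite divr_gt0.
  move=> s; rewrite ltr_pdivlMr // => st; apply: Hd.
  rewrite -mulrBr normcM (le_lt_trans _ st) //.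
  rewrite mulrC mulrA [_ * 2]mulrC ler_pM ?normc_ge0 ?ei_lip //.
  by rewrite lerDl.
split; apply: bmeas_continuous_periodic; do ?[by move=> s t ->].
  by move=> t; case: (cF t).
by move=> t; case: (cF t).
Qed.

Lemma ge0_integral_dtheta2pi (g : R -> \bar R) :
  measurable_fun [set: R] g -> (forall x, (0 <= g x)%E) ->
  (\int[mu]_x g x = ((2 * pi)^-1)%:E * \int[lebesgue_measure]_(x in `[0%R, (2 * pi)%R[) g x)%E.
Proof.
move=> mg g0; rewrite /dtheta2pi ge0_integral_mscale //=; congr (_ * _)%E.
have mD := @measurable_arc_domain R.
have mDC : measurable (~` (arc_domain : set (measurableTypeR R))) by exact: measurableC.
rewrite -(setUv (arc_domain : set (measurableTypeR R))) ge0_integral_setU //; last 2 first.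
- by apply: measurable_funS mg.
- exact/disj_setPCl.
rewrite [X in (_ + X)%E](_ : _ = 0%E) ?adde0.
  apply: eq_measure_integral => A mA AD.
  by rewrite /= /arc_length /mrestr /= (setIidl AD).
rewrite (eq_measure_integral mzero) ?integral_measure_zero // => A mA AD.
rewrite /= /arc_length /mrestr /= (_ : A `&` _ = set0) ?measure0 //.
by apply/seteqP; split => // x [/AD].
Qed.

Lemma avg_lebesgue u : bmeas u ->
  avg u = (2 * pi)^-1 * \int[lebesgue_measure]_(x in `[0, 2 * pi]) u x.
Proof.
move=> hu; have [mu1 [M HM]] := hu.
have p0 : 0 < 2 * pi :> R by rewrite mulr_gt0 ?pi_gt0.
have iu : lebesgue_measure.-integrable `[0, 2 * pi[ (EFin \o u).
  apply: measurable_bounded_integrable => //.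
  - by rewrite [ltLHS]lebesgue_measure_itv /= lte_fin p0 oppr0 adde0 ltry.
  - exact: measurable_funS mu1.
  - exists M; split; first exact: num_real.
    by move=> x Mx t _; exact: le_trans (HM t) (ltW Mx).
have mE : measurable_fun setT (EFin \o u) by exact/measurable_EFinP.
rewrite avg.unlock -Rintegral_itv_bndo_bndc // /Rintegral integralE [in RHS]integralE.
rewrite !ge0_integral_dtheta2pi //; last 2 first.
- exact: measurable_funeneg.
- exact: measurable_funepos.
rewrite -muleBr //; last first.
  rewrite fin_num_adde_defr // integrable_pos_fin_num //.
rewrite fineM //.
have := integrable_fin_num _ iu; rewrite integralE; exact.
Qed.

(** The real and imaginary parts are cos (n t) and sin (n t); their antiderivatives sin (n t) / n
    and - cos (n t) / n take equal values at 0 and 2 pi. *)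
Lemma cavg_expiX n : (0 < n)%N -> cavg (fun t => ei t ^+ n) = 0.
Proof.
move=> n0; have p0 : 0 < 2 * pi :> R by rewrite mulr_gt0 ?pi_gt0.
have nn0 : n%:R != 0 :> R by rewrite pnatr_eq0 -lt0n.
have E t : ei t ^+ n = ei (n%:R * t) by rewrite eiX mulr_natl.
have k2pi : ei (n%:R * (2 * pi)) = 1 :> R[i].
  by rewrite -(ei0 (R := R)) -(ei_period_int 0 n) add0r.
have ks : sin (n%:R * (2 * pi)) = 0 :> R by rewrite -Im_ei k2pi.
have kc : cos (n%:R * (2 * pi)) = 1 :> R by rewrite -Re_ei k2pi.
have hb := cbmeasX _ n cbmeas_expi.
have dlin (x : R) : is_derive x 1 (fun y : R => n%:R * y) n%:R.
  by have := is_deriveZ (n%:R : R) (is_derive_id x (1 : R)); rewrite /GRing.scale /= mulr1.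
have dE (F : R -> R) (F' : R -> R) (x : R) : (forall y : R, is_derive y 1 F (F' y)) ->
    is_derive x 1 (fun y => F (n%:R * y)) (n%:R * F' (n%:R * x)).
  by move=> dF; rewrite mulrC; exact: (is_derive1_comp (dF _) (dlin x)).
have ftc (F G : R -> R) : continuous F -> continuous G ->
    (forall x : R, is_derive x 1 F (G x)) ->
    \int[lebesgue_measure]_(x in `[0, 2 * pi]) G x = F (2 * pi) - F 0.
  move=> cF cG dF; rewrite /Rintegral (@continuous_FTC2 R G F) //.
  - exact: continuous_subspaceT.
  - split.
    + by move=> x _; have [] := dF x.
    + by apply: cvg_at_right_filter; exact: cF.
    + by apply: cvg_at_left_filter; exact: cF.
  - by move=> x _; rewrite derive1E; have [_ ->] := dF x.
have clin : continuous (fun x : R => n%:R * x).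
  by move=> x; apply: cvgMr; exact: cvg_id.
apply: complex_eqP.
  rewrite Re_cavg avg_lebesgue; last by case: hb.
  rewrite [X in _ * X](_ : _ = n%:R^-1 * sin (n%:R * (2 * pi)) - n%:R^-1 * sin (n%:R * 0)).
    by rewrite ks mulr0 [n%:R * 0]mulr0 sin0 mulr0 subr0 mulr0.
  apply: (ftc (fun x => n%:R^-1 * sin (n%:R * x)) (fun x => Re (ei x ^+ n))).
  - by move=> x; apply: cvgMr; apply: continuous_comp; [exact: clin|exact: continuous_sin].
  - move=> x; under eq_fun do rewrite E Re_ei.
    by apply: continuous_comp; [exact: clin|exact: continuous_cos].
  - move=> x; rewrite E Re_ei.
    have := is_deriveZ (n%:R^-1 : R) (dE sin cos x (@is_derive_sin R)).
    by rewrite /GRing.scale /= mulKf.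
rewrite Im_cavg avg_lebesgue; last by case: hb.
rewrite [X in _ * X](_ : _ = - n%:R^-1 * cos (n%:R * (2 * pi)) - (- n%:R^-1 * cos (n%:R * 0))).
  by rewrite kc [n%:R * 0]mulr0 cos0 subrr mulr0.
apply: (ftc (fun x => - n%:R^-1 * cos (n%:R * x)) (fun x => Im (ei x ^+ n))).
- by move=> x; apply: cvgMr; apply: continuous_comp; [exact: clin|exact: continuous_cos].
- move=> x; under eq_fun do rewrite E Im_ei.
  by apply: continuous_comp; [exact: clin|exact: continuous_sin].
- move=> x; rewrite E Im_ei.
  have := is_deriveZ (- n%:R^-1 : R) (dE cos (fun x => - sin x) x (@is_derive_cos R)).
  rewrite (_ : _ *: (_ * - sin _) = sin (n%:R * x)) //.
  by rewrite -[LHS]/(- n%:R^-1 * (n%:R * - sin (n%:R * x))) mulrN mulNr mulrN opprK mulKf.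
Qed.

Lemma cbmeas_expiXJ n : cbmeas (fun t => conjc (ei t) ^+ n).
Proof. by apply: cbmeasX; apply: cbmeasJ; exact: cbmeas_expi. Qed.

Lemma cavg_orthonormal m n :
  cavg (fun t => ei t ^+ m * conjc (ei t) ^+ n) = (m == n)%:R.
Proof.
wlog le : m n / (n <= m)%N.
  move=> H; have [/H //|/ltnW/H {}H] := leqP n m.
  rewrite eq_sym -[RHS]conjc_nat -H -cavgJ; last first.
    by apply: cbmeasM; [apply: cbmeasX; exact: cbmeas_expi|exact: cbmeas_expiXJ].
  by apply: eq_cavg => t; rewrite conjcM !conjcX conjcK mulrC.
rewrite -(subnK le).
under [X in cavg X]eq_fun do rewrite exprD -mulrA -exprMn ei_mulJ expr1n mulr1.
have [/eqP|mn] := posnP (m - n)%N.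
  rewrite subn_eq0 => mn; rewrite (_ : (m - n)%N = 0%N) ?add0n ?eqxx.
    by under [X in cavg X]eq_fun do rewrite expr0; exact: cavg_cst.
  by apply/eqP; rewrite subn_eq0.
by rewrite cavg_expiX // -[n in RHS]add0n eqn_add2r gtn_eqF.
Qed.

Definition fcoef f n := cavg (fun t => f t * conjc (ei t) ^+ n).
Definition trigp (c : nat -> R[i]) N t := \sum_(n < N) c n * ei t ^+ n.

Lemma cbmeas_trigp c N : cbmeas (trigp c N).
Proof.
by apply: cbmeas_sum => n; apply: cbmeasM; [exact: cbmeas_cst|apply: cbmeasX; exact: cbmeas_expi].
Qed.

Lemma cavg_trigpJ f c N : cbmeas f ->
  cavg (fun t => f t * conjc (trigp c N t)) = \sum_(n < N) conjc (c n) * fcoef f n.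
Proof.
move=> hf.
transitivity (cavg (fun t => \sum_(n < N) conjc (c n) * (f t * conjc (ei t) ^+ n))).
  apply: eq_cavg => t; rewrite /trigp conjc_sum mulr_sumr; apply: eq_bigr => n _.
  by rewrite conjcM conjcX mulrCA.
have H n : cbmeas (fun t => f t * conjc (ei t) ^+ n).
  by apply: cbmeasM => //; exact: cbmeas_expiXJ.
rewrite cavg_sum; first by apply: eq_bigr => n _; rewrite cavgZ.
by move=> n; apply: cbmeasM => //; exact: cbmeas_cst.
Qed.

Lemma fcoef_trigp c N n : fcoef (trigp c N) n = if (n < N)%N then c n else 0.
Proof.
transitivity (\sum_(m < N) c m * (m == n :> nat)%:R).
  rewrite /fcoef.
  transitivity (cavg (fun t => \sum_(m < N) c m * (ei t ^+ m * conjc (ei t) ^+ n))).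
    by apply: eq_cavg => t; rewrite /trigp mulr_suml; apply: eq_bigr => m _; rewrite mulrA.
  have H m : cbmeas (fun t => ei t ^+ m * conjc (ei t) ^+ n).
    by apply: cbmeasM; [apply: cbmeasX; exact: cbmeas_expi|exact: cbmeas_expiXJ].
  rewrite cavg_sum; first by apply: eq_bigr => m _; rewrite cavgZ // cavg_orthonormal.
  by move=> m; apply: cbmeasM => //; exact: cbmeas_cst.
case: ifPn => nN.
  rewrite (bigD1 (Ordinal nN)) //= eqxx mulr1 big1 ?addr0 // => m mn.
  rewrite (_ : (m == n :> nat) = false) ?mulr0 //.
  by apply: contraNF mn => /eqP mn; apply/eqP/val_inj.
apply: big1 => m _; rewrite (_ : (m == n :> nat) = false) ?mulr0 //.
by apply: contraNF nN => /eqP <-.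
Qed.

Lemma cavg_sqr f : cavg (fun t => f t * conjc (f t)) = (avg (fun t => normc (f t) ^+ 2))%:C.
Proof. by rewrite -cavg_real; apply: eq_cavg => t; rewrite mulc_conj. Qed.

Lemma parseval_trigp c N :
  avg (fun t => normc (trigp c N t) ^+ 2) = \sum_(n < N) normc (c n) ^+ 2.
Proof.
apply: complexI; rewrite -cavg_sqr cavg_trigpJ; last exact: cbmeas_trigp.
rewrite rmorph_sum; apply: eq_bigr => n _.
by rewrite fcoef_trigp ltn_ord mulrC mulc_conj.
Qed.

(** The mean square distance from [f] to its Fourier partial sum is nonnegative; both cross terms
    and the mean square of the partial sum are equal to the sum on the left. *)
Lemma bessel f N : cbmeas f ->
  \sum_(n < N) normc (fcoef f n) ^+ 2 <= avg (fun t => normc (f t) ^+ 2).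
Proof.
move=> hf; set c := fcoef f.
have hs : cbmeas (trigp c N) by exact: cbmeas_trigp.
have hd := cbmeasB _ _ hf hs.
have : 0 <= avg (fun t => normc (f t - trigp c N t) ^+ 2).
  by apply: avg_ge0 => t; exact: sqr_ge0.
rewrite -[in X in _ -> X]subr_ge0 -!lecR -cavg_sqr rmorphB /= -cavg_sqr; congr (0 <= _).
have -> : cavg (fun t => (f t - trigp c N t) * conjc (f t - trigp c N t))
  = cavg (fun t => (f t * conjc (f t) - f t * conjc (trigp c N t)) -
      (trigp c N t * conjc (f t) - trigp c N t * conjc (trigp c N t))).
  by apply: eq_cavg => t; rewrite conjcB; ring.
have hff : cbmeas (fun t => f t * conjc (f t)) by apply: cbmeasM => //; exact: cbmeasJ.
have hfs : cbmeas (fun t => f t * conjc (trigp c N t)) by apply: cbmeasM => //; exact: cbmeasJ.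
have hsf : cbmeas (fun t => trigp c N t * conjc (f t)) by apply: cbmeasM => //; exact: cbmeasJ.
have hss : cbmeas (fun t => trigp c N t * conjc (trigp c N t)) by apply: cbmeasM => //; exact: cbmeasJ.
rewrite !cavgB //; do ?exact: cbmeasB.
have -> : cavg (fun t => trigp c N t * conjc (f t)) = conjc (cavg (fun t => f t * conjc (trigp c N t))).
  by rewrite -cavgJ //; apply: eq_cavg => t; rewrite conjcM conjcK mulrC.
rewrite !cavg_sqr parseval_trigp cavg_trigpJ //.
have -> : \sum_(n < N) conjc (c n) * fcoef f n = (\sum_(n < N) normc (c n) ^+ 2)%:C.
  by rewrite rmorph_sum; apply: eq_bigr => n _; rewrite mulrC mulc_conj.
by rewrite conjc_real subrr subr0.
Qed.

End CircleAverage.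

Lemma normc_i {R : realType} : normc ('i : R[i]) = 1.
Proof. by rewrite /= expr0n expr1n add0r sqrtr1. Qed.

(** * Goursat's lemma and Taylor coefficients *)

Arguments normc {R} x : simpl never.
Arguments cint : simpl never.

Section Goursat.
Context {R : realType}.
Implicit Types (F : R[i] -> R[i]) (a b c d x y : R).
Local Notation leb := (@lebesgue_measure R).

Definition hseg F y a b := cint _ _ _ leb `[a, b] (fun x => F (x +i* y)).
Definition vseg F x c d := cint _ _ _ leb `[c, d] (fun y => F (x +i* y)).
(** The contour integral along the counterclockwise boundary: dz is dx on the horizontal sides and i
    dy on the vertical ones. *)
Definition rect_int F a b c d : R[i] :=
  hseg F c a b - hseg F d a b + 'i * (vseg F b c d - vseg F a c d).

Lemma path_integrable F (g : R -> R[i]) a b : (forall s t, normc (g s - g t) <= `|s - t|) ->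
  (forall t, a <= t <= b -> ccont F (g t)) ->
  cintegrable _ _ _ leb `[a, b] (fun t => F (g t)).
Proof.
move=> Hg HF.
have C t : t \in `[a, b] -> {for t, continuous (fun s => Re (F (g s)) : R)} /\
            {for t, continuous (fun s => Im (F (g s)) : R)}.
  rewrite in_itv /= => /HF cF; apply: continuous_ReIm => e e0; have [dl dl0 Hd] := cF e e0.
  by exists dl => // s st; apply: Hd; exact: le_lt_trans (Hg _ _) st.
split; apply: continuous_compact_integrable; do ?exact: segment_compact.
  apply: continuous_in_subspaceT => t /set_mem tin; by have [] := C t tin.
apply: continuous_in_subspaceT => t /set_mem tin; by have [] := C t tin.
Qed.

Lemma hpath_lip y (s t : R) : normc ((s +i* y) - (t +i* y)) <= `|s - t|.
Proof. by rewrite [_ - _](_ : _ = (s - t)%:C) ?normcR //; apply: complex_eqP; rewrite /= ?subrr. Qed.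

Lemma vpath_lip x (s t : R) : normc ((x +i* s) - (x +i* t)) <= `|s - t|.
Proof.
rewrite [_ - _](_ : _ = 'i * (s - t)%:C) ?normcM ?normcR; last first.
  by apply: complex_eqP; rewrite /= ?subrr; ring.
by rewrite normc_i mul1r.
Qed.

Lemma cint_split (f : R -> R[i]) a m b : a <= m -> m <= b ->
  cintegrable _ _ _ leb `[a, b] f ->
  cint _ _ _ leb `[a, b] f = cint _ _ _ leb `[a, m] f + cint _ _ _ leb `[m, b] f.
Proof.
move=> am mb [f1 f2].
have S (u : R -> R) : leb.-integrable `[a, b] (EFin \o u) ->
    \int[leb]_(x in `[a, b]) u x = \int[leb]_(x in `[a, m]) u x + \int[leb]_(x in `[m, b]) u x.
  move=> iu; have := Rintegral_itvB (x := m) iu; rewrite !bnd_simp => /(_ am mb) H.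
  rewrite -[\int[leb]_(x in `[m, b]) _]Rintegral_itv_obnd_cbnd; last first.
    apply: integrableS iu => //; apply: subset_itvr; by rewrite bnd_simp.
  by rewrite -H addrC subrK.
by apply: complex_eqP => /=; apply: S.
Qed.

Lemma Rintegral_itv_cst a b (k : R) : a <= b -> \int[leb]_(x in `[a, b]) k = k * (b - a).
Proof.
move=> ab; rewrite Rintegral_cst //; congr (_ * _).
rewrite -[LHS]/(fine (leb `[a, b])) [X in fine X]lebesgue_measure_itv /= lte_fin.
by case: ltP => // ba; rewrite (_ : b = a) ?subrr //; apply/eqP; rewrite eq_le ab ba.
Qed.

Lemma normc_cint_le (f : R -> R[i]) a b (M : R) : a <= b ->
  cintegrable _ _ _ leb `[a, b] f -> (forall t, a <= t <= b -> normc (f t) <= M) ->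
  normc (cint _ _ _ leb `[a, b] f) <= M * (b - a).
Proof.
move=> ab hf HM.
apply: le_trans (le_normc_cint _ _ _ _ _ _ _ hf) _ => //.
rewrite (_ : M * (b - a) = \int[leb]_(x in `[a, b]) M).
  apply: le_Rintegral => //; first exact: cintegrable_normc.
    apply: measurable_bounded_integrable => //.
      by rewrite [ltLHS]lebesgue_measure_itv /=; case: ifP => // _; rewrite ltry.
    by exists `|M|; split; [exact: num_real|move=> x Mx t _ /=; exact: ltW].
by rewrite Rintegral_itv_cst.
Qed.

Section Rectangle.
Variables (F : R[i] -> R[i]) (a b c d : R).
Hypotheses (ab : a <= b) (cd : c <= d).
Hypothesis HF : forall x y, a <= x <= b -> c <= y <= d -> ccont F (x +i* y).

Lemma hseg_integrable x1 x2 y : a <= x1 -> x2 <= b -> c <= y <= d ->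
  cintegrable _ _ _ leb `[x1, x2] (fun x => F (x +i* y)).
Proof.
move=> ax xb cyd; apply: (path_integrable F (fun x => x +i* y)); first exact: hpath_lip.
move=> t /andP[t1 t2]; apply: HF => //.
by rewrite (le_trans ax t1) (le_trans t2 xb).
Qed.

Lemma vseg_integrable y1 y2 x : c <= y1 -> y2 <= d -> a <= x <= b ->
  cintegrable _ _ _ leb `[y1, y2] (fun y => F (x +i* y)).
Proof.
move=> ax xb cyd; apply: (path_integrable F (fun y => x +i* y)); first exact: vpath_lip.
move=> t /andP[t1 t2]; apply: HF => //.
by rewrite (le_trans ax t1) (le_trans t2 xb).
Qed.

Lemma rect_int_split m n : a <= m <= b -> c <= n <= d ->
  rect_int F a b c d = rect_int F a m c n + rect_int F m b c n
                       + rect_int F a m n d + rect_int F m b n d.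
Proof.
move=> /andP[am mb] /andP[cn nd]; rewrite /rect_int /hseg /vseg.
rewrite (cint_split _ a m b) ?(cint_split (fun x => F (x +i* d)) a m b) //;
  do ?by apply: hseg_integrable; rewrite ?lexx ?cd.
rewrite (cint_split _ c n d) ?(cint_split (fun y => F (a +i* y)) c n d) //;
  do ?by apply: vseg_integrable; rewrite ?lexx ?ab.
ring.
Qed.

Lemma normc_rect_int_le (M : R) :
  (forall x y, a <= x <= b -> c <= y <= d -> normc (F (x +i* y)) <= M) ->
  normc (rect_int F a b c d) <= 2 * M * ((b - a) + (d - c)).
Proof.
move=> HM; rewrite /rect_int (le_trans (le_normcD _ _)) // normcM.
rewrite normc_i mul1r.
have H y : c <= y <= d -> normc (hseg F y a b) <= M * (b - a).
  by move=> cyd; apply: normc_cint_le => //; [exact: hseg_integrable|move=> t ?; exact: HM].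
have V x : a <= x <= b -> normc (vseg F x c d) <= M * (d - c).
  by move=> cyd; apply: normc_cint_le => //; [exact: vseg_integrable|move=> t ?; exact: HM].
have := le_normcD (hseg F c a b) (- hseg F d a b).
have := le_normcD (vseg F b c d) (- vseg F a c d); rewrite !normcN.
have := H c; have := H d; have := V a; have := V b; rewrite !lexx ab cd /= => /(_ isT) + /(_ isT) + /(_ isT) + /(_ isT).
lra.
Qed.

End Rectangle.

Lemma ccont_affine (u v z : R[i]) : ccont (fun w => u + v * w) z.
Proof.
move=> e e0; have K0 : 0 < normc v + 1 by rewrite ltr_wpDl ?normc_ge0.
exists (e / (normc v + 1)); first by rewrite divr_gt0.
move=> w; rewrite ltr_pdivlMr // => H.
rewrite [_ - _](_ : _ = v * (w - z)); last by ring.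
rewrite normcM (le_lt_trans _ H) // mulrC ler_wpM2l ?normc_ge0 //.
by rewrite lerDl.
Qed.

Lemma ccontB F G z : ccont F z -> ccont G z -> ccont (fun w => F w - G w) z.
Proof.
move=> cF cG e e0; have e2 : 0 < e / 2 by rewrite divr_gt0.
have [r1 r10 H1] := cF _ e2; have [r2 r20 H2] := cG _ e2.
exists (Num.min r1 r2); first by rewrite lt_min r10.
move=> w; rewrite lt_min => /andP[/H1 h1 /H2 h2].
rewrite [_ - _](_ : _ = (F w - F z) - (G w - G z)); last by ring.
by rewrite (le_lt_trans (le_normcD _ _)) // normcN [ltRHS](splitr e) ltrD.
Qed.

Arguments rect_int : simpl never.

Lemma rect_int_affine (u v : R[i]) a b c d : a <= b -> c <= d ->
  rect_int (fun w => u + v * w) a b c d = 0.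
Proof.
move=> ab cd.
have ic (s t : R) (k : R[i]) : cintegrable _ _ _ leb `[s, t] (fun=> k).
  by apply: (path_integrable (fun=> k) (fun t => t%:C)) => [s1 t1|t1 _ e e0];
    [rewrite -rmorphB normcR|exists 1 => // w _; rewrite subrr (@normc0 R)].
have ih (s t y : R) : cintegrable _ _ _ leb `[s, t] (fun x => u + v * (x +i* y)).
  by apply: (path_integrable (fun w => u + v * w) (fun x => x +i* y) s t (hpath_lip y)) => t1 _; exact: ccont_affine.
have iv (s t x : R) : cintegrable _ _ _ leb `[s, t] (fun y => u + v * (x +i* y)).
  by apply: (path_integrable (fun w => u + v * w) (fun y => x +i* y) s t (vpath_lip x)) => t1 _; exact: ccont_affine.
have kc (s t : R) (k : R[i]) : s <= t -> cint _ _ _ leb `[s, t] (fun=> k) = (t - s)%:C * k.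
  move=> st.
  by apply: complex_eqP; rewrite /= Rintegral_itv_cst //; case: k => k1 k2 /=; ring.
rewrite /rect_int /hseg /vseg -!cintB //.
rewrite (eq_cint _ _ _ _ _ _ (fun=> - v * 'i * (d - c)%:C)); last first.
  by move=> x _; apply: complex_eqP; rewrite !(ReDc, ImDc, ReNc, ImNc, ReM, ImM) /=; ring.
rewrite [X in _ + 'i * X](eq_cint _ _ _ _ _ _ (fun=> v * (b - a)%:C)); last first.
  by move=> x _; apply: complex_eqP; rewrite !(ReDc, ImDc, ReNc, ImNc, ReM, ImM) /=; ring.
by rewrite !kc //; ring.
Qed.

Lemma rect_int_subaffine F (u v : R[i]) a b c d : a <= b -> c <= d ->
  (forall x y, a <= x <= b -> c <= y <= d -> ccont F (x +i* y)) ->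
  rect_int F a b c d = rect_int (fun w => F w - (u + v * w)) a b c d.
Proof.
move=> ab cd HF.
rewrite -[LHS]subr0 -(rect_int_affine u v _ _ _ _ ab cd) /rect_int /hseg /vseg.
have HA x y : a <= x <= b -> c <= y <= d -> ccont (fun w => u + v * w) (x +i* y).
  by move=> _ _; exact: ccont_affine.
rewrite !cintB //; do ?by [apply: (hseg_integrable _ _ _ _ _ HF); rewrite ?lexx ?ab ?cd
  | apply: (vseg_integrable _ _ _ _ _ HF); rewrite ?lexx ?ab ?cd
  | apply: (hseg_integrable _ _ _ _ _ HA); rewrite ?lexx ?ab ?cd
  | apply: (vseg_integrable _ _ _ _ _ HA); rewrite ?lexx ?ab ?cd].
ring.
Qed.

Lemma geometric_small (C dl : R) : 0 < dl -> exists k, C * (2^-1) ^+ k < dl.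
Proof.
move=> dl0; apply: contrapT => H; suff : dl <= 0 by rewrite leNgt dl0.
apply: (le_geometric_eq0 dl C 2^-1); first by rewrite invr_ge0 ler0n /= invf_lt1 ?ltr1n.
by move=> k; rewrite leNgt; apply/negP => Hk; apply: H; exists k.
Qed.

Lemma nested_point (x W : nat -> R) :
  (forall k, 0 <= W k) -> (forall k, x k <= x k.+1) ->
  (forall k, x k.+1 + W k.+1 <= x k + W k) -> exists X, forall k, x k <= X <= x k + W k.
Proof.
move=> W0 x1 x2.
have mx m n : (m <= n)%N -> x m <= x n.
  by move=> /subnK <-; elim: (n - m)%N => // j IH; exact: le_trans IH (x1 _).
have mW m n : (m <= n)%N -> x n + W n <= x m + W m.
  by move=> /subnK <-; elim: (n - m)%N => // j IH; exact: le_trans (x2 _) IH.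
have B m k : x m <= x k + W k.
  rewrite (le_trans (mx _ _ (leq_maxl m k))) // (le_trans _ (mW _ _ (leq_maxr m k))) //.
  by rewrite lerDl.
have ne : range x !=set0 by exists (x 0%N); exists 0%N.
have hs : has_sup (range x).
  by split => //; exists (x 0%N + W 0%N) => _ [m _ <-].
exists (sup (range x)) => k; apply/andP; split.
  by apply: sup_upper_bound => //; exists k.
by apply: ge_sup => // _ [m _ <-].
Qed.

Lemma normc_add4_lt (x y z w : R[i]) (e : R) :
  normc x < e -> normc y < e -> normc z < e -> normc w < e -> normc (x + y + z + w) < e * 4.
Proof.
have := le_normcD (x + y + z) w; have := le_normcD (x + y) z; have := le_normcD x y.
set n1 := normc (x + y); set n2 := normc (x + y + z); set n3 := normc (x + y + z + w).
by move: n1 n2 n3 (normc x) (normc y) (normc z) (normc w) => *; lra.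
Qed.

Lemma goursat F a b c d : a <= b -> c <= d ->
  (forall x y, a <= x <= b -> c <= y <= d -> exists D, cder F (x +i* y) D) ->
  rect_int F a b c d = 0.
Proof.
move=> ab cd HF.
have cF x y : a <= x <= b -> c <= y <= d -> ccont F (x +i* y).
  by move=> hx hy; have [D] := HF x y hx hy; exact: cder_ccont.
pose w := b - a; pose h := d - c.
have w0 : 0 <= w by rewrite subr_ge0.
have h0 : 0 <= h by rewrite subr_ge0.
pose W k := w * 2^-1 ^+ k; pose H k := h * 2^-1 ^+ k.
have i2 : 0 <= 2^-1 :> R by rewrite invr_ge0.
have W0 k : 0 <= W k by rewrite mulr_ge0 // exprn_ge0.
have H0 k : 0 <= H k by rewrite mulr_ge0 // exprn_ge0.
have WS k : W k = W k.+1 + W k.+1 by rewrite /W exprS; field.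
have HS k : H k = H k.+1 + H k.+1 by rewrite /H exprS; field.
set M := normc (rect_int F a b c d).
pose Q k (p : R * R) := rect_int F p.1 (p.1 + W k) p.2 (p.2 + H k).
pose good (k : nat) (p : R * R) := [/\ a <= p.1, p.1 + W k <= b, c <= p.2, p.2 + H k <= d &
   M * 4^-1 ^+ k <= normc (Q k p)].
(* If every quarter had an integral smaller than [M * 4^-1 ^+ k.+1], the four together would stay
   below [M * 4^-1 ^+ k]. *)
have step k p : good k p -> exists p', good k.+1 p' /\
   [/\ p.1 <= p'.1, p'.1 + W k.+1 <= p.1 + W k, p.2 <= p'.2 & p'.2 + H k.+1 <= p.2 + H k].
  case: p => x y [/= ax xb cy yd HM]; have Wk := W0 k.+1; have Hk := H0 k.+1.
  apply: contrapT => /forallNP NG.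
  have small x' y' : (x' = x \/ x' = x + W k.+1) -> (y' = y \/ y' = y + H k.+1) ->
      normc (Q k.+1 (x', y')) < M * 4^-1 ^+ k.+1.
    move=> hx hy; rewrite ltNge; apply/negP => le; apply: (NG (x', y')).
    rewrite /good /= le.
    have [x1 x2 x3] : [/\ a <= x', x' + W k.+1 <= x + W k & x <= x'].
      rewrite (WS k); case: hx => ->; split => //; rewrite ?addrA // ?lerDl //.
      by rewrite ler_wpDr.
    have [y1 y2 y3] : [/\ c <= y', y' + H k.+1 <= y + H k & y <= y'].
      rewrite (HS k); case: hy => ->; split => //; rewrite ?addrA // ?lerDl //.
      by rewrite ler_wpDr.
    by split; split => //; [exact: le_trans x2 xb|exact: le_trans y2 yd].
  have E : Q k (x, y) = Q k.+1 (x, y) + Q k.+1 (x + W k.+1, y)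
                      + Q k.+1 (x, y + H k.+1) + Q k.+1 (x + W k.+1, y + H k.+1).
    rewrite {1}/Q /= (rect_int_split _ _ _ _ _ _ _ _ (x + W k.+1) (y + H k.+1)).
    - by rewrite /Q /= -(addrA x) -(addrA y) -WS -HS.
    - by rewrite lerDl.
    - by rewrite lerDl.
    - move=> x' y' /andP[l1 l2] /andP[l3 l4]; apply: cF.
        by rewrite (le_trans ax l1) (le_trans l2 xb).
      by rewrite (le_trans cy l3) (le_trans l4 yd).
    - by rewrite lerDl Wk (WS k) lerD2l lerDl.
    - by rewrite lerDl Hk (HS k) lerD2l lerDl.
  move: HM; rewrite E leNgt => /negP; apply.
  have := small x y (or_introl erefl) (or_introl erefl).
  have := small (x + W k.+1) y (or_intror erefl) (or_introl erefl).
  have := small x (y + H k.+1) (or_introl erefl) (or_intror erefl).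
  have := small (x + W k.+1) (y + H k.+1) (or_intror erefl) (or_intror erefl).
  set A1 := Q _ _; set A2 := Q _ _; set A3 := Q _ _; set A4 := Q _ _ => s1 s2 s3 s4.
  have -> : M * 4^-1 ^+ k = M * 4^-1 ^+ k.+1 * 4 by rewrite exprS; field.
  exact: normc_add4_lt s4 s3 s2 s1.
(* The relation is guarded by [good u.1 u.2] so that every pair has a successor, as dependent choice
   requires; a pair that is not good is its own successor. *)
pose Rel (u v : nat * (R * R)) := good u.1 u.2 -> v.1 = u.1.+1 /\ good v.1 v.2 /\
   [/\ u.2.1 <= v.2.1, v.2.1 + W v.1 <= u.2.1 + W u.1, u.2.2 <= v.2.2 & v.2.2 + H v.1 <= u.2.2 + H u.1].
have Hrel u : {v | Rel u v}.
  apply: cid; case: u => k p; have [G|NG] := pselect (good k p).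
    by have [p' [G' N']] := step k p G; exists (k.+1, p').
  by exists (k, p).
have [f [f0 fS]] := dependent_choice Hrel (0%N, (a, c)).
have Gf k : (f k).1 = k /\ good (f k).1 (f k).2.
  elim: k => [|k [IH1 IH2]].
    rewrite f0 /good /= /Q /W /H /= !expr0 !mulr1 /w /h ![_ + (_ - _)]addrC !subrK.
    by split => //; split.
  have [e1 [G _]] := fS k IH2; split; last exact: G.
  by rewrite e1 IH1.
pose x k := (f k).2.1; pose y k := (f k).2.2.
have N k : [/\ x k <= x k.+1, x k.+1 + W k.+1 <= x k + W k, y k <= y k.+1 & y k.+1 + H k.+1 <= y k + H k].
  have [e1 G1] := Gf k; have [e2 _] := Gf k.+1.
  by have [_ [_]] := fS k G1; rewrite e1 e2.
have [X HX] : exists X, forall k, x k <= X <= x k + W k.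
  by apply: nested_point => // k; case: (N k).
have [Y HY] : exists Y, forall k, y k <= Y <= y k + H k.
  by apply: nested_point => // k; case: (N k).
have G k : good k (x k, y k).
  by have [e1 G1] := Gf k; move: G1; rewrite e1 /x /y -surjective_pairing.
have [D HD] : exists D, cder F (X +i* Y) D.
  have [/= g1 g2 g3 g4 _] := G 0%N.
  have /andP[u1 u2] := HX 0%N; have /andP[v1 v2] := HY 0%N.
  by apply: HF; rewrite ?(le_trans g1 u1) ?(le_trans u2 g2) ?(le_trans g3 v1) ?(le_trans v2 g4).
(* Subtracting the affine part of [F] at the common point of the rectangles changes no integral and
   leaves a function bounded by [e * S] on a rectangle of half perimeter [S]. The bound
   [2 * e * S ^+ 2] carries the same factor [4^-1 ^+ k] as the lower bound, which cancels. *)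
have key (e : R) : 0 < e -> M <= 2 * e * (w + h) ^+ 2.
  move=> e0; have [dl dl0 Hdl] := HD e e0.
  have [k Hk] := geometric_small (w + h) _ dl0.
  have [/= g1 g2 g3 g4 g5] := G k.
  have /andP[u1 u2] := HX k; have /andP[v1 v2] := HY k.
  have SE : W k + H k = (w + h) * 2^-1 ^+ k by rewrite [in RHS]mulrDl.
  pose S := W k + H k.
  have S0 : 0 <= S by rewrite addr_ge0.
  have := g5; rewrite /Q /=.
  have xW : x k <= x k + W k by rewrite lerDl.
  have yH : y k <= y k + H k by rewrite lerDl.
  have cFk x' y' : x k <= x' <= x k + W k -> y k <= y' <= y k + H k -> ccont F (x' +i* y').
    move=> /andP[l1 l2] /andP[l3 l4]; apply: cF.
      by rewrite (le_trans g1 l1) (le_trans l2 g2).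
    by rewrite (le_trans g3 l3) (le_trans l4 g4).
  rewrite (rect_int_subaffine _ (F (X +i* Y) - D * (X +i* Y)) D) //.
  set z := X +i* Y => le1.
  have le2 : normc (rect_int (fun v => F v - (F z - D * z + D * v)) (x k) (x k + W k) (y k) (y k + H k))
      <= 2 * (e * S) * S.
    have -> : 2 * (e * S) * S = 2 * (e * S) * ((x k + W k - x k) + (y k + H k - y k)).
      by rewrite /S; ring.
    apply: normc_rect_int_le => //.
      by move=> x' y' l1 l2; apply: ccontB; [exact: cFk|exact: ccont_affine].
    move=> x' y' /andP[l1 l2] /andP[l3 l4].
    have dist : normc ((x' +i* y') - z) <= S.
      rewrite (le_trans (normc_le_ReIm _)) //= lerD // ler_norml; lra.
    have := Hdl ((x' +i* y') - z); rewrite (le_lt_trans dist) /S ?SE ?Hk // => /(_ isT).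
    rewrite -/z [z + _]addrC subrK => le3.
    rewrite (_ : _ - _ = F (x' +i* y') - F z - D * (x' +i* y' - z)); last by ring.
    by rewrite (le_trans le3) // -SE ler_wpM2l // ltW.
  have := le_trans le1 le2.
  have -> : 2 * (e * S) * S = 2 * e * (w + h) ^+ 2 * 4^-1 ^+ k.
    have -> : 4^-1 = 2^-1 ^+ 2 :> R by field.
    by rewrite /S SE -exprM mulnC exprM; ring.
  by rewrite ler_pM2r // exprn_gt0 // invr_gt0.
apply: contrapT => /eqP; rewrite -normc_gt0 -/M => M0.
(* The factor 4 makes [2 * (w + h) ^+ 2 / K] less than 1, and the added 1 keeps [K] positive for a
   degenerate rectangle. *)
have K0 : 0 < 4 * ((w + h) ^+ 2 + 1) by rewrite mulr_gt0 // ltr_wpDl ?sqr_ge0.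
set K := 4 * _ in K0.
have := key (M / K); rewrite divr_gt0 // => /(_ isT).
rewrite (_ : 2 * (M / K) * (w + h) ^+ 2 = M * (2 * (w + h) ^+ 2 / K)); last by ring.
rewrite leNgt => /negP; apply.
rewrite -[ltRHS]mulr1 ltr_pM2l // ltr_pdivrMr // mul1r /K.
by have := sqr_ge0 (w + h); lra.
Qed.

End Goursat.

(** Cauchy's coefficient formula on the circle of radius 1/2; the radius is arbitrary, as
    [fcoef_circle] shows. *)
HB.lock Definition taylor {R : realType} (f : R[i] -> R[i]) (n : nat) : R[i] :=
  fcoef (fun t => f (2^-1%:C * ei t)) n * 2 ^+ n.

(** * Independence of the radius *)

Section TaylorCoefficients.
Context {R : realType}.
Implicit Types (f g : R[i] -> R[i]) (r : R).

Lemma cexp_ln r (t : R) : 0 < r -> cexp (ln r +i* t) = r%:C * ei t.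
Proof. by move=> r0; rewrite cexpE /= lnK ?posrE. Qed.

Lemma normc_rexpi r (t : R) : 0 <= r -> normc (r%:C * ei t) = r.
Proof. by move=> r0; rewrite normcM normc_expi mulr1 normcR ger0_norm. Qed.

Lemma normc_rexpi01 r (t : R) : 0 < r -> r < 1 -> 0 < normc (r%:C * ei t) < 1.
Proof. by move=> r0 r1; rewrite normc_rexpi ?r0 // ltW. Qed.

Lemma cavg_vseg g r : 0 < r -> r < 1 -> (forall z, 0 < normc z < 1 -> cdiff g z) ->
  cavg (fun t => g (r%:C * ei t)) =
  ((2 * pi)^-1)%:C * vseg (fun z => g (cexp z)) (ln r) 0 (2 * pi).
Proof.
move=> r0 r1 dg.
have [h1 h2] : cbmeas (fun t => g (r%:C * ei t)).
  by apply: (cbmeas_circle g r%:C) => t; apply: cdiff_ccont; apply: dg; exact: normc_rexpi01.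
apply: complex_eqP; rewrite ?Re_mulr ?Im_mulr.
  rewrite Re_cavg (avg_lebesgue _ h1); congr (_ * _).
  by apply: eq_Rintegral => t _; rewrite cexp_ln.
rewrite Im_cavg (avg_lebesgue _ h2); congr (_ * _).
by apply: eq_Rintegral => t _; rewrite cexp_ln.
Qed.

(** Goursat's lemma for the composite of [g] with [cexp]: in the coordinate log z the annulus is a
    rectangle of height 2 pi, the horizontal sides cancel by periodicity and the vertical sides are
    the two averages. A singularity of [g] at 0 does no harm. *)
Lemma cavg_circle_const g r1 r2 : 0 < r1 -> r1 <= r2 -> r2 < 1 ->
  (forall z, 0 < normc z < 1 -> cdiff g z) ->
  cavg (fun t => g (r1%:C * ei t)) = cavg (fun t => g (r2%:C * ei t)).
Proof.
move=> r10 r12 r21 dg.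
have p0 : 0 <= 2 * pi :> R by rewrite mulr_ge0 ?pi_ge0.
have r20 : 0 < r2 by exact: lt_le_trans r12.
pose F : R[i] -> R[i] := fun z => g (cexp z).
have ln12 : ln r1 <= ln r2 by rewrite ler_ln.
have := @goursat _ F (ln r1) (ln r2) 0 (2 * pi) ln12 p0.
have dF x y : ln r1 <= x <= ln r2 -> 0 <= y <= 2 * pi -> exists D, cder F (x +i* y) D.
  move=> /andP[_ x2] _.
  apply: (cdiff_comp cexp g); first exact: cdiff_cexp.
  apply: dg; rewrite normc_cexp expR_gt0 /= (le_lt_trans _ r21) //.
  by rewrite -ler_ln ?posrE ?expR_gt0 // expRK.
move=> /(_ dF); rewrite /rect_int.
have -> : hseg F 0 (ln r1) (ln r2) = hseg F (2 * pi) (ln r1) (ln r2).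
  apply: eq_cint => x _; congr g; rewrite !cexpE /=; congr (_ * _).
  by have := ei_period (0 : R); rewrite add0r => E; exact: esym E.
rewrite subrr add0r => /eqP; rewrite mulf_eq0 (negbTE (neq0Ci _)) /=.
rewrite subr_eq0 => /eqP E.
rewrite (cavg_vseg g r1 r10 (le_lt_trans r12 r21) dg) (cavg_vseg g r2 r20 r21 dg).
exact: (congr1 (fun v => ((2 * pi)^-1)%:C * v) (esym E)).
Qed.

Lemma cavg_circle_eq g r1 r2 : 0 < r1 < 1 -> 0 < r2 < 1 ->
  (forall z, 0 < normc z < 1 -> cdiff g z) ->
  cavg (fun t => g (r1%:C * ei t)) = cavg (fun t => g (r2%:C * ei t)).
Proof.
move=> /andP[r10 r11] /andP[r20 r21] dg; have [r12|/ltW r12] := leP r1 r2.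
  exact: cavg_circle_const.
by apply/esym; exact: cavg_circle_const.
Qed.

Lemma holo_ccont f z : holo f -> normc z < 1 -> ccont f z.
Proof. by move=> hf z1; apply: cdiff_ccont; exact: hf. Qed.

Lemma holo_cbmeas f (c : R[i]) : holo f -> normc c < 1 ->
  cbmeas (fun t => f (c * ei t)).
Proof.
move=> hf c1; apply: (cbmeas_circle f) => t; apply: holo_ccont => //.
by rewrite normcM normc_expi mulr1.
Qed.

Lemma half01 : 0 < (2^-1 : R) < 1.
Proof. by rewrite invr_gt0 ltr0n /= invf_lt1 // ltr1n. Qed.

(** Up to the factor r^n the coefficient is the average of f(z) / z^n, a function differentiable off
    0, whose average does not depend on the radius. *)
Lemma fcoef_circle f r n : holo f -> 0 < r < 1 ->
  fcoef (fun t => f (r%:C * ei t)) n = taylor f n * r%:C ^+ n.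
Proof.
move=> hf r01.
pose g : R[i] -> R[i] := fun z => f z * (z ^+ n)^-1.
have dg z : 0 < normc z < 1 -> cdiff g z.
  move=> /andP[z0 z1]; apply: cdiffM; first exact: hf.
  apply: cdiffV; first by rewrite expf_neq0 // -normc_gt0.
  exact/cdiffX/cdiff_id.
have E s : 0 < s < 1 -> fcoef (fun t => f (s%:C * ei t)) n = s%:C ^+ n * cavg (fun t => g (s%:C * ei t)).
  move=> /andP[s0 s1]; rewrite -cavgZ; last first.
    apply: (cbmeas_circle g) => t; apply: cdiff_ccont; apply: dg.
    by rewrite normc_rexpi ?s0 ?s1 // ltW.
  apply: eq_cavg => t; rewrite /g exprMn invfM -[(ei t ^+ n)^-1]exprVn eiV.
  by rewrite mulrCA mulVKf // expf_neq0 // -normc_gt0 normcR normr_gt0 gt_eqF.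
rewrite taylor.unlock !E //; last exact: half01.
have -> := cavg_circle_eq g r 2^-1 r01 half01 dg.
rewrite mulrC; congr (_ * _); rewrite mulrAC -exprMn.
by rewrite (_ : 2^-1%:C * 2 = 1) ?expr1n ?mul1r //; apply: complex_eqP => /=; field.
Qed.

Lemma ccont0_bound f : ccont f 0 -> exists2 dl : R, 0 < dl < 1 &
  forall z, normc z < dl -> normc (f z) <= normc (f 0) + 1.
Proof.
move=> /(_ 1 ltr01)[dl dl0 H]; exists (Num.min dl 2^-1).
  by case/andP: half01 => h0 h1; rewrite lt_min dl0 h0 /= gt_min h1 orbT.
move=> z; rewrite lt_min => /andP[zd _].
rewrite -[f z](subrK (f 0)) addrC (le_trans (le_normcD _ _)) // lerD2l ltW //.
by apply: H; rewrite subr0.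
Qed.

(** The average of f(z) z^(n+1) does not depend on the radius and is at most [s * K] on a small
    circle of radius [s]; hence it vanishes. *)
Lemma fcoef_circle_neg f r n : holo f -> 0 < r < 1 ->
  cavg (fun t => f (r%:C * ei t) * ei t ^+ n.+1) = 0.
Proof.
move=> hf r01; have [r0 r1] := andP r01.
pose g : R[i] -> R[i] := fun z => f z * z ^+ n.+1.
have hg : holo g.
  by move=> z z1; apply: cdiffM; [exact: hf|exact/cdiffX/cdiff_id].
have dg z : 0 < normc z < 1 -> cdiff g z by move=> /andP[_]; exact: hg.
have E : cavg (fun t => g (r%:C * ei t)) =
    r%:C ^+ n.+1 * cavg (fun t => f (r%:C * ei t) * ei t ^+ n.+1).
  rewrite -cavgZ; first by apply: eq_cavg => t; rewrite /g exprMn mulrCA.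
  apply: cbmeasM; last by apply: cbmeasX; exact: cbmeas_expi.
  by apply: holo_cbmeas => //; rewrite normcR gtr0_norm.
suff g0 : cavg (fun t => g (r%:C * ei t)) = 0.
  have rn0 : r%:C ^+ n.+1 != 0 by rewrite expf_neq0 // -normc_gt0 normcR gtr0_norm.
  by apply: (mulfI rn0); rewrite -E g0 mulr0.
have n01 : normc (0 : R[i]) < 1 by rewrite (@normc0 R) ltr01.
have [dl /andP[dl0 dl1] Hd] := ccont0_bound _ (holo_ccont _ 0 hf n01).
apply/eqP; rewrite -normc_eq0 eq_le normc_ge0 andbT leNgt; apply/negP => g0.
set K := normc (f 0) + 1 in Hd.
have K0 : 0 < K by rewrite ltr_wpDl ?normc_ge0.
set M := normc _ in g0.
(* The second bound turns [M <= s * K] into [M <= M / 2], against [0 < M]; the first keeps the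
   circle where [f] is bounded by [K]. *)
pose s := Num.min (dl / 2) (M / (2 * K)).
have s0 : 0 < s by rewrite lt_min !divr_gt0 // mulr_gt0.
have sdl : s < dl by rewrite gt_min ltr_pdivrMr // ltr_pMr // ltr1n.
have s01 : 0 < s < 1 by rewrite s0 (lt_trans sdl).
have : M <= s * K.
  rewrite /M (cavg_circle_eq g r s r01 s01 dg).
  apply: normc_cavg_le.
    by apply: holo_cbmeas => //; rewrite normcR gtr0_norm //; case/andP: s01.
  move=> t; rewrite /g normcM normcX normc_rexpi ?(ltW s0) // mulrC exprS ler_pM //.
  - by rewrite mulr_ge0 ?exprn_ge0 // ltW.
  - exact: normc_ge0.
  - by rewrite ler_piMr ?exprn_ile1 ?ltW //; case/andP: s01.
  - by apply: Hd; rewrite normc_rexpi ?ltW.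
apply/negP; rewrite -ltNge (@le_lt_trans _ _ (M / 2)) //; last first.
  by rewrite ltr_pdivrMr // ltr_pMr // ltr1n.
by rewrite -ler_pdivlMr // -mulrA -invfM ge_min lexx orbT.
Qed.

Lemma taylor0 f : holo f -> taylor f 0 = f 0.
Proof.
move=> hf.
have C r : 0 < r < 1 -> taylor f 0 = cavg (fun t => f (r%:C * ei t)).
  move=> r01; have := fcoef_circle f r 0 hf r01; rewrite expr0 mulr1 => <-.
  by apply: eq_cavg => t; rewrite expr0 mulr1.
apply/eqP; rewrite -subr_eq0 -normc_eq0 eq_le normc_ge0 andbT leNgt; apply/negP => g0.
have n01 : normc (0 : R[i]) < 1 by rewrite (@normc0 R) ltr01.
have [|dl dl0 Hd] := holo_ccont f 0 hf n01 (normc (taylor f 0 - f 0) / 2).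
  by rewrite divr_gt0.
pose s := Num.min (dl / 2) 2^-1.
have [h0 h1] := andP half01.
have s0 : 0 < s by rewrite lt_min h0 divr_gt0.
have s1 : s < 1 by rewrite gt_min h1 orbT.
have sdl : s < dl by rewrite gt_min ltr_pdivrMr // ltr_pMr // ltr1n.
have hs : cbmeas (fun t => f (s%:C * ei t)).
  by apply: holo_cbmeas => //; rewrite normcR gtr0_norm.
have : normc (taylor f 0 - f 0) <= normc (taylor f 0 - f 0) / 2.
  rewrite {1}(C s) ?s0 // -[X in _ - X](cavg_cst) -cavgB //; last exact: cbmeas_cst.
  apply: normc_cavg_le; first by apply: cbmeasB => //; exact: cbmeas_cst.
  by move=> t; apply/ltW/Hd; rewrite subr0 normc_rexpi // ltW.
by apply/negP; rewrite -ltNge ltr_pdivrMr // ltr_pMr // ltr1n.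
Qed.

End TaylorCoefficients.

(** * Cauchy and Poisson kernels *)

(** Since d zeta / (2 pi i) = zeta d theta / (2 pi), this is the Cauchy kernel for the normalized
    measure; [pker] is the Poisson kernel. *)
HB.lock Definition ker {R : realType} (z : R[i]) (t : R) : R[i] := ei t / (ei t - z).
HB.lock Definition pker {R : realType} (z : R[i]) (t : R) : R :=
  (1 - normc z ^+ 2) / normc (ei t - z) ^+ 2.

Section CauchyTransform.
Context {R : realType}.
Implicit Types (f F : R[i] -> R[i]) (g : R -> R[i]) (z w h : R[i]) (r s t M e : R).

Lemma le_ei_sub z t : 1 - normc z <= normc (ei t - z).
Proof.
rewrite lerBlDr -{1}(normc_expi t) -{1}(subrK z (ei t)).
exact: le_normcD.
Qed.

Lemma ei_sub_neq0 z t : normc z < 1 -> ei t - z != 0.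
Proof. by move=> z1; rewrite -normc_gt0 (lt_le_trans _ (le_ei_sub z t)) // subr_gt0. Qed.

Lemma kerE z t : ker z t = ei t / (ei t - z).
Proof. by rewrite ker.unlock. Qed.

Lemma cbmeas_ei_sub_inv z : normc z < 1 -> cbmeas (fun t => (ei t - z)^-1).
Proof.
move=> z1.
have H := @cbmeas_circle R (fun w => (w - z)^-1) 1.
under eq_fun do rewrite -[ei _]mul1r; apply: H => t; rewrite mul1r.
apply: cdiff_ccont; apply: cdiffV; first exact: ei_sub_neq0.
by apply: cdiffD; [exact: cdiff_id|exact: cdiff_cst].
Qed.

Lemma cbmeas_ker z : normc z < 1 -> cbmeas (ker z).
Proof.
move=> z1; rewrite (_ : ker z = fun t => ei t / (ei t - z)); last by apply/funext => t; exact: kerE.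
by apply: cbmeasM; [exact: cbmeas_expi|exact: cbmeas_ei_sub_inv].
Qed.

Lemma normc_ker z t : normc z < 1 -> normc (ker z t) <= (1 - normc z)^-1.
Proof.
move=> z1; rewrite kerE normcM normc_expi mul1r normcV lef_pV2 ?le_ei_sub // posrE ?subr_gt0 //.
by rewrite normc_gt0 ei_sub_neq0.
Qed.

Lemma ker_expand z t N : normc z < 1 ->
  ker z t = \sum_(n < N) conjc (ei t) ^+ n * z ^+ n + z ^+ N * conjc (ei t) ^+ N * ker z t.
Proof.
move=> z1; have n0 := ei_sub_neq0 z t z1.
elim: N => [|N IH]; first by rewrite big_ord0 !expr0 !mul1r add0r.
rewrite big_ord_recr /= -addrA {1}IH; congr (_ + _).
have kE : ker z t = 1 + z * conjc (ei t) * ker z t.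
  rewrite kerE; apply: (mulIf n0); rewrite mulrDl mul1r -!mulrA mulVf // !mulr1.
  by rewrite [conjc _ * _]mulrC ei_mulJ mulr1 subrK.
rewrite {1}kE !exprS; ring.
Qed.

Definition cauchy g z := cavg (fun t => g t * ker z t).

Lemma cbmeas_cauchy g z : cbmeas g -> normc z < 1 -> cbmeas (fun t => g t * ker z t).
Proof. by move=> hg z1; apply: cbmeasM => //; exact: cbmeas_ker. Qed.

Lemma cauchy_tail g z M N : cbmeas g -> (forall t, normc (g t) <= M) -> normc z < 1 ->
  normc (cauchy g z - \sum_(n < N) fcoef g n * z ^+ n) <= M / (1 - normc z) * normc z ^+ N.
Proof.
move=> hg HM z1; have M0 : 0 <= M := le_trans (normc_ge0 _) (HM 0).
have hk := cbmeas_ker _ z1.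
have hJ n : cbmeas (fun t => g t * conjc (ei t) ^+ n).
  by apply: cbmeasM => //; exact: cbmeas_expiXJ.
have -> : \sum_(n < N) fcoef g n * z ^+ n
    = cavg (fun t => \sum_(n < N) z ^+ n * (g t * conjc (ei t) ^+ n)).
  rewrite cavg_sum; last by move=> n; apply: cbmeasM => //; exact: cbmeas_cst.
  by apply: eq_bigr => n _; rewrite cavgZ // mulrC.
rewrite /cauchy -cavgB; first last.
- by apply: cbmeas_sum => n; apply: cbmeasM => //; exact: cbmeas_cst.
- exact: cbmeas_cauchy.
have -> : cavg (fun t => g t * ker z t - \sum_(n < N) z ^+ n * (g t * conjc (ei t) ^+ n))
   = cavg (fun t => z ^+ N * (g t * conjc (ei t) ^+ N * ker z t)).
  apply: eq_cavg => t; rewrite [X in g t * X](ker_expand z t N z1) mulrDr mulr_sumr.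
  rewrite addrAC (_ : \sum_(i < N) g t * _ = \sum_(n < N) z ^+ n * (g t * conjc (ei t) ^+ n)).
    by rewrite subrr add0r; ring.
  by apply: eq_bigr => n _; ring.
have hJk := cbmeasM _ _ (hJ N) hk.
rewrite cavgZ // normcM normcX mulrC; apply: ler_wpM2r; first by rewrite exprn_ge0 ?normc_ge0.
apply: normc_cavg_le => // t.
rewrite (normcM _ (ker z t)) normcM normcX normc_conj normc_expi expr1n mulr1.
by apply: ler_pM; rewrite ?normc_ge0 // normc_ker.
Qed.

(** The first-order expansion of 1 / (e^it - z - h) has the exact remainder h^2 / ((e^it - z)^2
    (e^it - z - h)), so no theorem on differentiation under the integral sign is involved. *)
Lemma cauchy_cdiff g z : cbmeas g -> normc z < 1 -> cdiff (cauchy g) z.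
Proof.
move=> hg z1; have [M M0 HM] := cbmeas_bound _ hg.
pose d := 1 - normc z; have d0 : 0 < d by rewrite subr_gt0.
have hi := cbmeas_ei_sub_inv _ z1.
have hE := @cbmeas_expi R.
have h2 := cbmeasX _ 2 hi; have hD := cbmeasM _ _ hg (cbmeasM _ _ hE h2).
exists (cavg (fun t => g t * (ei t * (ei t - z)^-1 ^+ 2))) => e e0.
(* For [normc h < d / 2] the three factors in the denominator of the remainder have inverses at most
   [1 / d], [1 / d] and [2 / d]. *)
pose C := M * (2 / d ^+ 3).
have C0 : 0 <= C by rewrite mulr_ge0 // divr_ge0 // exprn_ge0 // ltW.
have C1 : 0 < C + 1 by rewrite ltr_wpDl.
exists (Num.min (d / 2) (e / (C + 1))).
  by rewrite lt_min !divr_gt0.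
move=> h; rewrite lt_min (ltr_pdivlMr _ _ C1) => /andP[hd he].
have zh : normc (z + h) < 1.
  rewrite (le_lt_trans (le_normcD _ _)) // -ltrBrDl (lt_le_trans hd) //.
  by rewrite ler_pdivrMr // ler_pMr // ler1n.
have dh : d / 2 <= 1 - normc (z + h).
  have := le_normcD z h; rewrite /d; move: hd; rewrite /d; lra.
have hc1 := cbmeas_cauchy _ _ hg z1; have hc2 := cbmeas_cauchy _ _ hg zh.
have hD' := cbmeasM _ _ (cbmeas_cst h) hD.
rewrite mulrC -cavgZ // /cauchy -cavgB // -cavgB //; last exact: cbmeasB.
have hih := cbmeas_ei_sub_inv _ zh.
have hR := cbmeasM _ _ hg (cbmeasM _ _ hE (cbmeasM _ _ h2 hih)).
have -> : cavg (fun t => g t * ker (z + h) t - g t * ker z t - h * (g t * (ei t * (ei t - z)^-1 ^+ 2)))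
  = cavg (fun t => h ^+ 2 * (g t * (ei t * ((ei t - z)^-1 ^+ 2 * (ei t - (z + h))^-1)))).
  apply: eq_cavg => t; rewrite !kerE.
  have n1 := ei_sub_neq0 z t z1; have n2 := ei_sub_neq0 (z + h) t zh.
  by field; rewrite n1 n2.
rewrite cavgZ // normcM normcX.
have le : normc (cavg (fun t => g t * (ei t * ((ei t - z)^-1 ^+ 2 * (ei t - (z + h))^-1)))) <= C.
  apply: normc_cavg_le => // t; rewrite (normcM (g t)) (normcM (ei t)) normcM normcX normc_expi mul1r !normcV /C.
  have a1 : (normc (ei t - z))^-1 <= d^-1.
    by rewrite lef_pV2 ?le_ei_sub // posrE // normc_gt0 ei_sub_neq0.
  have a2 : (normc (ei t - (z + h)))^-1 <= 2 / d.
    rewrite -[2 / d]invf_div lef_pV2 ?posrE ?divr_gt0 //; last by rewrite normc_gt0 ei_sub_neq0.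
    exact: le_trans dh (le_ei_sub _ _).
  have -> : 2 / d ^+ 3 = d^-1 ^+ 2 * (2 / d) by field; rewrite gt_eqF.
  have p1 : 0 <= (normc (ei t - z))^-1 by rewrite invr_ge0 normc_ge0.
  have p2 : 0 <= (normc (ei t - (z + h)))^-1 by rewrite invr_ge0 normc_ge0.
  apply: ler_pM => //; [exact: normc_ge0|by rewrite mulr_ge0 // exprn_ge0|].
  apply: ler_pM => //; first exact: exprn_ge0.
  by rewrite ler_pXn2r ?nnegrE // invr_ge0 ltW.
have n0 := normc_ge0 h.
have := ler_wpM2l (exprn_ge0 2 n0) le.
move=> /le_trans; apply; rewrite expr2 mulrAC ler_wpM2r //.
by move: he; rewrite mulrDr mulr1; lra.
Qed.

Lemma pker_def z t : pker z t = (1 - normc z ^+ 2) / normc (ei t - z) ^+ 2.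
Proof. by rewrite pker.unlock. Qed.

Lemma pker_ge0 z t : normc z < 1 -> 0 <= pker z t.
Proof.
move=> z1; rewrite pker_def divr_ge0 ?sqr_ge0 // subr_ge0 expr_le1 ?normc_ge0 //; exact: ltW.
Qed.

Lemma pkerE z t : normc z < 1 -> (pker z t)%:C = ker z t + conjc (ker z t) - 1.
Proof.
move=> z1; have n0 := ei_sub_neq0 z t z1.
have c0 : conjc (ei t - z) != 0 by rewrite -normc_gt0 normc_conj normc_gt0.
have D0 : (ei t - z) * conjc (ei t - z) != 0 by rewrite mulf_neq0.
rewrite pker_def rmorphM fmorphV /= -mulc_conj rmorphB /= -mulc_conj rmorph1.
apply: (mulIf D0); rewrite divfK // kerE conjcM.
have -> : conjc (ei t - z)^-1 = (conjc (ei t - z))^-1 by exact: conjc_inv.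
rewrite mulrBl mulrDl mul1r.
have -> : ei t / (ei t - z) * ((ei t - z) * conjc (ei t - z)) = ei t * conjc (ei t - z).
  by rewrite mulrA divfK.
have -> : conjc (ei t) / conjc (ei t - z) * ((ei t - z) * conjc (ei t - z)) = conjc (ei t) * (ei t - z).
  by rewrite [(ei t - z) * _]mulrC mulrA divfK.
have e1 := ei_mulJ t; have e2 : conjc (ei t) * ei t = 1 by rewrite mulrC.
rewrite conjcB !mulrBr !mulrBl e1 e2; ring.
Qed.

Lemma pker_Re z t : normc z < 1 -> pker z t = Re (2 * ker z t - 1).
Proof.
by move=> z1; rewrite -[LHS]/(Re (pker z t)%:C) pkerE // [2 * _]mulr_natl mulr2n !ReDc ReNc ReJ.
Qed.

Lemma bmeas_pker z : normc z < 1 -> bmeas (pker z).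
Proof.
move=> z1; have [h _] : cbmeas (fun t => 2 * ker z t - 1).
  by apply: cbmeasB; [apply: cbmeasM; [exact: cbmeas_cst|exact: cbmeas_ker]|exact: cbmeas_cst].
by rewrite (_ : pker z = fun t => Re (2 * ker z t - 1)) //; apply/funext => t; exact: pker_Re.
Qed.

Lemma normc_small_eq0 w (K q : R) : 0 <= q < 1 -> (forall N, normc w <= K * q ^+ N) -> w = 0.
Proof.
move=> q01 H; apply/eqP; rewrite -normc_eq0 eq_le normc_ge0 andbT.
exact: le_geometric_eq0 q01 H.
Qed.

Lemma normc01 z : normc z < 1 -> 0 <= normc z < 1.
Proof. by move=> ->; rewrite normc_ge0. Qed.

(* Against the conjugate kernel only the mean of a function whose negative
   Fourier coefficients vanish survives. *)
Lemma cavg_conj_ker g z : cbmeas g -> (forall n, cavg (fun t => g t * ei t ^+ n.+1) = 0) ->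
  normc z < 1 -> cavg (fun t => g t * conjc (ker z t)) = cavg g.
Proof.
move=> hg Hneg z1; have [M M0 HM] := cbmeas_bound _ hg.
have hk := cbmeasJ _ (cbmeas_ker _ z1).
have hgk : cbmeas (fun t => g t * conjc (ker z t)) by exact: cbmeasM.
apply/eqP; rewrite -subr_eq0; apply/eqP.
apply: (normc_small_eq0 _ (M / (1 - normc z) * normc z) (normc z)) => [|N]; first exact: normc01.
have H := cauchy_tail (fun t => conjc (g t)) z M N.+1 (cbmeasJ _ hg).
have {}H := H (fun t => (@eq_ind_r _ _ (fun x => x <= M) (HM t) _ (normc_conj (g t)))) z1.
rewrite -[leRHS]mulrA -exprS; apply: le_trans H.
rewrite -[leRHS]normc_conj conjcB conjc_sum /cauchy -cavgJ; last first.
  by apply: cbmeas_cauchy => //; exact: cbmeasJ.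
rewrite le_eqVlt; apply/orP; left; apply/eqP; congr (normc (_ - _)).
  by apply: eq_cavg => t; rewrite conjcM conjcK.
rewrite big_ord_recl expr0 mulr1 big1 ?addr0 => [|n _].
  rewrite /fcoef -cavgJ.
    by apply: eq_cavg => t; rewrite conjcM conjcK expr0 conjc1 mulr1.
  by apply: cbmeasM; [exact: cbmeasJ|exact: cbmeas_expiXJ].
rewrite conjcM /fcoef -cavgJ; last by apply: cbmeasM; [exact: cbmeasJ|exact: cbmeas_expiXJ].
rewrite [X in X * _](_ : _ = 0) ?mul0r // -[RHS](Hneg n).
by apply: eq_cavg => t; rewrite conjcM conjcX !conjcK.
Qed.

Lemma fcoef_cst (k : R[i]) n : fcoef (fun=> k) n = if n == 0%N then k else 0.
Proof.
rewrite /fcoef cavgZ; last exact: cbmeas_expiXJ.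
have -> : cavg (fun t => conjc (ei t) ^+ n) = (0%N == n)%:R.
  by rewrite -cavg_orthonormal; apply: eq_cavg => t; rewrite expr0 mul1r.
by rewrite eq_sym; case: eqP => _; rewrite ?mulr1 ?mulr0.
Qed.

Lemma avg_pker z : normc z < 1 -> avg (pker z) = 1.
Proof.
move=> z1; have hk := cbmeas_ker _ z1.
have k1 : cavg (ker z) = 1.
  apply/eqP; rewrite -subr_eq0; apply/eqP.
  apply: (normc_small_eq0 _ (1 / (1 - normc z) * normc z) (normc z)) => [|N]; first exact: normc01.
  have := cauchy_tail (fun=> 1) z 1 N.+1 (cbmeas_cst 1).
  rewrite (@normc1 R) => /(_ (fun=> lexx _) z1) H; rewrite -[leRHS]mulrA -exprS.
  apply: le_trans H; rewrite /cauchy (eq_cavg (fun t => 1 * ker z t) (ker z)); last by move=> t; rewrite mul1r.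
  rewrite big_ord_recl fcoef_cst expr0 mulr1 big1 ?addr0 // => n _.
  by rewrite fcoef_cst mul0r.
apply: complexI; rewrite -cavg_real.
transitivity (cavg (fun t => ker z t + conjc (ker z t) - 1)).
  by apply: eq_cavg => t; rewrite pkerE.
rewrite cavgB; [|by apply: cbmeasD => //; exact: cbmeasJ|exact: cbmeas_cst].
by rewrite cavgD // ?cavgJ ?cavg_cst ?k1 ?conjc1 ?addrK //; exact: cbmeasJ.
Qed.

(** The Poisson kernel is the Cauchy kernel plus its conjugate minus 1; the conjugate part yields
    the mean of [g], which the - 1 takes away. *)
Lemma cauchy_poisson g z : cbmeas g -> (forall n, cavg (fun t => g t * ei t ^+ n.+1) = 0) ->
  normc z < 1 -> cauchy g z = cavg (fun t => g t * (pker z t)%:C).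
Proof.
move=> hg Hneg z1; have hk := cbmeas_ker _ z1.
have hkJ := cbmeasJ _ hk.
have -> : cavg (fun t => g t * (pker z t)%:C) =
    cavg (fun t => (g t * ker z t + g t * conjc (ker z t)) - g t).
  by apply: eq_cavg => t; rewrite pkerE //; ring.
rewrite cavgB // ?cavgD //; do ?[exact: cbmeasM|by apply: cbmeasD; exact: cbmeasM].
by rewrite cavg_conj_ker // addrK.
Qed.

(** Away from [t0] the kernel is at most 8 (1 - r) / eta^2 and [g] varies by at most 2 M, whence the
    constant 16 M / eta^2. Near [t0] the bound [e] is integrated against a kernel of mean 1. *)
Lemma poisson_approx g M t0 e eta r : cbmeas g -> (forall t, normc (g t) <= M) ->
  0 < eta -> 0 <= e -> (forall t, normc (ei t - ei t0) < eta -> normc (g t - g t0) <= e) ->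
  0 <= r -> r < 1 -> 1 - r <= eta / 2 ->
  normc (cavg (fun t => g t * (pker (r%:C * ei t0) t)%:C) - g t0)
    <= e + 16 * M / eta ^+ 2 * (1 - r).
Proof.
move=> hg HM eta0 e0 Hc r0 r1 re; have M0 : 0 <= M := le_trans (normc_ge0 _) (HM 0).
set z := r%:C * ei t0.
have nz : normc z = r by rewrite normc_rexpi.
have z1 : normc z < 1 by rewrite nz.
have hp := bmeas_pker _ z1; have hpc := cbmeas_real _ hp.
have -> : cavg (fun t => g t * (pker z t)%:C) - g t0 = cavg (fun t => (g t - g t0) * (pker z t)%:C).
  transitivity (cavg (fun t => g t * (pker z t)%:C) - cavg (fun t => g t0 * (pker z t)%:C)).
    by rewrite (cavgZ (g t0)) // cavg_real avg_pker // mulr1.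
  rewrite -cavgB; [|exact: cbmeasM|by apply: cbmeasM => //; exact: cbmeas_cst].
  by apply: eq_cavg => t; rewrite mulrBl.
have hd : cbmeas (fun t => (g t - g t0) * (pker z t)%:C).
  by apply: cbmeasM => //; apply: cbmeasB => //; exact: cbmeas_cst.
rewrite (le_trans (le_normc_cavg _ hd)) //.
pose B := 16 * M / eta ^+ 2 * (1 - r).
have B0 : 0 <= B by rewrite !mulr_ge0 ?invr_ge0 ?sqr_ge0 // subr_ge0 ltW.
have -> : e + 16 * M / eta ^+ 2 * (1 - r) = avg (fun t => e * pker z t + B).
  rewrite (avgD (fun t => e * pker z t) (fun=> B)) ?(avgZ e (pker z)) ?avg_pker ?avg_cst ?mulr1 //.
    by apply: bmeasM => //; exact: bmeas_cst.
  exact: bmeas_cst.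
apply: le_avg.
- exact: cbmeas_normc.
- by apply: bmeasD; [apply: bmeasM => //; exact: bmeas_cst|exact: bmeas_cst].
move=> t; have p0 := pker_ge0 z t z1.
rewrite normcM normcR ger0_norm //.
have [near|far] := ltP (normc (ei t - ei t0)) eta.
  by apply: ler_wpDr => //; apply: ler_wpM2r => //; exact: Hc.
apply: ler_wpDl; first exact: mulr_ge0.
have g2 : normc (g t - g t0) <= 2 * M.
  by rewrite (le_trans (le_normcD _ _)) // normcN mulr_natl mulr2n lerD.
have dist : eta / 2 <= normc (ei t - z).
  have : normc (ei t - ei t0) <= normc (ei t - z) + normc (z - ei t0).
    by rewrite (_ : ei t - ei t0 = (ei t - z) + (z - ei t0)) ?le_normcD //; ring.
  have -> : normc (z - ei t0) = 1 - r.
    rewrite (_ : z - ei t0 = (r - 1)%:C * ei t0); last by rewrite rmorphB /= mulrBl mul1r.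
    by rewrite normcM normc_expi mulr1 normcR distrC ger0_norm // subr_ge0 ltW.
  by move: far re; lra.
have pk : pker z t <= 8 * (1 - r) / eta ^+ 2.
  rewrite pker_def nz ler_pdivrMr; last first.
    by rewrite exprn_gt0 // (lt_le_trans _ dist) // divr_gt0.
  have : (eta / 2) ^+ 2 <= normc (ei t - z) ^+ 2.
    by rewrite ler_pXn2r // ?nnegrE ?normc_ge0 // divr_ge0 // ltW.
  have c0 : 0 <= 8 * (1 - r) / eta ^+ 2.
    by rewrite divr_ge0 ?sqr_ge0 // mulr_ge0 // subr_ge0 ltW.
  move=> /(ler_wpM2l c0); apply: le_trans.
  rewrite (_ : 8 * (1 - r) / eta ^+ 2 * (eta / 2) ^+ 2 = 2 * (1 - r)).
    by rewrite (_ : 1 - r ^+ 2 = (1 + r) * (1 - r)); [rewrite ler_wpM2r ?subr_ge0 1?ltW //; lra|ring].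
  by field; rewrite gt_eqF.
rewrite (le_trans (ler_pM (normc_ge0 _) p0 g2 pk)) //.
by rewrite /B le_eqVlt; apply/orP; left; apply/eqP; field; rewrite gt_eqF.
Qed.

(** [dl] depends on [e], [eta] and [M] alone, so that one radius serves all centres [t0];
    [outer_majorant] needs this uniformity. *)
Lemma poisson_unif e eta M : 0 < e -> 0 < eta -> 0 <= M ->
  exists2 dl : R, 0 < dl <= 1 & forall g t0 r, cbmeas g -> (forall t, normc (g t) <= M) ->
    (forall t, normc (ei t - ei t0) < eta -> normc (g t - g t0) <= e / 2) ->
    1 - dl < r -> r < 1 ->
    normc (cavg (fun t => g t * (pker (r%:C * ei t0) t)%:C) - g t0) <= e.
Proof.
move=> e0 eta0 M0; pose K := 16 * M / eta ^+ 2 + 1.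
have K0 : 0 < K by rewrite ltr_wpDl // divr_ge0 ?sqr_ge0 // mulr_ge0.
exists (Num.min 1 (Num.min (eta / 2) (e / 2 / K))).
  by rewrite !lt_min ge_min lexx ltr01 !divr_gt0.
move=> g t0 r hg HM Hc; rewrite ltrBlDr -ltrBlDl !lt_min => /and3P[r0 re rK] r1.
have e2 : 0 <= e / 2 by rewrite divr_ge0 // ltW.
have r0' : 0 <= r by move: r0; lra.
have := poisson_approx g M t0 (e / 2) eta r hg HM eta0 e2 Hc r0' r1 (ltW re).
move=> /le_trans; apply; rewrite [leRHS]splitr lerD2l.
move: rK; rewrite ltr_pdivlMr // /K mulrDr mulr1 => /ltW; rewrite mulrC.
by apply: le_trans; rewrite lerDl subr_ge0 ltW.
Qed.

End CauchyTransform.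

(** * Power series expansion, Cauchy and Poisson formulas *)

Section PowerSeriesExpansion.
Context {R : realType}.
Implicit Types (f : R[i] -> R[i]) (g : R -> R[i]) (z w : R[i]) (r s t M e : R) (c : nat -> R[i]).

Lemma normc_tri (x y w : R[i]) : normc (x - y) <= normc (w - x) + normc (w - y).
Proof. by rewrite (_ : x - y = - (w - x) + (w - y)) ?(le_trans (le_normcD _ _)) ?normcN //; ring. Qed.

Lemma normc_tri3 (x y a b : R[i]) :
  normc (x - y) <= normc (x - a) + normc (a - b) + normc (y - b).
Proof.
rewrite (_ : x - y = (x - a) + (a - b) + - (y - b)); last by ring.
by rewrite (le_trans (le_normcD _ _)) // normcN lerD2r le_normcD.
Qed.

Lemma realC_sub1 r w : r%:C * w - w = (r - 1)%:C * w.
Proof. by rewrite rmorphB /= mulrBl mul1r. Qed.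

Lemma unimodular_ei w : normc w = 1 -> exists t, w = ei t.
Proof.
move=> w1; have N : Re w ^+ 2 + Im w ^+ 2 = 1 by rewrite -normc_sqr w1 expr1n.
have x1 : -1 <= Re w <= 1 by rewrite -ler_norml -w1 normRe_le.
have S : Num.sqrt (1 - Re w ^+ 2) = `|Im w| by rewrite -sqrtr_sqr -N addrC addKr.
have [y0|y0] := leP 0 (Im w).
  exists (acos (Re w)); apply: complex_eqP; rewrite ?Re_ei ?Im_ei ?acosK //.
  by rewrite sin_acos // S ger0_norm.
exists (- acos (Re w)); apply: complex_eqP; rewrite ?Re_ei ?Im_ei ?cosN ?sinN ?acosK //.
by rewrite sin_acos // S ltr0_norm // opprK.
Qed.

Lemma polar z : exists t, z = (normc z)%:C * ei t.
Proof.
have [->|z0] := eqVneq z 0; first by exists 0; rewrite (@normc0 R) mul0r.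
have n0 : (normc z)%:C != 0 :> R[i] by rewrite -normc_gt0 normcR normr_gt0 normc_eq0.
have [|t E] := unimodular_ei (z / (normc z)%:C).
  by rewrite normcM normcV normcR ger0_norm ?normc_ge0 // divff // normc_eq0.
by exists t; rewrite -E mulrC divfK.
Qed.

Lemma holo_circle f s : holo f -> 0 < s < 1 -> cbmeas (fun t => f (s%:C * ei t)).
Proof. by move=> hf /andP[s0 s1]; apply: holo_cbmeas => //; rewrite normcR gtr0_norm. Qed.

Lemma cauchy_circle_tail f s M z N : holo f -> 0 < s < 1 ->
  (forall t, normc (f (s%:C * ei t)) <= M) -> normc z < 1 ->
  normc (cauchy (fun t => f (s%:C * ei t)) z - \sum_(n < N) taylor f n * (s%:C * z) ^+ n)
    <= M / (1 - normc z) * normc z ^+ N.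
Proof.
move=> hf s01 HM z1; have := cauchy_tail _ z M N (holo_circle _ _ hf s01) HM z1.
congr (normc (_ - _) <= _); apply: eq_bigr => n _.
by rewrite fcoef_circle // -mulrA exprMn.
Qed.

Lemma cauchy_circle_ps f s z : holo f -> 0 < s < 1 -> normc z < 1 ->
  cauchy (fun t => f (s%:C * ei t)) z = ps (taylor f) (s%:C * z).
Proof.
move=> hf s01 z1; have [M M0 HM] := cbmeas_bound _ (holo_circle _ _ hf s01).
apply: (csum_unique _ _ (M / (1 - normc z)) (normc z)); first exact: normc01.
  by rewrite divr_ge0 // subr_ge0 ltW.
by move=> N; exact: cauchy_circle_tail.
Qed.

(** The Cauchy integral over the circle through [z], evaluated on the radius of [z], is the power
    series at r z; it tends to f(z) as r tends to 1 by the Poisson approximation. Represented over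
    the larger circle of radius [s'], the same series is continuous at [z], so it also tends to its
    value there. *)
Lemma holo_ps f z : holo f -> normc z < 1 -> f z = ps (taylor f) z.
Proof.
move=> hf z1; have [->|z0] := eqVneq z 0.
  apply: (csum_unique _ _ (normc (f 0)) 0); rewrite ?lexx ?ltr01 ?normc_ge0 //.
  case=> [|N]; first by rewrite big_ord0 subr0 expr0 mulr1.
  rewrite big_ord_recl big1 => [|n _]; last by rewrite exprS mul0r mulr0.
  by rewrite addr0 expr0 mulr1 taylor0 // subrr (@normc0 R) exprS mul0r mulr0.
have [t0 zE] := polar z; set s := normc z in z1 zE.
have s0 : 0 < s by rewrite normc_gt0.
have s01 : 0 < s < 1 by rewrite s0.
pose s' := (1 + s) / 2.
have ss' : s < s' by rewrite /s' ltr_pdivlMr //; lra.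
have s'1 : s' < 1 by rewrite /s' ltr_pdivrMr //; lra.
have s'0 : 0 < s' by exact: lt_trans ss'.
have s'01 : 0 < s' < 1 by rewrite s'0.
pose c : R := s / s'.
have c0 : 0 < c by rewrite divr_gt0.
have c1 : c < 1 by rewrite ltr_pdivrMr // mul1r.
have cs : s'%:C * c%:C = s%:C :> R[i] by rewrite -rmorphM /= mulrC divfK // gt_eqF.
have hg := holo_circle _ _ hf s01; have hg' := holo_circle _ _ hf s'01.
have [M M0 HM] := cbmeas_bound _ hg.
apply/eqP; rewrite -subr_eq0 -normc_eq0 eq_le normc_ge0 andbT leNgt; apply/negP => D0.
set D := normc (f z - ps _ z) in D0.
have e0 : 0 < D / 4 by rewrite divr_gt0.
have e80 : 0 < D / 4 / 2 by rewrite divr_gt0.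
have [eta eta0 Heta] : exists2 eta, 0 < eta & forall t, normc (ei t - ei t0) < eta ->
    normc (f (s%:C * ei t) - f (s%:C * ei t0)) <= D / 4 / 2.
  have [eta eta0 H] := holo_ccont f z hf z1 _ e80.
  exists eta => // t Ht; rewrite -zE; apply/ltW/H.
  rewrite {1}zE -mulrBr normcM normcR gtr0_norm //.
  by apply: le_lt_trans Ht; rewrite ler_piMl ?normc_ge0 // ltW.
have [dl /andP[dl0 dl1] Hdl] := poisson_unif _ _ _ e0 eta0 M0.
have nc : normc (c%:C * ei t0) < 1 by rewrite normc_rexpi // ltW.
have [r' r'0 Hr'] := cdiff_ccont _ _ (cauchy_cdiff _ _ hg' nc) _ e0.
pose m := Num.min dl r'.
have m0 : 0 < m by rewrite lt_min dl0.
have m1 : m <= 1 by rewrite ge_min dl1.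
pose r := 1 - m / 2.
have r1 : r < 1 by rewrite /r; move: m0; lra.
have r0 : 0 < r by rewrite /r; move: m1; lra.
have rdl : 1 - dl < r by rewrite /r; have : m <= dl by [rewrite ge_min lexx]; move: m0; lra.
have nr : normc (r%:C * ei t0) < 1 by rewrite normc_rexpi // ltW.
have A1 := Hdl _ t0 r hg HM Heta rdl r1.
rewrite -cauchy_poisson // in A1; last by move=> n; exact: fcoef_circle_neg.
rewrite cauchy_circle_ps // -zE in A1.
have nrc : normc (r%:C * (c%:C * ei t0)) < 1.
  by rewrite normcM normcR gtr0_norm // normc_rexpi ?ltW // mulr_ilt1 // ltW.
have A2 : normc (cauchy (fun t => f (s'%:C * ei t)) (r%:C * (c%:C * ei t0))
                 - cauchy (fun t => f (s'%:C * ei t)) (c%:C * ei t0)) < D / 4.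
  apply: Hr'; rewrite (_ : r%:C * (c%:C * ei t0) - c%:C * ei t0 = (r - 1)%:C * (c%:C * ei t0)).
    rewrite normcM normcR normc_rexpi ?ltW // distrC ger0_norm ?subr_ge0 ?ltW //.
    rewrite (le_lt_trans (_ : _ <= 1 - r)) ?ler_piMr ?subr_ge0 ?ltW //.
    by rewrite /r; have : m <= r' by [rewrite ge_min lexx orbT]; move: m0; lra.
  exact: realC_sub1.
rewrite !cauchy_circle_ps // in A2.
have E1 : s'%:C * (r%:C * (c%:C * ei t0)) = s%:C * (r%:C * ei t0).
  by rewrite -cs; ring.
have E2 : s'%:C * (c%:C * ei t0) = z by rewrite mulrA cs.
rewrite E1 E2 in A2.
have : D <= D / 4 + D / 4 := le_trans (normc_tri _ _ _) (lerD A1 (ltW A2)).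
by clear -D0; lra.
Qed.

Lemma cauchy_circle f s z : holo f -> 0 < s < 1 -> normc z < 1 ->
  cauchy (fun t => f (s%:C * ei t)) z = f (s%:C * z).
Proof.
move=> hf s01 z1; rewrite cauchy_circle_ps // -holo_ps //.
case/andP: s01 => s0 s1; rewrite normcM normcR gtr0_norm //.
by rewrite mulr_ilt1 ?normc_ge0 // ltW.
Qed.

Lemma poisson_circle f s z : holo f -> 0 < s < 1 -> normc z < 1 ->
  f (s%:C * z) = cavg (fun t => f (s%:C * ei t) * (pker z t)%:C).
Proof.
move=> hf s01 z1; rewrite -cauchy_circle // cauchy_poisson //; first exact: holo_circle.
by move=> n; exact: fcoef_circle_neg.
Qed.

Lemma le_poisson_circle f s z : holo f -> 0 < s < 1 -> normc z < 1 ->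
  normc (f (s%:C * z)) <= avg (fun t => normc (f (s%:C * ei t)) * pker z t).
Proof.
move=> hf s01 z1; rewrite poisson_circle //.
have hp := cbmeas_real _ (bmeas_pker _ z1).
rewrite (le_trans (le_normc_cavg _ (cbmeasM _ _ (holo_circle _ _ hf s01) hp))) //.
rewrite le_eqVlt; apply/orP; left; apply/eqP; apply: eq_avg => t.
by rewrite normcM normcR ger0_norm // pker_ge0.
Qed.

Lemma max_modulus f s B z : holo f -> 0 < s < 1 -> (forall t, normc (f (s%:C * ei t)) <= B) ->
  normc z < 1 -> normc (f (s%:C * z)) <= B.
Proof.
move=> hf s01 HB z1; rewrite (le_trans (le_poisson_circle _ _ _ hf s01 z1)) //.
have hp := bmeas_pker _ z1.
rewrite -[leRHS]mulr1 -(avg_pker z z1) -avgZ //; apply: le_avg.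
- by apply: bmeasM => //; exact/cbmeas_normc/holo_circle.
- by apply: bmeasM => //; exact: bmeas_cst.
- by move=> t; rewrite ler_wpM2r // pker_ge0.
Qed.

Lemma taylor_tail f s M z N : holo f -> 0 < s < 1 ->
  (forall t, normc (f (s%:C * ei t)) <= M) -> normc z < 1 ->
  normc (f (s%:C * z) - \sum_(n < N) taylor f n * (s%:C * z) ^+ n)
    <= M / (1 - normc z) * normc z ^+ N.
Proof. by move=> hf s01 HM z1; rewrite -cauchy_circle //; exact: cauchy_circle_tail. Qed.

Lemma bessel_holo f s N : holo f -> 0 < s < 1 ->
  \sum_(n < N) normc (taylor f n) ^+ 2 * s ^+ n ^+ 2 <= avg (fun t => normc (f (s%:C * ei t)) ^+ 2).
Proof.
move=> hf s01; have := bessel _ N (holo_circle _ _ hf s01).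
apply: le_trans; rewrite le_eqVlt; apply/orP; left; apply/eqP; apply: eq_bigr => n _.
case/andP: (s01) => s0 _.
by rewrite fcoef_circle // normcM normcX normcR gtr0_norm // exprMn.
Qed.

(* On a smaller circle the partial sums converge uniformly. *)
Lemma avg_sqr_holo_le f s A : holo f -> 0 < s < 1 ->
  (forall N, \sum_(n < N) normc (taylor f n) ^+ 2 * s ^+ n ^+ 2 <= A) ->
  avg (fun t => normc (f (s%:C * ei t)) ^+ 2) <= A.
Proof.
move=> hf s01 HA; have [s0 s1] := andP s01.
pose s' := (1 + s) / 2.
have ss' : s < s' by rewrite /s' ltr_pdivlMr //; lra.
have s'1 : s' < 1 by rewrite /s' ltr_pdivrMr //; lra.
have s'0 : 0 < s' by exact: lt_trans ss'.
have s'01 : 0 < s' < 1 by rewrite s'0.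
pose c : R := s / s'.
have c0 : 0 < c by rewrite divr_gt0.
have c1 : c < 1 by rewrite ltr_pdivrMr // mul1r.
have cs : s'%:C * c%:C = s%:C :> R[i] by rewrite -rmorphM /= mulrC divfK // gt_eqF.
have hg := holo_circle _ _ hf s01.
have [M M0 HM] := cbmeas_bound _ hg.
have [M' M'0 HM'] := cbmeas_bound _ (holo_circle _ _ hf s'01).
pose b n := taylor f n * s%:C ^+ n.
pose K := M' / (1 - c).
have K0 : 0 <= K by rewrite divr_ge0 // subr_ge0 ltW.
have tail N t : normc (f (s%:C * ei t) - trigp b N t) <= K * c ^+ N.
  have nc : normc (c%:C * ei t) = c by rewrite normc_rexpi // ltW.
  have := taylor_tail _ _ _ (c%:C * ei t) N hf s'01 HM'; rewrite nc => /(_ c1).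
  rewrite mulrA cs; congr (normc (_ - _) <= _); apply: eq_bigr => n _.
  by rewrite exprMn mulrA.
have ht N : cbmeas (trigp b N) by exact: cbmeas_trigp.
have sq u : cbmeas u -> bmeas (fun t => normc (u t) ^+ 2).
  by move=> hu; apply: bmeasX; exact: cbmeas_normc.
rewrite -subr_le0; apply: (le_geometric_eq0 _ (K * (2 * M + K)) c) => [|N].
  by rewrite ltW.
have HA' := HA N; have P := parseval_trigp b N.
have bE : \sum_(n < N) normc (taylor f n) ^+ 2 * s ^+ n ^+ 2 = \sum_(n < N) normc (b n) ^+ 2.
  by apply: eq_bigr => n _; rewrite /b normcM normcX normcR gtr0_norm // exprMn.
rewrite bE -P in HA'.
apply: (@le_trans _ _ (avg (fun t => normc (f (s%:C * ei t)) ^+ 2) - avg (fun t => normc (trigp b N t) ^+ 2))).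
  by rewrite lerD2l lerN2.
rewrite -avgB; [|exact: sq|exact: sq].
apply: avg_le; first by apply: bmeasB; exact: sq.
move=> t; have T := tail N t; set u := f _ in T *; set v := trigp _ _ _ in T *.
have uM : normc u <= M by exact: HM.
have cN : c ^+ N <= 1 by rewrite exprn_ile1 // ltW.
have cN0 : 0 <= c ^+ N by rewrite exprn_ge0 // ltW.
have kc : K * c ^+ N <= K by rewrite ler_piMr.
have d1 : normc u - normc v <= K * c ^+ N.
  by rewrite (le_trans _ T) // (le_trans (ler_norm _)) // normcBB.
have d2 : normc v <= M + K.
  rewrite -[v](subrK u) addrC (le_trans (le_normcD _ _)) // lerD // normcB.
  exact: le_trans T kc.
have n1 := normc_ge0 u; have n2 := normc_ge0 v.
rewrite subr_sqr mulrC -[leRHS]mulrA [_ * c ^+ N]mulrC mulrA [leRHS]mulrC.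
have P0 : 0 <= normc u + normc v by rewrite addr_ge0.
have P1 : normc u + normc v <= 2 * M + K by move: uM d2; lra.
rewrite (le_trans (ler_wpM2l P0 d1)) // ler_wpM2r // mulr_ge0 //.
Qed.

(** * Power series with bounded coefficients *)

Section SquareSummable.
Variables (c : nat -> R[i]) (C : R).
Hypothesis HC : forall n, normc (c n) <= C.

Let C0 : 0 <= C. Proof. exact: le_trans (normc_ge0 _) (HC 0%N). Qed.

Lemma ps_bounded_tail z N : normc z < 1 ->
  normc (ps c z - \sum_(n < N) c n * z ^+ n) <= 2 * C * normc z ^+ N / (1 - normc z).
Proof.
move=> z1; have := ps_tail c 1 C z ltr01 C0; rewrite divr1; apply => // n.
by rewrite expr1n mulr1.
Qed.

Lemma cdiff_poly N z : cdiff (fun w => \sum_(n < N) c n * w ^+ n) z.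
Proof.
elim: N => [|N IH].
  by under eq_fun do rewrite big_ord0; exact: cdiff_cst.
under eq_fun do rewrite big_ord_recr /=; apply: cdiffD => //.
by apply: cdiffM; [exact: cdiff_cst|apply: cdiffX; exact: cdiff_id].
Qed.

Lemma ps_ccont z : normc z < 1 -> ccont (ps c) z.
Proof.
move=> z1 e e0; pose q := (1 + normc z) / 2; have n0 := normc_ge0 z.
have q1 : q < 1 by rewrite /q ltr_pdivrMr //; lra.
have zq : normc z < q by rewrite /q ltr_pdivlMr //; lra.
have q0 : 0 < q by exact: le_lt_trans zq.
have e30 : 0 < e / 3 by rewrite divr_gt0.
have [N HN] : exists N, 2 * C / (1 - q) * q ^+ N < e / 3.
  apply: contrapT => H; suff : e / 3 <= 0 by rewrite leNgt e30.
  apply: (le_geometric_eq0 _ (2 * C / (1 - q)) q); first by rewrite q1 ltW.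
  by move=> N; rewrite leNgt; apply/negP => ?; apply: H; exists N.
have tail w : normc w < q -> normc (ps c w - \sum_(n < N) c n * w ^+ n) < e / 3.
  move=> wq; have w1 : normc w < 1 by exact: lt_trans q1.
  apply: le_lt_trans HN; rewrite (le_trans (ps_bounded_tail w N w1)) //.
  rewrite mulrAC; apply: ler_pM; rewrite ?exprn_ge0 ?normc_ge0 //.
  - by rewrite divr_ge0 ?mulr_ge0 // subr_ge0 ltW.
  - by rewrite ler_wpM2l ?mulr_ge0 // lef_pV2 ?posrE ?subr_gt0 // lerD2l lerN2 ltW.
  - by rewrite lerXn2r ?nnegrE ?normc_ge0 // ltW.
have [r r0 Hr] := cdiff_ccont _ _ (cdiff_poly N z) _ e30.
exists (Num.min r (q - normc z)); first by rewrite lt_min r0 subr_gt0.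
move=> w; rewrite lt_min => /andP[/Hr H1 H2].
have wq : normc w < q.
  by rewrite -(subrK z w) (le_lt_trans (le_normcD _ _)) // -ltrBrDr.
have T1 := tail _ wq; have T2 := tail _ zq.
set a1 := \sum_(n < N) c n * w ^+ n in H1 T1; set a2 := \sum_(n < N) c n * z ^+ n in H1 T2.
rewrite (le_lt_trans (normc_tri3 _ _ a1 a2)) // [ltRHS](_ : e = e / 3 + e / 3 + e / 3).
  exact: (ltrD (ltrD T1 H1) T2).
by field.
Qed.

Lemma cbmeas_ps s : 0 < s < 1 -> cbmeas (fun t => ps c (s%:C * ei t)).
Proof.
move=> /andP[s0 s1]; apply: (cbmeas_circle (ps c)) => t; apply: ps_ccont.
by rewrite normc_rexpi // ltW.
Qed.

Lemma fcoef_ps s n : 0 < s < 1 -> fcoef (fun t => ps c (s%:C * ei t)) n = c n * s%:C ^+ n.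
Proof.
move=> s01; have [s0 s1] := andP s01; have hg := cbmeas_ps _ s01.
apply/eqP; rewrite -subr_eq0; apply/eqP.
apply: (normc_small_eq0 _ (2 * C / (1 - s) * s ^+ n.+1) s) => [|N]; first by rewrite s1 ltW.
have hp := cbmeas_trigp (fun n => c n * s%:C ^+ n) (n.+1 + N).
have := fcoef_trigp (fun n => c n * s%:C ^+ n) (n.+1 + N) n.
rewrite ltn_addr // => <-.
have hJ := cbmeas_expiXJ (R := R) n.
rewrite /fcoef -cavgB; [|exact: cbmeasM|exact: cbmeasM].
apply: normc_cavg_le; first by apply: cbmeasB; exact: cbmeasM.
move=> t; rewrite -mulrBl normcM normcX normc_conj normc_expi expr1n mulr1.
have nz : normc (s%:C * ei t) = s by rewrite normc_rexpi // ltW.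
have := ps_bounded_tail (s%:C * ei t) (n.+1 + N); rewrite nz => /(_ s1).
rewrite exprD -!mulrA [s ^+ N * _]mulrC !mulrA mulrAC [in leRHS](mulrAC _ _ (1 - s)^-1).
rewrite (_ : \sum_(k < _) _ = trigp (fun n => c n * s%:C ^+ n) (n.+1 + N) t) //.
  by move=> /le_trans; apply; rewrite le_eqVlt; apply/orP; left; apply/eqP; ring.
by apply: eq_bigr => k _; rewrite exprMn mulrA.
Qed.

Lemma cdiff_near (f g' : R[i] -> R[i]) z r : 0 < r -> (forall w, normc (w - z) < r -> f w = g' w) ->
  cdiff f z -> cdiff g' z.
Proof.
move=> r0 E [d Hd]; exists d => e e0; have [r1 r10 H1] := Hd e e0.
exists (Num.min r r1); first by rewrite lt_min r0.
move=> h; rewrite lt_min => /andP[hr /H1].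
by rewrite !E // ?subrr ?(@normc0 R) // addrC addKr.
Qed.

(** The series is continuous and its Fourier coefficients on a circle are known, so near [z] it
    coincides with its own Cauchy integral, which is differentiable by [cauchy_cdiff]. Termwise
    differentiation is avoided. *)
Lemma holo_ps_bounded : holo (ps c).
Proof.
move=> z z1; pose s := (1 + normc z) / 2; have n0 := normc_ge0 z.
have s1 : s < 1 by rewrite /s ltr_pdivrMr //; lra.
have zs : normc z < s by rewrite /s ltr_pdivlMr //; lra.
have s0 : 0 < s by exact: le_lt_trans zs.
have s01 : 0 < s < 1 by rewrite s0.
have sn0 : s%:C != 0 :> R[i] by rewrite -normc_gt0 normcR normr_gt0 gt_eqF.
have hg := cbmeas_ps _ s01; have [M M0 HM] := cbmeas_bound _ hg.
apply: (cdiff_near (fun w => cauchy (fun t => ps c (s%:C * ei t)) (s%:C^-1 * w)) _ _ (s - normc z)).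
- by rewrite subr_gt0.
- move=> w wz; have ws : normc w < s.
    by rewrite -(subrK z w) (le_lt_trans (le_normcD _ _)) // -ltrBrDr.
  have nw : normc (s%:C^-1 * w) < 1.
    by rewrite normcM normcV normcR gtr0_norm // mulrC ltr_pdivrMr // mul1r.
  apply: (csum_unique _ _ (M / (1 - normc (s%:C^-1 * w))) (normc (s%:C^-1 * w))).
  + exact: normc01.
  + by rewrite divr_ge0 // subr_ge0 ltW.
  move=> N; have := cauchy_tail _ _ M N hg HM nw.
  congr (normc (_ - _) <= _); apply: eq_bigr => n _.
  by rewrite fcoef_ps // -mulrA -exprMn mulVKf.
apply: (cdiff_comp (fun w => s%:C^-1 * w)); first exact: cdiffMl.
apply: cauchy_cdiff => //.
by rewrite normcM normcV normcR gtr0_norm // mulrC ltr_pdivrMr // mul1r.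
Qed.

End SquareSummable.

End PowerSeriesExpansion.

(** * Outer majorants and Hardy means *)

Section OuterMajorant.
Context {R : realType}.
Implicit Types (f G : R[i] -> R[i]) (u : R -> R) (z w : R[i]) (q r s t M e : R).

(** [2 * ker z t - 1] is (e^it + z) / (e^it - z): this is the Herglotz transform, whose real part is
    the Poisson integral of [u]. *)
Definition herg u z : R[i] := cavg (fun t => (u t)%:C * (2 * ker z t - 1)).

Lemma hergE u z : bmeas u -> normc z < 1 ->
  herg u z = 2 * cauchy (fun t => (u t)%:C) z - (avg u)%:C.
Proof.
move=> hu z1; have hc := cbmeas_real _ hu; have hk := cbmeas_cauchy _ _ hc z1.
rewrite /cauchy -cavgZ // -cavg_real -cavgB //.
  by apply: eq_cavg => t; ring.
by apply: cbmeasM => //; exact: cbmeas_cst.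
Qed.

Lemma holo_herg u : bmeas u -> holo (herg u).
Proof.
move=> hu z z1.
have hc := cbmeas_real _ hu.
apply: (cdiff_near (fun w => 2 * cauchy (fun t => (u t)%:C) w + - (avg u)%:C) _ _ (1 - normc z)).
- by rewrite subr_gt0.
- move=> w wz; rewrite hergE // -(subrK z w) (le_lt_trans (le_normcD _ _)) //.
  by rewrite -ltrBrDr.
apply: cdiffD; last exact: cdiff_cst.
by apply: cdiffM; [exact: cdiff_cst|exact: cauchy_cdiff].
Qed.

Lemma Re_herg u z : normc z < 1 -> Re (herg u z) = avg (fun t => u t * pker z t).
Proof.
by move=> z1; rewrite Re_cavg; apply: eq_avg => t; rewrite Re_mulr -pker_Re.
Qed.

(** Compares two Cauchy kernels on a slightly larger circle. The estimate makes log max (|f|, c)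
    Lipschitz on the circle, hence uniformly close to its Poisson integral. *)
Lemma holo_lipschitz f s : holo f -> 0 < s < 1 -> exists2 L, 0 <= L &
  forall z w, normc z <= s -> normc w <= s -> normc (f z - f w) <= L * normc (z - w).
Proof.
move=> hf s01; have [s0 s1] := andP s01.
pose s' := (1 + s) / 2.
have ss' : s < s' by rewrite /s' ltr_pdivlMr //; lra.
have s'1 : s' < 1 by rewrite /s' ltr_pdivrMr //; lra.
have s'0 : 0 < s' by exact: lt_trans ss'.
have s'01 : 0 < s' < 1 by rewrite s'0.
have sn0 : s'%:C != 0 :> R[i] by rewrite -normc_gt0 normcR normr_gt0 gt_eqF.
have hg := holo_circle _ _ hf s'01.
have [M M0 HM] := cbmeas_bound _ hg.
pose c : R := s / s'.
have c1 : c < 1 by rewrite ltr_pdivrMr // mul1r.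
pose d := 1 - c; have d0 : 0 < d by rewrite subr_gt0.
have L0 : 0 <= M * (d^-1 * d^-1) / s'.
  by apply: divr_ge0; [apply: mulr_ge0 => //; rewrite mulr_ge0 // invr_ge0 ltW|exact: ltW].
exists (M * (d^-1 * d^-1) / s') => // z w zs ws.
have sc x : normc x <= s -> normc (s'%:C^-1 * x) <= c.
  by move=> xs; rewrite normcM normcV normcR gtr0_norm // mulrC ler_wpM2r // invr_ge0 ltW.
have [zc wc] := (sc _ zs, sc _ ws).
have z1 := le_lt_trans zc c1; have w1 := le_lt_trans wc c1.
have fE x : normc (s'%:C^-1 * x) < 1 -> f x = cauchy (fun t => f (s'%:C * ei t)) (s'%:C^-1 * x).
  by move=> x1; rewrite cauchy_circle // mulVKf.
rewrite (fE z z1) (fE w w1) /cauchy -cavgB; [|exact: cbmeas_cauchy|exact: cbmeas_cauchy].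
apply: normc_cavg_le; first by apply: cbmeasB; exact: cbmeas_cauchy.
move=> t; rewrite -mulrBr !kerE.
set z' := s'%:C^-1 * z in z1 zc *; set w' := s'%:C^-1 * w in w1 wc *.
have nz := ei_sub_neq0 z' t z1; have nw := ei_sub_neq0 w' t w1.
have -> : ei t / (ei t - z') - ei t / (ei t - w') = ei t * (z' - w') * ((ei t - z')^-1 * (ei t - w')^-1).
  by field; rewrite nz nw.
have bd x : normc x <= c -> normc x < 1 -> (normc (ei t - x))^-1 <= d^-1.
  move=> xc x1; rewrite lef_pV2 ?posrE //; last by rewrite normc_gt0 ei_sub_neq0.
  by apply: le_trans (le_ei_sub x t); rewrite lerD2l lerN2.
have -> : M * (d^-1 * d^-1) / s' * normc (z - w) = M * (normc (z' - w') * (d^-1 * d^-1)).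
  rewrite /z' /w' -mulrBr normcM normcV normcR gtr0_norm //; ring.
rewrite normcM; apply: ler_pM; rewrite ?normc_ge0 //.
rewrite (normcM (ei t * _)) normcM normc_expi mul1r; apply: ler_wpM2l; first exact: normc_ge0.
rewrite normcM !normcV; apply: ler_pM; rewrite ?invr_ge0 ?normc_ge0 //; exact: bd.
Qed.

Lemma ln_sub_le (a b c : R) : 0 < c -> c <= a -> c <= b -> `|ln a - ln b| <= `|a - b| / c.
Proof.
move=> c0; wlog ab : a b / b <= a.
  move=> H ca cb; case: (leP b a) => [ba|/ltW ab]; first exact: H.
  by rewrite distrC [`|a - b|]distrC; exact: H.
move=> ca cb; have a0 := lt_le_trans c0 ca; have b0 := lt_le_trans c0 cb.
rewrite ger0_norm; last by rewrite subr_ge0 ler_ln.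
rewrite ger0_norm ?subr_ge0 // -ln_div ?posrE //.
have -> : a / b = 1 + (a - b) / b by field; rewrite gt_eqF.
have h0 : 0 <= (a - b) / b by rewrite divr_ge0 ?subr_ge0 // ltW.
rewrite (le_trans (le_ln1Dx _)) //; first by rewrite (lt_le_trans _ h0) // ltrN10.
by rewrite ler_wpM2l ?subr_ge0 // lef_pV2.
Qed.

Lemma normr_max_le (a b c : R) : `|Num.max a c - Num.max b c| <= `|a - b|.
Proof.
wlog ab : a b / b <= a.
  move=> H; case: (leP b a) => [ba|/ltW ab]; first exact: H.
  by rewrite distrC [`|a - b|]distrC; exact: H.
rewrite [leRHS]ger0_norm ?subr_ge0 // ler_norml !maxEle.
by case: (leP a c) => h1; case: (leP b c) => h2; lra.
Qed.

(** [G] is exp (q W / 2), where Re W is the Poisson integral of log max (|f|, c) raised by [eps]. On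
    the circle of radius [rho] the exponential of Re W is at least the modulus of the rescaled [f],
    so the maximum principle for the product with exp (- W) gives the majorization inside. The
    circle of radius [rho] stands in for the unit circle, on which W is not controlled. *)
Lemma outer_majorant f s c q e : holo f -> 0 < s < 1 -> 0 < c -> 0 < q -> 0 < e ->
  exists G (rho : R), [/\ holo G, 0 < rho < 1,
    forall z, normc z < 1 -> normc (f (s%:C * z)) `^ q <= normc (G (rho%:C * z)) ^+ 2 &
    forall t, normc (G (rho%:C * ei t)) ^+ 2 <=
      expR e * Num.max (normc (f (s%:C * ei t))) c `^ q].
Proof.
move=> hf s01 c0 q0 e0; have [s0 s1] := andP s01.
have [L L0 HL] := holo_lipschitz _ _ hf s01.
pose m t := Num.max (normc (f (s%:C * ei t))) c.
have mc t : c <= m t by rewrite le_max lexx orbT.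
have m0 t : 0 < m t by exact: lt_le_trans (mc t).
pose u t := ln (m t).
have nse t : normc (s%:C * ei t) = s by rewrite normc_rexpi // ltW.
have uL t t' : `|u t - u t'| <= L / c * normc (ei t - ei t').
  rewrite (le_trans (ln_sub_le _ _ _ c0 (mc t) (mc t'))) // mulrAC ler_pM2r ?invr_gt0 //.
  rewrite (le_trans (normr_max_le _ _ _)) // (le_trans (normcBB _ _)) //.
  rewrite (le_trans (HL _ _ _ _)) ?nse // ler_wpM2l //.
  by rewrite -mulrBr normcM normcR gtr0_norm // ler_piMl ?normc_ge0 // ltW.
have Lc0 : 0 <= L / c by rewrite divr_ge0 // ltW.
have hu : bmeas u.
  apply: bmeas_continuous_periodic; last by move=> a b ab; rewrite /u /m ab.
  move=> t; apply/cvgrPdist_lt => d d0; apply/nbhs_normP.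
  have K0 : 0 < L / c * 2 + 1 by rewrite ltr_wpDl // mulr_ge0.
  exists (d / (L / c * 2 + 1)); first by rewrite /= divr_gt0.
  move=> t' /=; rewrite ltr_pdivlMr // => tt'.
  rewrite (le_lt_trans (uL t t')) // (le_lt_trans _ tt') //.
  rewrite (le_trans (ler_wpM2l Lc0 (ei_lip t t'))) // mulrA mulrC ler_wpM2l //.
  by rewrite lerDl.
have [_ [M HM]] := hu.
have M0 : 0 <= M := le_trans (normr_ge0 _) (HM 0).
(* Re W exceeds [u] by at most [2 * eps] on the circle of radius [rho], and [2 * eps * q = e]. *)
pose eps := e / (2 * q).
have eps0 : 0 < eps by rewrite divr_gt0 // mulr_gt0.
pose eta := eps / 2 / (L / c + 1).
have Lc1 : 0 < L / c + 1 by rewrite ltr_wpDl.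
have eta0 : 0 < eta by rewrite divr_gt0 // divr_gt0.
have hg := cbmeas_real _ hu.
have [dl /andP[dl0 dl1] Hdl] := poisson_unif _ _ _ eps0 eta0 M0.
(* Close enough to 1 for the Poisson approximation, and larger than [s] so that w -> f((s / rho) w)
   is holomorphic on the disk. *)
pose rho := Num.max (1 - dl / 2) ((1 + s) / 2).
have rho1 : rho < 1 by rewrite gt_max; apply/andP; split; lra.
have rhos : s < rho by rewrite lt_max; apply/orP; right; lra.
have rhod : 1 - dl < rho by rewrite lt_max; apply/orP; left; lra.
have rho0 : 0 < rho by exact: lt_trans rhos.
have nr t : normc (rho%:C * ei t) = rho by rewrite normc_rexpi // ltW.
have near t : `|Re (herg u (rho%:C * ei t)) - u t| <= eps.
  have := Hdl (fun t => (u t)%:C) t rho hg _ _ rhod rho1.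
  have b1 : forall t, normc (u t)%:C <= M by move=> x; rewrite normcR.
  have b2 : forall t', normc (ei t' - ei t) < eta -> normc ((u t')%:C - (u t)%:C) <= eps / 2.
    move=> t'; rewrite /eta ltr_pdivlMr // => h; rewrite -rmorphB normcR.
    rewrite (le_trans (uL t' t)) // (le_trans _ (ltW h)) // mulrC ler_wpM2l ?normc_ge0 //.
    by rewrite lerDl.
  move=> /(_ b1 b2); apply: le_trans.
  rewrite Re_herg ?nr // (_ : cavg _ = (avg (fun x => u x * pker (rho%:C * ei t) x))%:C).
    by rewrite -rmorphB normcR.
  by rewrite -cavg_real; apply: eq_cavg => x; rewrite rmorphM.
pose W z := herg u z + eps%:C.
have hW : holo W.
  by move=> z z1; apply: cdiffD; [exact: holo_herg|exact: cdiff_cst].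
have ReW t : u t <= Re (W (rho%:C * ei t)) <= u t + eps + eps.
  by have := near t; rewrite ReDc /= ler_norml; lra.
have holoE (k : R[i]) : holo (fun z => cexp (k * W z)).
  move=> z z1; apply: (cdiff_comp (fun x => k * W x) cexp); last exact: cdiff_cexp.
  by apply: cdiffM; [exact: cdiff_cst|exact: hW].
have rz z : normc z < 1 -> normc (rho%:C * z) < 1.
  by move=> z1; rewrite normcM normcR gtr0_norm // mulr_ilt1 ?normc_ge0 // ltW.
have inside h z : holo h -> (forall t, normc (h (rho%:C * ei t)) <= m t) -> normc z < 1 ->
    normc (h (rho%:C * z)) <= expR (Re (W (rho%:C * z))).
  move=> hh Hh z1; pose k w := h w * cexp (- 1 * W w).
  have hk : holo k by move=> w w1; apply: cdiffM; [exact: hh|exact: holoE].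
  have kb t : normc (k (rho%:C * ei t)) <= 1.
    rewrite /k normcM normc_cexp mulN1r ReNc expRN ler_pdivrMr ?expR_gt0 // mul1r.
    rewrite (le_trans (Hh t)) // -[leLHS]lnK ?posrE // ler_expR.
    by case/andP: (ReW t).
  have rho01 : 0 < rho < 1 by rewrite rho0.
  have := max_modulus _ _ _ _ hk rho01 kb z1.
  by rewrite /k normcM normc_cexp mulN1r ReNc expRN ler_pdivrMr ?expR_gt0 // mul1r.
(* The exponent q / 2 makes |G|^2 comparable with |f|^q, and the means of squares are monotone by
   Parseval. *)
exists (fun z => cexp ((q / 2)%:C * W z)), rho.
have GE z : normc (cexp ((q / 2)%:C * W z)) ^+ 2 = expR (Re (W z)) `^ q.
  rewrite normc_cexp Re_mulr -expRM_natl -expRM; congr expR.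
  by rewrite mulr_natl mulr2n; field.
split => //.
- by rewrite rho0.
- move=> z z1; rewrite GE; apply: ge0_ler_powR; rewrite ?nnegrE ?normc_ge0 ?expR_ge0 //; first exact: ltW.
  pose h w := f ((s / rho)%:C * w).
  have hh : holo h.
    move=> w w1; apply: (cdiff_comp (fun x => (s / rho)%:C * x)); first exact: cdiffMl.
    apply: hf; rewrite normcM normcR ger0_norm ?divr_ge0 ?ltW //.
    by rewrite mulr_ilt1 ?normc_ge0 ?divr_ge0 ?ltW // ltr_pdivrMr // mul1r.
  have hE w : h (rho%:C * w) = f (s%:C * w).
    by rewrite /h mulrA -rmorphM /= divfK // gt_eqF.
  rewrite -hE; apply: inside => // t; rewrite hE /m le_max lexx //.
- move=> t; rewrite GE.
  have mE : m t `^ q = expR (u t) `^ q by rewrite /u lnK ?posrE.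
  rewrite -/(m t) mE -!expRM -expRD ler_expR.
  have /andP[_ h] := ReW t.
  rewrite (le_trans (ler_wpM2r (ltW q0) h)) //.
  have eE : e = 2 * eps * q by rewrite /eps; field; rewrite gt_eqF.
  by rewrite eE le_eqVlt; apply/orP; left; apply/eqP; ring.
Qed.

End OuterMajorant.

(** * Monotone means and a harmonic majorant *)

Section HardyMajorant.
Context {R : realType}.
Implicit Types (f G : R[i] -> R[i]) (u : R -> R) (z w : R[i]) (q r s t M e : R)
  (c : nat -> R[i]).

Lemma bmeas_powR u q : bmeas u -> (forall t, 0 <= u t) -> 0 < q -> bmeas (fun t => u t `^ q).
Proof.
move=> [mu_ [M HM]] u0 q0; split.
  exact: measurableT_comp (measurable_powR q) mu_.
exists (M `^ q) => t; rewrite ger0_norm ?powR_ge0 //.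
have tM : u t <= M by apply: le_trans (HM t); exact: ler_norm.
by apply: ge0_ler_powR; rewrite ?nnegrE ?u0 //; [exact: ltW|exact: le_trans tM].
Qed.

Lemma bmeas_max u k : bmeas u -> bmeas (fun t => Num.max (u t) k).
Proof.
move=> [mu_ [M HM]]; split; first exact: measurable_maxr.
by exists (M + `|k|) => t; have := HM t; rewrite maxEle;
  case: ifP => _ h; [rewrite lerDr (le_trans _ h)|rewrite (le_trans h) // lerDl].
Qed.

Lemma bmeas_sqr_circle f r : holo f -> 0 <= r < 1 -> bmeas (fun t => normc (f (r%:C * ei t)) ^+ 2).
Proof.
move=> hf /andP[r0 r1]; apply: bmeasX; apply: cbmeas_normc; apply: holo_cbmeas => //.
by rewrite normcR ger0_norm.
Qed.

Lemma bmeas_powR_circle f r q : holo f -> 0 <= r < 1 -> 0 < q ->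
  bmeas (fun t => normc (f (r%:C * ei t)) `^ q).
Proof.
move=> hf /andP[r0 r1] q0; apply: bmeas_powR => //; last by move=> t; exact: normc_ge0.
by apply: cbmeas_normc; apply: holo_cbmeas => //; rewrite normcR ger0_norm.
Qed.

(** The mean square is the sum of |a_n|^2 r^(2n), which increases with r. The value r = 0 is outside
    the range of the lemmas on circles; there only |G(0)|^2 remains, the first term of Bessel's
    inequality. *)
Lemma avg_sqr_mono G r s : holo G -> 0 <= r -> r <= s -> 0 < s < 1 ->
  avg (fun t => normc (G (r%:C * ei t)) ^+ 2) <= avg (fun t => normc (G (s%:C * ei t)) ^+ 2).
Proof.
move=> hG; rewrite le_eqVlt => /orP[/eqP <- rs s01|r0 rs s01].
  have := bessel_holo _ _ 1 hG s01; rewrite big_ord1 expr0 expr1n mulr1 taylor0 //.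
  apply: le_trans; rewrite -[leRHS]avg_cst le_eqVlt; apply/orP; left; apply/eqP.
  by apply: eq_avg => t; rewrite mul0r.
have [s0 s1] := andP s01.
apply: avg_sqr_holo_le => // [|N]; first by rewrite r0 (le_lt_trans rs).
apply: le_trans (bessel_holo _ _ N hG s01); apply: ler_sum => n _.
rewrite ler_wpM2l ?sqr_ge0 // lerXn2r ?nnegrE ?exprn_ge0 //; [exact: ltW|exact: ltW|].
by rewrite lerXn2r ?nnegrE // ltW.
Qed.

Lemma max_powR_le (a c q : R) : 0 <= a -> 0 <= c -> Num.max a c `^ q <= a `^ q + c `^ q.
Proof. by move=> a0 c0; rewrite maxEle; case: ifP => _; rewrite ?lerDl ?lerDr powR_ge0. Qed.

Lemma avg_max_le f s (c : R) q e : holo f -> 0 < s < 1 -> 0 < c -> 0 < q ->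
  avg (fun t => expR e * Num.max (normc (f (s%:C * ei t))) c `^ q) <=
  expR e * (avg (fun t => normc (f (s%:C * ei t)) `^ q) + c `^ q).
Proof.
move=> hf /andP[s0 s1] c0 q0; have s01 : 0 <= s < 1 by rewrite ltW.
have hu := bmeas_powR_circle _ _ _ hf s01 q0.
have hm : bmeas (fun t => Num.max (normc (f (s%:C * ei t))) c `^ q).
  apply: bmeas_powR => //; last by move=> t; rewrite le_max normc_ge0.
  apply: bmeas_max; apply: cbmeas_normc; apply: holo_cbmeas => //.
  by rewrite normcR gtr0_norm.
rewrite avgZ //; apply: ler_wpM2l; first exact: expR_ge0.
rewrite -(avg_cst (c `^ q)) -avgD //; last exact: bmeas_cst.
apply: le_avg => // [|t]; first by apply: bmeasD => //; exact: bmeas_cst.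
by apply: max_powR_le; [exact: normc_ge0|exact: ltW].
Qed.

(** At radius r, |f|^q is compared with |G|^2 at radius [rho * (r / s)]; then the mean of |G|^2
    increases up to [rho], where it is almost the mean of |f|^q at radius s. *)
Lemma hardy_mono f r s q : holo f -> 0 <= r < s -> s < 1 -> 0 < q ->
  avg (fun t => normc (f (r%:C * ei t)) `^ q) <= avg (fun t => normc (f (s%:C * ei t)) `^ q).
Proof.
move=> hf /andP[r0 rs] s1 q0; have s0 := le_lt_trans r0 rs.
have s01 : 0 < s < 1 by rewrite s0.
set A := avg _; set B := avg _.
have B0 : 0 <= B by apply: avg_ge0 => t; exact: powR_ge0.
(* The tolerance ln (1 + d) and the floor d^(1/q) turn the loss of [outer_majorant] into the factor
   1 + d and the summand d. *)
have key d : 0 < d -> A <= (1 + d) * (B + d).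
  move=> d0; have d10 : 0 < 1 + d by rewrite addr_gt0.
  have d1 : 1 < 1 + d by rewrite ltrDl.
  have e0 : 0 < ln (1 + d) by exact: ln_gt0.
  have c0 : 0 < d `^ q^-1 by exact: powR_gt0.
  have [G [rho [hG rho01 H1 H3]]] := outer_majorant _ _ _ _ _ hf s01 c0 q0 e0.
  have [rho0 rho1] := andP rho01.
  have := avg_max_le _ _ _ _ (ln (1 + d)) hf s01 c0 q0.
  rewrite -powRrM mulVf ?gt_eqF // powRr1 ?(ltW d0) // lnK ?posrE //.
  apply: le_trans.
  have k0 : 0 <= r / s by rewrite divr_ge0 // ltW.
  have k1 : r / s < 1 by rewrite ltr_pdivrMr // mul1r.
  have rk0 : 0 <= rho * (r / s) by rewrite mulr_ge0 // ltW.
  have rk1 : rho * (r / s) <= rho by rewrite ler_piMr // ltW.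
  apply: (@le_trans _ _ (avg (fun t => normc (G (rho%:C * ei t)) ^+ 2))).
    apply: le_trans (avg_sqr_mono _ _ _ hG rk0 rk1 rho01).
    apply: le_avg => [| |t].
    - by apply: bmeas_powR_circle => //; rewrite r0 (lt_trans rs).
    - by apply: bmeas_sqr_circle => //; rewrite rk0 (le_lt_trans rk1).
    have k1' : normc ((r / s)%:C * ei t) < 1 by rewrite normc_rexpi.
    have := H1 _ k1'; rewrite !mulrA -!rmorphM /= [s * _]mulrC divfK ?gt_eqF //.
    by rewrite -mulrA.
  apply: le_avg => [| |t].
  - by apply: bmeas_sqr_circle => //; rewrite ltW.
  - apply: bmeasM; first exact: bmeas_cst.
    apply: bmeas_powR => // [|t]; last by rewrite le_max normc_ge0.
    apply: bmeas_max; apply: cbmeas_normc; apply: holo_cbmeas => //.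
    by rewrite normcR gtr0_norm.
  - by have := H3 t; rewrite lnK ?posrE.
apply/ler_addgt0Pr => e e0.
pose d := Num.min 1 (e / (B + 2)).
have B20 : 0 < B + 2 by rewrite ltr_wpDl.
have d0 : 0 < d by rewrite lt_min ltr01 divr_gt0.
have d1 : d <= 1 by rewrite ge_min lexx.
have de : d * (B + 2) <= e by rewrite -ler_pdivlMr // ge_min lexx orbT.
rewrite (le_trans (key d d0)) //.
have : d * d <= d by rewrite ler_piMr // ltW.
by move: de; rewrite !mulrDl !mulrDr !mul1r mulr1; lra.
Qed.

(** Compactness of [-B, B] along an ultrafilter. A single [U] gives limits to all bounded sequences
    at once, so the countably many coefficients need no diagonal extraction. *)
Lemma ultra_lim (U : set_system nat) (u : nat -> R) B : UltraFilter U ->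
  (forall k, `|u k| <= B) -> exists l, forall e, 0 < e -> U [set k | `|u k - l| < e].
Proof.
move=> UU HB.
have hB : U (u @^-1` `[- B, B]%classic).
  by apply: (@filterS _ U _ setT) => [k _|]; [rewrite /= in_itv /= -ler_norml|exact: filterT].
have [p [_ cl]] := @segment_compact R (- B) B (u @ U) _ hB.
exists p => e e0.
have [//|UC] := in_ultra_setVsetC [set k | `|u k - p| < e] UU.
have [x [/= xe]] : [set x | ~ `|x - p| < e] `&` ball p e !=set0.
  by apply: cl; [exact: UC|exact: nbhsx_ballx].
by rewrite -ball_normE /= distrC.
Qed.

Lemma ultra_climit (U : set_system nat) c B : UltraFilter U ->
  (forall k, normc (c k) <= B) -> exists l, forall e : R, 0 < e -> U [set k | normc (c k - l) < e].
Proof.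
move=> UU HB.
have [x Hx] := ultra_lim U (fun k => Re (c k)) B UU (fun k => le_trans (normRe_le _) (HB k)).
have [y Hy] := ultra_lim U (fun k => Im (c k)) B UU (fun k => le_trans (normIm_le _) (HB k)).
exists (x +i* y) => e e0; have e2 : 0 < e / 2 by rewrite divr_gt0.
apply: filterS2 (Hx _ e2) (Hy _ e2) => k /= h1 h2.
rewrite (le_lt_trans (normc_le_ReIm _)) // ReDc ImDc ReNc ImNc /= (splitr e).
exact: ltrD.
Qed.

Lemma powR_cont (x q e : R) : 0 < x -> 0 < e -> exists2 d : R, 0 < d &
  forall y, `|y - x| < d -> `|y `^ q - x `^ q| < e.
Proof.
move=> x0 e0.
have dx : derivable (fun y : R => y `^ q) x 1.
  by apply: derivable_powR; rewrite in_itv /= x0.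
have /cvgrPdist_lt /(_ e e0) := differentiable_continuous (proj1 (derivable1_diffP _ _) dx).
move=> /nbhs_normP[d /= d0 H]; exists d => // y yx.
by have := H y; rewrite /= distrC => /(_ yx); rewrite distrC.
Qed.

Lemma ultra_poly (U : set_system nat) (a : nat -> nat -> R[i]) c z N : UltraFilter U ->
  (forall n e, 0 < e -> U [set k | normc (a k n - c n) < e]) -> normc z < 1 ->
  forall e, 0 < e ->
    U [set k | normc (\sum_(n < N) a k n * z ^+ n - \sum_(n < N) c n * z ^+ n) < e].
Proof.
move=> UU H z1; elim: N => [|N IH] e e0.
  by apply: filterS filterT => k _ /=; rewrite !big_ord0 subrr (@normc0 R).
have e2 : 0 < e / 2 by rewrite divr_gt0.
apply: filterS2 (IH _ e2) (H N _ e2) => k /= h1 h2.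
rewrite !big_ord_recr /=.
set A := \sum_(n < N) a k n * z ^+ n in h1 *; set C := \sum_(n < N) c n * z ^+ n in h1 *.
have -> : A + a k N * z ^+ N - (C + c N * z ^+ N) = (A - C) + (a k N - c N) * z ^+ N by ring.
rewrite (le_lt_trans (le_normcD _ _)) // (splitr e).
apply: ltr_leD => //; apply: le_trans (ltW h2).
rewrite normcM normcX; apply: ler_piMr; first exact: normc_ge0.
by rewrite exprn_ile1 ?normc_ge0 // ltW.
Qed.

Lemma ultra_ps (U : set_system nat) (a : nat -> nat -> R[i]) c B z : UltraFilter U ->
  (forall k n, normc (a k n) <= B) -> (forall n, normc (c n) <= B) ->
  (forall n e, 0 < e -> U [set k | normc (a k n - c n) < e]) -> normc z < 1 ->
  forall e, 0 < e -> U [set k | normc (ps (a k) z - ps c z) < e].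
Proof.
move=> UU Ha Hc H z1 e e0; have e3 : 0 < e / 3 by rewrite divr_gt0.
have B0 : 0 <= B := le_trans (normc_ge0 _) (Hc 0).
have [N HN] : exists N, 2 * B * normc z ^+ N / (1 - normc z) < e / 3.
  apply: contrapT => hN; suff : e / 3 <= 0 by rewrite leNgt e3.
  apply: (le_geometric_eq0 _ (2 * B / (1 - normc z)) (normc z)) => [|N]; first exact: normc01.
  by rewrite mulrAC leNgt; apply/negP => h; apply: hN; exists N.
apply: filterS (ultra_poly U a c z N UU H z1 _ e3) => k /= h.
have T1 := le_lt_trans (ps_bounded_tail _ _ (Ha k) z N z1) HN.
have T2 := le_lt_trans (ps_bounded_tail _ _ Hc z N z1) HN.
have -> : e = e / 3 + e / 3 + e / 3 by field.
exact: le_lt_trans (normc_tri3 _ _ _ _) (ltrD (ltrD T1 h) T2).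
Qed.

Lemma ultra_le (U : set_system nat) (u v : nat -> R) (x y : R) : UltraFilter U ->
  (forall k, u k <= v k) -> (forall e, 0 < e -> U [set k | `|u k - x| < e]) ->
  (forall e, 0 < e -> U [set k | `|v k - y| < e]) -> x <= y.
Proof.
move=> UU uv Hx Hy; apply/ler_addgt0Pr => e e0.
have e2 : 0 < e / 2 by rewrite divr_gt0.
have [k [/= h1 h2]] := filter_ex (filterI (Hx _ e2) (Hy _ e2)).
by have := uv k; move: h1 h2; rewrite !ltr_norml; lra.
Qed.

Lemma normc2 : normc (2 : R[i]) = 2.
Proof. by rewrite -(rmorph_nat (real_complex R)) (normcR 2) ger0_norm. Qed.

(** Doubling the coefficients of the Cauchy integral and subtracting the mean leaves the mean itself
    as constant term. *)
Lemma herg_ps u z : bmeas u -> normc z < 1 ->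
  herg u z = ps (fun n => if n == 0%N then (avg u)%:C else 2 * fcoef (fun t => (u t)%:C) n) z.
Proof.
move=> hu z1; have hg := cbmeas_real _ hu; have [M M0 HM] := cbmeas_bound _ hg.
set a := fun n : nat => _.
have a0 : a 0 = 2 * fcoef (fun t => (u t)%:C) 0 - (avg u)%:C.
  have -> : fcoef (fun t => (u t)%:C) 0 = (avg u)%:C.
    by rewrite /fcoef -cavg_real; apply: eq_cavg => t; rewrite expr0 mulr1.
  by rewrite /a /=; ring.
have d0 : 0 < 1 - normc z by rewrite subr_gt0.
have avgM : `|avg u| <= M.
  by rewrite -normcR -cavg_real; apply: normc_cavg_le.
have M1 : 0 <= 2 * (M / (1 - normc z)) + M.
  by apply: addr_ge0 => //; apply: mulr_ge0 => //; apply: divr_ge0 => //; exact: ltW.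
apply: (csum_unique _ _ (2 * (M / (1 - normc z)) + M) (normc z)) => //; first exact: normc01.
case=> [|N].
  rewrite big_ord0 subr0 expr0 mulr1 hergE // (le_trans (le_normcD _ _)) //.
  apply: lerD; last by rewrite (normcN (avg u)%:C) (normcR (avg u)).
  rewrite normcM normc2 ler_wpM2l //.
  have := cauchy_tail _ z M 0 hg HM z1.
  by rewrite big_ord0 subr0 expr0 mulr1.
rewrite hergE // big_ord_recl /= expr0 mulr1 a0.
have -> : 2 * cauchy (fun t => (u t)%:C) z - (avg u)%:C - (2 * fcoef (fun t => (u t)%:C) 0 - (avg u)%:C
    + \sum_(n < N) a (lift ord0 n) * z ^+ bump 0 n)
  = 2 * (cauchy (fun t => (u t)%:C) z - \sum_(n < N.+1) fcoef (fun t => (u t)%:C) n * z ^+ n).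
  rewrite [in RHS]big_ord_recl /= expr0 mulr1.
  have -> : \sum_(n < N) a (lift ord0 n) * z ^+ bump 0 n
      = 2 * \sum_(n < N) fcoef (fun t => (u t)%:C) (bump 0 n) * z ^+ bump 0 n.
    by rewrite mulr_sumr; apply: eq_bigr => n _; rewrite mulrA.
  set S := \sum_(n < N) _; set K := cauchy _ _; set F0 := fcoef _ _; set V := _%:C; ring.
rewrite normcM normc2 (le_trans (ler_wpM2l _ (cauchy_tail _ z M N.+1 hg HM z1))) //.
rewrite [leLHS]mulrA; apply: ler_wpM2r; first by rewrite exprn_ge0 // normc_ge0.
by rewrite lerDl.
Qed.

Lemma normc_fcoef_le u n : bmeas u -> (forall t, 0 <= u t) ->
  normc (fcoef (fun t => (u t)%:C) n) <= avg u.
Proof.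
move=> hu u0; rewrite (le_trans (le_normc_cavg _ _)) //.
  by apply: cbmeasM; [exact: cbmeas_real|exact: cbmeas_expiXJ].
rewrite le_eqVlt; apply/orP; left; apply/eqP; apply: eq_avg => t.
by rewrite normcM normcX normc_conj normc_expi expr1n mulr1 normcR ger0_norm.
Qed.

(** |f(s_k z)|^q lies below the real part of the Herglotz transform of [u k], whose coefficients are
    bounded independently of k. They converge along an ultrafilter finer than the filter at
    infinity, while f(s_k z) tends to f(z). *)
Theorem harmonic_majorant f q A : holo f -> 0 < q ->
  (forall r, 0 < r < 1 -> avg (fun t => normc (f (r%:C * ei t)) `^ q) <= A) ->
  exists c (C : R), (forall n, normc (c n) <= C) /\
    forall z, normc z < 1 -> normc (f z) `^ q <= Re (ps c z).
Proof.
move=> hf q0 HA.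
pose s (k : nat) : R := 1 - (k.+2%:R)^-1.
have i0 k : 0 < (k.+2%:R : R)^-1 by rewrite invr_gt0.
have i1 k : (k.+2%:R : R)^-1 < 1 by rewrite invf_lt1 // ltr1n.
have s01 k : 0 < s k < 1 by rewrite subr_gt0 i1 ltrBlDr ltrDl i0.
have e0 : 0 < ln (2 : R) by rewrite ln_gt0 // ltr1n.
(* The tolerance ln 2 and the floor 1 in [outer_majorant] appear here as the factor 2 and the
   maximum with 1. *)
pose u k t := 2 * Num.max (normc (f ((s k)%:C * ei t))) 1 `^ q.
have u0 k t : 0 <= u k t by apply: mulr_ge0 => //; exact: powR_ge0.
have hu k : bmeas (u k).
  have [s0 s1] := andP (s01 k).
  apply: bmeasM; first exact: bmeas_cst.
  apply: bmeas_powR => // [|t]; last by rewrite le_max normc_ge0.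
  apply: bmeas_max; apply: cbmeas_normc; apply: holo_cbmeas => //.
  by rewrite normcR gtr0_norm.
have uA k : avg (u k) <= 2 * (A + 1).
  have := avg_max_le _ _ _ _ (ln 2) hf (s01 k) ltr01 q0.
  rewrite powR1 lnK ?posrE // => h; apply: le_trans h _.
  by rewrite ler_wpM2l // lerD2r HA.
have major k z : normc z < 1 -> normc (f ((s k)%:C * z)) `^ q <= Re (herg (u k) z).
  move=> z1; have [G [rho [hG r01 H1 H3]]] := outer_majorant _ _ _ _ _ hf (s01 k) ltr01 q0 e0.
  have hG2 : holo (fun w => G w ^+ 2) by move=> w w1; apply: cdiffX; exact: hG.
  have hp := bmeas_pker _ z1.
  rewrite (le_trans (H1 z z1)) // -normcX Re_herg //.
  rewrite (le_trans (le_poisson_circle _ _ _ hG2 r01 z1)) //; apply: le_avg => [| |t].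
  - by apply: bmeasM => //; apply: cbmeas_normc; exact: (holo_circle (fun w => G w ^+ 2)).
  - exact: bmeasM.
  apply: ler_wpM2r; first exact: pker_ge0.
  by rewrite normcX; have := H3 t; rewrite lnK ?posrE.
pose a k n : R[i] := if n == 0%N then (avg (u k))%:C else 2 * fcoef (fun t => (u k t)%:C) n.
pose B := 2 * (2 * (A + 1)).
have aB k n : normc (a k n) <= B.
  have avg0 : 0 <= avg (u k) by exact: avg_ge0.
  rewrite /a /B; case: eqP => _.
    by rewrite normcR ger0_norm //; move: (uA k) avg0; lra.
  rewrite normcM normc2 ler_wpM2l //.
  exact: le_trans (normc_fcoef_le _ _ (hu k) (u0 k)) (uA k).
have [U [UU subU]] := ultraFilterLemma (F := \oo) _.
have [c Hc] := choice (fun n => ultra_climit U (fun k => a k n) B UU (fun k => aB k n)).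
have cB n : normc (c n) <= B.
  apply: (ultra_le U (fun k => normc (a k n)) (fun=> B)) => // [e ee|e ee].
    by apply: filterS (Hc n _ ee) => k /=; apply: le_lt_trans; exact: normcBB.
  by apply: filterS filterT => k _ /=; rewrite subrr normr0.
exists c, B; split => // z z1.
have lim e (ee : 0 < e) : U [set k | `|Re (herg (u k) z) - Re (ps c z)| < e].
  apply: filterS (ultra_ps U a c B z UU aB cB Hc z1 e ee) => k hk.
  by rewrite /mkset herg_ps // -ReNc -ReDc; exact: le_lt_trans (normRe_le _) hk.
(* [powR_cont] concerns positive bases; at a zero of f the majorant only has to be nonnegative. *)
have [f0|f0] := eqVneq (f z) 0.
  rewrite f0 (@normc0 R) powR0 ?gt_eqF //.
  apply: (ultra_le U (fun=> 0) _ _ _ UU _ _ lim) => [k|e ee].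
    exact: le_trans (powR_ge0 _ _) (major k z z1).
  by apply: filterS filterT => k _ /=; rewrite subrr normr0.
apply: (ultra_le U (fun k => normc (f ((s k)%:C * z)) `^ q) _ _ _ UU _ _ lim) => [k|e ee].
  exact: major.
have fz0 : 0 < normc (f z) by rewrite normc_gt0.
have [d d0 Hd] := powR_cont _ q _ fz0 ee.
have [r r0 Hr] := holo_ccont _ _ hf z1 _ d0.
apply: subU; apply: filterS (near_infty_natSinv_lt (PosNum r0)) => k /= hk.
apply: Hd; apply: le_lt_trans (normcBB _ _) (Hr _ _).
rewrite realC_sub1 normcM normcR /s addrAC subrr add0r normrN gtr0_norm //.
apply: le_lt_trans hk; rewrite -[leRHS]mulr1; apply: ler_pM; rewrite ?normc_ge0 ?(ltW z1) ?(ltW (i0 k)) //.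
by rewrite lef_pV2 ?posrE // ler_nat.
Qed.

Lemma bernoulli_sub (x : R) n : 0 <= x -> 0 <= 1 - x -> 1 - n%:R * x <= (1 - x) ^+ n.
Proof.
move=> x0 x1; elim: n => [|n IH]; first by rewrite mul0r subr0 expr0.
rewrite exprS (le_trans _ (ler_wpM2l x1 IH)) // -natr1 -subr_ge0.
rewrite (_ : _ - _ = n%:R * x ^+ 2); first by rewrite mulr_ge0 // sqr_ge0.
by ring.
Qed.

(* With a holomorphic [P] whose real part majorizes [|f|^q], the multiplier
   [(1 + e P)^-k] is at most 1 in modulus and makes [f] bounded once
   [k q >= 1], because [|f|^q <= Re P <= |1 + e P| / e]. *)
Lemma bounded_multiplier f q A r e : holo f -> 0 < q ->
  (forall r, 0 < r < 1 -> avg (fun t => normc (f (r%:C * ei t)) `^ q) <= A) ->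
  r < 1 -> 0 < e -> exists h, [/\ holo h, forall z, normc z < 1 -> normc (h z) <= 1,
    exists M, forall z, normc z < 1 -> normc (f z * h z) <= M &
    forall z, normc z <= r -> 1 - e <= normc (h z)].
Proof.
move=> hf q0 HA r1 e0; have [c [C [HC Hc]]] := harmonic_majorant _ _ _ hf q0 HA.
have C0 : 0 <= C := le_trans (normc_ge0 _) (HC 0).
have hP := holo_ps_bounded c C HC.
pose k := (Num.truncn q^-1).+1.
have kq : q^-1 <= k%:R by apply: ltW; exact: truncnS_gt.
pose K := 2 * C / (1 - r).
have d0 : 0 < 1 - r by rewrite subr_gt0.
have K0 : 0 <= K by apply: divr_ge0; [exact: mulr_ge0|exact: ltW].
have kK0 : 0 < k%:R * K + 1 by rewrite ltr_wpDl // mulr_ge0.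
(* Chosen so that Bernoulli's inequality (1 - eps K)^k >= 1 - k eps K loses at most [e] on the disk
   of radius [r], where [K] bounds the series. *)
pose eps := e / (k%:R * K + 1).
have eps0 : 0 < eps by rewrite divr_gt0.
pose D z := 1 + eps%:C * ps c z.
have ReP0 z : normc z < 1 -> 0 <= Re (ps c z).
  by move=> z1; exact: le_trans (powR_ge0 _ _) (Hc z z1).
have ReD z : Re (D z) = 1 + eps * Re (ps c z) by rewrite /D ReDc Re_mulr.
have D1 z : normc z < 1 -> 1 <= normc (D z).
  move=> z1; apply: le_trans (Re_le_normc _); rewrite ReD lerDl mulr_ge0 ?ReP0 //.
  exact: ltW.
have Dn0 z : normc z < 1 -> D z != 0.
  by move=> z1; rewrite -normc_gt0 (lt_le_trans ltr01) // D1.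
pose h z := (D z)^-1 ^+ k.
have hD z : normc (h z) = (normc (D z) ^+ k)^-1 by rewrite /h normcX normcV exprVn.
have D0 z : normc z < 1 -> 0 < normc (D z) by move=> z1; rewrite normc_gt0 Dn0.
exists h; split.
- move=> z z1; apply: cdiffX; apply: cdiffV; first exact: Dn0.
  apply: cdiffD; first exact: cdiff_cst.
  by apply: cdiffM; [exact: cdiff_cst|exact: hP].
- by move=> z z1; rewrite hD invf_le1 ?exprn_gt0 ?D0 // exprn_ege1 // D1.
- exists (eps^-1 `^ q^-1) => z z1.
  have h1 : normc (f z) <= (eps^-1 * normc (D z)) `^ q^-1.
    rewrite -[leLHS](powRr1 (normc_ge0 _)) -(mulfV (lt0r_neq0 q0)) powRrM.
    apply: ge0_ler_powR; rewrite ?nnegrE ?powR_ge0 ?invr_ge0 ?(ltW q0) //.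
      by apply: mulr_ge0; [rewrite invr_ge0 ltW|exact: normc_ge0].
    apply: le_trans (Hc z z1) _; rewrite ler_pdivlMl //.
    by apply: le_trans (Re_le_normc _); rewrite ReD lerDr.
  rewrite normcM hD ler_pdivrMr ?exprn_gt0 ?D0 // (le_trans h1) //.
  rewrite powRM ?invr_ge0 ?(ltW eps0) ?normc_ge0 // ler_wpM2l ?powR_ge0 //.
  by rewrite -powR_mulrn ?normc_ge0 // ler_powR // D1.
- move=> z zr; have z1 := le_lt_trans zr r1; rewrite hD.
  have PK : normc (ps c z) <= K.
    have := ps_bounded_tail c C HC z 0 z1; rewrite big_ord0 subr0 expr0 mulr1 => /le_trans; apply.
    rewrite ler_wpM2l ?mulr_ge0 // lef_pV2 ?posrE ?subr_gt0 // lerD2l lerN2 //.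
  have DK : normc (D z) <= 1 + eps * K.
    rewrite (le_trans (le_normcD _ _)) // (@normc1 R) lerD2l normcM normcR gtr0_norm //.
    by rewrite ler_wpM2l // ltW.
  have K1 : 0 < 1 + eps * K by rewrite ltr_wpDr // mulr_ge0 // ltW.
  apply: (@le_trans _ _ (((1 + eps * K) ^+ k)^-1)); last first.
    rewrite lef_pV2 ?posrE ?exprn_gt0 ?D0 // lerXn2r ?nnegrE ?normc_ge0 //; exact: ltW.
  have b1 : 1 - eps * K <= (1 + eps * K)^-1.
    rewrite -[leRHS]mul1r ler_pdivlMr // -subr_ge0.
    by rewrite (_ : _ - _ = (eps * K) ^+ 2) ?sqr_ge0 //; ring.
  have [neg|pos] := ltP (1 - eps * K) 0.
    apply: (@le_trans _ _ 0); last by rewrite invr_ge0 exprn_ge0 // ltW.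
    have kn : 1 <= k%:R :> R by rewrite ler1n.
    have : eps * (k%:R * K + 1) = e by rewrite divfK // gt_eqF.
    move: neg kn; rewrite mulrDr mulr1 => neg kn eE.
    have : eps * K <= eps * (k%:R * K) by rewrite ler_wpM2l ?(ltW eps0) // ler_peMl.
    by move: neg eE; lra.
  rewrite -exprVn; apply: (@le_trans _ _ ((1 - eps * K) ^+ k)); last first.
    by rewrite lerXn2r ?nnegrE // invr_ge0 ltW.
  have x0 : 0 <= eps * K by apply: mulr_ge0 => //; exact: ltW.
  rewrite (le_trans _ (bernoulli_sub _ k x0 pos)) // lerD2l lerN2.
  have : eps * (k%:R * K + 1) = e by rewrite divfK // gt_eqF.
  move=> <-; rewrite mulrCA mulrDr mulr1 lerDl; exact: ltW.
Qed.

End HardyMajorant.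

(** * Nontangential boundary behaviour *)

Section Nontangential.
Context {R : realType}.
Local Notation leb := (@lebesgue_measure R).
Implicit Types (f F : R[i] -> R[i]) (u : R -> R) (z w : R[i]) (r s t theta K M e : R)
  (c : nat -> R[i]).

Lemma normc_ei_sub s t : normc (ei s - ei t) = 2 * `|sin ((s - t) / 2)|.
Proof.
have -> : ei s - ei t = ei t * (ei (s - t) - 1).
  by rewrite mulrBr mulr1 -eiD [t + _]addrC subrK.
rewrite normcM normc_expi mul1r.
apply/eqP; rewrite -(eqrXn2 (n := 2)) ?normc_ge0 ?mulr_ge0 //.
rewrite normc_sqr ReDc ImDc ReNc ImNc /= oppr0 addr0 Re_ei Im_ei.
rewrite {1 2}(splitr (s - t)) cosD sinD exprMn -normrX ger0_norm ?sqr_ge0 //.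
have := cos2Dsin2 ((s - t) / 2); set a := cos _; set b := sin _ => h.
apply/eqP; have -> : a * a - b * b - 1 = - 2 * b ^+ 2.
  by transitivity (a * a - b * b - (a ^+ 2 + b ^+ 2)); [rewrite h|ring].
have -> : (- 2 * b ^+ 2) ^+ 2 + (b * a + a * b) ^+ 2 = 4 * b ^+ 2 * (a ^+ 2 + b ^+ 2) by ring.
by rewrite h mulr1 -natrX.
Qed.

(** Up to 1/2 the slope comes from the mean value theorem and the minimum of cos; beyond 1/2 it
    comes from the positive minimum of sin on a compact interval. *)
Lemma sin_lower (b : R) : 0 < b < pi -> exists2 k : R, 0 < k &
  forall y, 0 <= y <= b -> k * y <= sin y.
Proof.
move=> /andP[b0 bpi]; have p2 := pihalf_ge1 R.
have [x1 x1h H1] := @EVT_min R cos 0 2^-1 (ltW (andP half01).1)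
  (continuous_subspaceT (@continuous_cos R)).
pose b' := Num.max b 2^-1.
have b'h : 2^-1 <= b' by rewrite le_max lexx orbT.
have h1 : (2^-1 : R) < 1 by have /andP[] := @half01 R.
have b'pi : b' < pi.
  by rewrite gt_max bpi /= (lt_le_trans h1) // (le_trans _ (pi_ge2 R)) // ler1n.
have [x2 x2h H2] := @EVT_min R sin 2^-1 b' b'h (continuous_subspaceT (@continuous_sin R)).
have c0 : 0 < cos x1.
  move: x1h; rewrite in_itv /= => /andP[l r].
  apply: cos_gt0_pihalf; rewrite (lt_le_trans (_ : - (pi / 2) < 0) l) ?oppr_lt0 //.
    by rewrite (le_lt_trans r) // (lt_le_trans h1).
  by rewrite (lt_le_trans ltr01).
have s0 : 0 < sin x2.
  move: x2h; rewrite in_itv /= => /andP[l r].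
  apply: sin_gt0_pi; rewrite (le_lt_trans r b'pi) andbT (lt_le_trans _ l) //.
have p0 := pi_gt0 R.
exists (Num.min (cos x1) (sin x2 / pi)); first by rewrite lt_min c0 divr_gt0.
move=> y /andP[y0 yb]; have [yh|yh] := leP y 2^-1.
  apply: (@le_trans _ _ (cos x1 * y)); first by rewrite ler_wpM2r // ge_min lexx.
  have [|x xy] := @MVT_segment R sin cos 0 y y0.
    by apply: continuous_subspaceT; exact: continuous_sin.
  rewrite sin0 !subr0 => ->; rewrite ler_wpM2r //; apply: H1.
  by move: xy; rewrite !in_itv /= => /andP[-> /le_trans ->].
apply: (@le_trans _ _ (sin x2 / pi * y)); first by rewrite ler_wpM2r // ge_min lexx orbT.
apply: (@le_trans _ _ (sin x2)).
  rewrite mulrAC ler_pdivrMr // ler_wpM2l ?(ltW s0) //.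
  by rewrite (le_trans yb) // ltW.
by apply: H2; rewrite in_itv /= (ltW yh) /b' le_max yb.
Qed.

(** The half angle [|t - theta| / 2] stays below some [b < pi]. As [t] runs through a fixed period,
    the constant degenerates when [theta] tends to the cut point 0, which is why 0 is discarded as a
    null set later. *)
Lemma chord_lower theta : 0 < theta < 2 * pi -> exists2 C : R, 0 < C &
  forall t, 0 <= t <= 2 * pi -> `|t - theta| <= C * normc (ei t - ei theta).
Proof.
move=> /andP[th0 th1]; pose b := Num.max theta (2 * pi - theta) / 2.
have b0 : 0 < b by rewrite divr_gt0 // lt_max th0.
have bpi : b < pi by rewrite ltr_pdivrMr // [pi * 2]mulrC gt_max th1 ltrBlDr ltrDl.
have [|k k0 Hk] := sin_lower b; first by rewrite b0.
exists k^-1; first by rewrite invr_gt0.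
move=> t /andP[t0 t1]; rewrite ler_pdivlMl // normc_ei_sub.
have yb : `|t - theta| / 2 <= b.
  rewrite ler_pM2r ?invr_gt0 // ler_norml; apply/andP; split.
    by rewrite -lerN2 opprK le_max; apply/orP; left; move: t0; lra.
  by rewrite le_max; apply/orP; right; move: t1; lra.
have y0 : 0 <= `|t - theta| / 2 by rewrite divr_ge0.
have := Hk _ (introT andP (conj y0 yb)); rewrite mulrA ler_pdivrMr // => /le_trans; apply.
rewrite mulrC ler_pM2l //.
have [h|h] := leP 0 (t - theta).
  by rewrite ger0_norm // ler_norm.
by rewrite ltr0_norm // mulNr sinN -normrN ler_norm.
Qed.

Lemma bmeas_indic (A : set R) : measurable A -> bmeas (\1_A : R -> R).
Proof.
move=> mA; split; first exact: measurable_indic.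
exists 1 => t; rewrite ger0_norm // indicE; by case: (_ \in _).
Qed.

Lemma arc_integrable u (D : set R) : measurable D -> D `<=` `[0, 2 * pi] -> bmeas u ->
  leb.-integrable D (EFin \o u).
Proof.
move=> mD sD [mu_ [M HM]]; apply: measurable_bounded_integrable => //.
- apply: (@le_lt_trans _ _ (leb `[0, 2 * pi])); first by apply: le_measure; rewrite ?inE.
  by rewrite lebesgue_measure_itv /=; case: ifP => _; rewrite ?ltry // -EFinB ltry.
- exact: measurable_funTS.
- by exists M; split; [exact: num_real|move=> x Mx t _; exact: le_trans (HM t) (ltW Mx)].
Qed.

Lemma le_avg_arc (u v : R -> R) : bmeas u -> bmeas v -> (forall t, 0 <= t <= 2 * pi -> u t <= v t) ->
  avg u <= avg v.
Proof.
move=> hu hv uv; rewrite !avg_lebesgue //; apply: ler_wpM2l; first exact: inv_2pi_ge0.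
apply: le_Rintegral => //; exact: arc_integrable.
Qed.

Lemma EFin_avg u : bmeas u -> (forall t, 0 <= u t) ->
  (avg u)%:E = (((2 * pi)^-1)%:E * \int[leb]_(x in `[0%R, (2 * pi)%R[) (u x)%:E)%E.
Proof.
move=> hu u0; rewrite avg.unlock -ge0_integral_dtheta2pi.
- rewrite /Rintegral fineK //; exact: integral_fune_fin_num (bmeas_integrable _ hu).
- by apply/measurable_EFinP; case: hu.
- by move=> x; rewrite lee_fin.
Qed.

Lemma bmeas_sum n (U : 'I_n -> R -> R) : (forall i, bmeas (U i)) ->
  bmeas (fun t => \sum_(i < n) U i t) /\ avg (fun t => \sum_(i < n) U i t) = \sum_(i < n) avg (U i).
Proof.
elim: n U => [|n IH] U HU.
  under eq_fun do rewrite big_ord0; rewrite big_ord0 avg_cst; split => //; exact: bmeas_cst.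
have [h1 h2] := IH (fun i => U (widen_ord (leqnSn n) i)) (fun i => HU _).
under eq_fun do rewrite big_ord_recr; rewrite big_ord_recr /=; split.
  by apply: bmeasD => //; exact: HU.
by rewrite avgD // h2.
Qed.

(** Spreads the Poisson kernel over dyadic balls. In the induction either d < 2^J K h and the
    shorter sum suffices, or D >= 2^J h and the last term alone, 8 / (4^(J+1) h) = 2 / (4^J h),
    dominates. *)
Lemma dyadic_bound (d D K h : R) J : 0 < h -> 0 < K -> h <= D -> d <= K * D ->
  d < 2 ^+ J * (K * h) ->
  2 * h / D ^+ 2 <= \sum_(j < J.+1) 8 / (4 ^+ j * h) * (d < 2 ^+ j * (K * h))%R%:R.
Proof.
move=> h0 K0 hD dKD.
have D0 : 0 < D := lt_le_trans h0 hD.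
have term0 j : 0 <= 8 / (4 ^+ j * h) * (d < 2 ^+ j * (K * h))%R%:R.
  by apply: mulr_ge0 => //; apply: divr_ge0 => //; apply: mulr_ge0; [exact: exprn_ge0|exact: ltW].
elim: J => [|J IH] dJ.
  rewrite big_ord1 expr0 mul1r dJ mulr1 ler_pdivrMr ?exprn_gt0 // mulrAC ler_pdivlMr //.
  by rewrite expr0 mul1r in dJ; nra.
rewrite big_ord_recr /=; have [lt|ge] := ltP d (2 ^+ J * (K * h)).
  by rewrite (le_trans (IH lt)) // lerDl.
rewrite dJ mulr1; apply: (@le_trans _ _ (8 / (4 ^+ J.+1 * h))); last first.
  by rewrite lerDr sumr_ge0.
have DJ : 2 ^+ J * h <= D.
  rewrite -(ler_pM2l K0) (le_trans _ dKD) // (le_trans _ ge) // mulrCA //.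
have P0 : 0 < (2 ^+ J : R) by rewrite exprn_gt0.
rewrite ler_pdivrMr ?exprn_gt0 // mulrAC ler_pdivlMr ?mulr_gt0 ?exprn_gt0 //.
have -> : (4 ^+ J.+1 : R) = 4 * (2 ^+ J * 2 ^+ J) by rewrite exprS -exprMn; congr (_ * _ ^+ _); ring.
have : (2 ^+ J * h) ^+ 2 <= D ^+ 2.
  by rewrite lerXn2r ?nnegrE ?(ltW D0) // mulr_ge0 // ltW.
by rewrite exprMn; nra.
Qed.

Lemma indic_ball theta r t : \1_(ball theta r) t = (`|t - theta| < r)%R%:R :> R.
Proof.
rewrite indicE distrC; case: (boolP (`|theta - t| < r)) => h; first by rewrite mem_set.
by rewrite memNset // => h'; move/negP: h; apply.
Qed.

(** The ball of radius 2^j K h contributes 8 / (4^j h) times 2^j K h M, that is 8 K M / 2^j, and the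
    geometric series at most doubles the first term. The inequality with [K] is what is retained of
    [z] lying in a Stolz angle at [theta]. *)
Lemma poisson_maximal u z theta K M : bmeas u -> (forall t, 0 <= u t) -> normc z < 1 -> 0 < K -> 0 <= M ->
  (forall r, 0 < r -> avg (fun t => u t * \1_(ball theta r) t) <= r * M) ->
  (forall t, 0 <= t <= 2 * pi -> `|t - theta| <= K * normc (ei t - z)) ->
  avg (fun t => u t * pker z t) <= 16 * K * M.
Proof.
move=> hu u0 z1 K0 M0 HM HK; pose h := 1 - normc z.
have h0 : 0 < h by rewrite subr_gt0.
(* As |e^it - z| <= 2, the largest ball then contains the whole period. *)
have [J HJ] : exists J, K * 2 < 2 ^+ J * (K * h).
  have [J HJ] := geometric_small (K * 2) _ (mulr_gt0 K0 h0).
  exists J; move: HJ; rewrite exprVn ltr_pdivrMr ?exprn_gt0 //.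
  by rewrite [K * h * _]mulrC.
have hb r : bmeas (\1_(ball theta r) : R -> R) by apply: bmeas_indic; exact: measurable_ball.
pose U (j : 'I_J.+1) t := 8 / (4 ^+ j * h) * (u t * \1_(ball theta (2 ^+ j * (K * h))) t).
have hU j : bmeas (U j) by apply: bmeasM; [exact: bmeas_cst|exact: bmeasM].
have [hS ES] := bmeas_sum _ _ hU.
have hpk := bmeas_pker _ z1.
apply: (@le_trans _ _ (avg (fun t => \sum_(j < J.+1) U j t))).
  apply: le_avg_arc => // [|t tI]; first exact: bmeasM.
  have hD := le_ei_sub z t; have dKD := HK t tI.
  have D2 : normc (ei t - z) <= 2.
    rewrite (le_trans (le_normcD _ _)) // normc_expi normcN; move: z1; lra.
  have tJ : `|t - theta| < 2 ^+ J * (K * h).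
    by apply: le_lt_trans HJ; rewrite (le_trans dKD) // ler_wpM2l // ltW.
  have := dyadic_bound _ _ _ _ _ h0 K0 hD dKD tJ => Hdy.
  have -> : \sum_(j < J.+1) U j t =
      u t * \sum_(j < J.+1) 8 / (4 ^+ j * h) * (`|t - theta| < 2 ^+ j * (K * h))%R%:R.
    rewrite mulr_sumr; apply: eq_bigr => j _; rewrite /U mulrCA; congr (_ * (_ * _)).
    exact: indic_ball.
  apply: ler_wpM2l => //; apply: le_trans Hdy; rewrite pker_def.
  apply: ler_wpM2r; first by rewrite invr_ge0 sqr_ge0.
  by have := normc_ge0 z; rewrite /h; move: z1; set x := normc z; nra.
rewrite ES; apply: (@le_trans _ _ (\sum_(j < J.+1) 8 * K * M * 2^-1 ^+ j)).
  apply: ler_sum => j _; rewrite avgZ; last exact: bmeasM.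
  have P0 : 0 < (2 ^+ j : R) by rewrite exprn_gt0.
  have r0 : 0 < 2 ^+ j * (K * h) by rewrite mulr_gt0 // mulr_gt0.
  have c0 : 0 <= 8 / (4 ^+ j * h).
    by apply: divr_ge0 => //; apply: mulr_ge0; [exact: exprn_ge0|exact: ltW].
  apply: le_trans (ler_wpM2l c0 (HM _ r0)) _.
  have -> : (4 ^+ j : R) = 2 ^+ j * 2 ^+ j by rewrite -exprMn; congr (_ ^+ _); ring.
  rewrite exprVn le_eqVlt; apply/orP; left; apply/eqP; field.
  by rewrite !gt_eqF.
have := @geometric_partial R 2^-1 0 J.+1 (introT andP (conj (ltW (andP half01).1) (andP half01).2)) isT.
rewrite big_mkord expr0 -mulr_sumr => hg.
have KM0 : 0 <= 8 * K * M by rewrite mulr_ge0 // mulr_ge0 // ltW.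
apply: le_trans (ler_wpM2l KM0 hg) _.
by rewrite le_eqVlt; apply/orP; left; apply/eqP; field.
Qed.

Local Notation arc := (`[0, 2 * pi[%classic : set R).

Lemma arc_locally_integrable u : bmeas u -> locally_integrable setT (u \_ arc).
Proof.
move=> hu; apply: integrable_locally_restrict => //; apply: arc_integrable => //.
by move=> t /=; rewrite !in_itv /= => /andP[-> /ltW ->].
Qed.

Lemma avg_ball_maximal u theta M r : bmeas u -> (forall t, 0 <= u t) -> 0 < r ->
  (HL_maximal (u \_ arc) theta <= M%:E)%E -> avg (fun t => u t * \1_(ball theta r) t) <= r * M.
Proof.
move=> hu u0 r0 HM.
have hb : bmeas (\1_(ball theta r) : R -> R) by apply: bmeas_indic; exact: measurable_ball.
have w0 t : 0 <= u t * \1_(ball theta r) t by rewrite mulr_ge0.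
have M0 : 0 <= M by rewrite -lee_fin (le_trans _ HM) // HL_maximalT_ge0 //; exact: arc_locally_integrable.
have h : (\int[leb]_(x in ball theta r) `|((u \_ arc) x)%:E| <= (r *+ 2 * M)%:E)%E.
  have : (iavg (u \_ arc) (ball theta r) <= M%:E)%E.
    by apply: le_trans HM; apply: ereal_sup_ubound; exists r => //=; rewrite in_itv /= r0.
  rewrite /iavg lebesgue_measure_ball ?(ltW r0) //.
  have r20 : 0 < r *+ 2 by rewrite pmulrn_lgt0.
  by rewrite inver gt_eqF // lee_pdivrMl // -EFinM.
rewrite -lee_fin EFin_avg //; last exact: bmeasM.
have -> : (\int[leb]_(x in arc) (u x * \1_(ball theta r) x)%:E =
    \int[leb]_(x in ball theta r) `|((u \_ arc) x)%:E|)%E.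
  rewrite integral_mkcond [RHS]integral_mkcond; apply: eq_integral => x _.
  rewrite !patchE indicE; case: (x \in arc); case: (_ \in (ball theta r : set R)) => //=.
  - by rewrite mulr1 ger0_norm.
  - by rewrite mulr0.
  - by rewrite normr0.
apply: le_trans (lee_wpmul2l _ h) _; first by rewrite lee_fin inv_2pi_ge0.
have p2 := pi_ge2 R; have p0 := pi_gt0 R.
rewrite -EFinM lee_fin ler_pdivrMl ?mulr_gt0 // mulr2n.
have rM : 0 <= r * M by rewrite mulr_ge0 // ltW.
by nra.
Qed.

(** 24 is the constant 3 of the maximal inequality times 8 > 2 pi, the latter from passing between
    Lebesgue measure and the average. *)
Lemma maximal_measure u k : bmeas u -> (forall t, 0 <= u t) -> 0 < k ->
  (leb [set x | HL_maximal (u \_ arc) x > k%:E] <= (24 / k * avg u)%:E)%E.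
Proof.
move=> hu u0 k0; apply: le_trans (maximal_inequality (arc_locally_integrable _ hu) k0) _.
have -> : (\int[leb]_y `|((u \_ arc) y)%:E| = \int[leb]_(x in arc) (u x)%:E)%E.
  rewrite [RHS]integral_mkcond; apply: eq_integral => x _.
  by rewrite /patch; case: ifP => h1; rewrite ?normr0 // abse_EFin ger0_norm.
have p0 := pi_gt0 R; have p4 : pi < 4 :> R by have := pihalf_lt2 R; rewrite ltr_pdivrMr //; lra.
have /(congr1 (fun x => (2 * pi)%:E * x)%E) := EFin_avg _ hu u0.
rewrite muleA -!EFinM divff ?gt_eqF ?mulr_gt0 // mul1e => <-.
rewrite -EFinM lee_fin mulrA; apply: ler_wpM2r; first exact: avg_ge0.
by rewrite mulrAC ler_pM2r ?invr_gt0 //; move: p4; lra.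
Qed.

(** The Poisson formula is stated for circles inside the disk; the dilated polynomial w -> P(2 w)
    takes on the circle of radius 1/2 the values of P on the unit circle. *)
Lemma poly_poisson c N z : normc z < 1 ->
  normc (\sum_(n < N) c n * z ^+ n) <= avg (fun t => normc (trigp c N t) * pker z t).
Proof.
move=> z1; pose f w := \sum_(n < N) c n * 2 ^+ n * w ^+ n.
have hf : holo f by move=> w _; exact: (cdiff_poly (fun n => c n * 2 ^+ n)).
have fE w : f (2^-1%:C * w) = \sum_(n < N) c n * w ^+ n.
  apply: eq_bigr => n _; rewrite -mulrA -exprMn mulrA (_ : 2 * 2^-1%:C = 1) ?mul1r //.
  by rewrite -(rmorph_nat (real_complex R)) -rmorphM /= divff.
rewrite -fE (le_trans (le_poisson_circle _ _ _ hf half01 z1)) // le_eqVlt; apply/orP; left.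
by apply/eqP; apply: eq_avg => t; rewrite fE.
Qed.

(* AM-GM in the form [2 x <= k x^2 + 1 / k]. *)
Lemma avg_le_sqr u k : bmeas u -> 0 < k -> avg (fun t => u t ^+ 2) <= k ^- 2 -> avg u <= k^-1.
Proof.
move=> hu k0 H; have hu2 := bmeasX _ 2 hu.
apply: (@le_trans _ _ (avg (fun t => k / 2 * u t ^+ 2 + (2 * k)^-1))).
  apply: le_avg => // [|t].
    by apply: bmeasD; [apply: bmeasM => //; exact: bmeas_cst|exact: bmeas_cst].
  rewrite -subr_ge0 (_ : _ - _ = k / 2 * (u t - k^-1) ^+ 2).
    by rewrite mulr_ge0 ?sqr_ge0 // divr_ge0 // ltW.
  by field; rewrite gt_eqF.
rewrite avgD; [|by apply: bmeasM => //; exact: bmeas_cst|exact: bmeas_cst].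
rewrite avgZ // avg_cst (_ : k^-1 = k / 2 * k ^- 2 + (2 * k)^-1).
  by rewrite lerD2r ler_wpM2l // divr_ge0 // ltW.
by field; rewrite gt_eqF.
Qed.

Lemma bounded_sum_tail c B e : (forall N, \sum_(n < N) normc (c n) ^+ 2 <= B) -> 0 < e ->
  exists N, forall M : nat, (N <= M)%N -> \sum_(N <= n < M) normc (c n) ^+ 2 <= e.
Proof.
move=> HB e0; pose S N := \sum_(n < N) normc (c n) ^+ 2.
have hs : has_sup (range S).
  by split; [exists (S 0), 0|exists B => _ [N _ <-]; exact: HB].
have [_ [N _ <-] HN] := sup_adherent e0 hs.
exists N => M NM; have : S M <= sup (range S) by apply: ub_le_sup; [exact: hs.2|exists M].
rewrite /S -!(big_mkord xpredT (fun n => normc (c n) ^+ 2)) (big_cat_nat _ NM) //= in HN *.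
by move: HN; set x := sup _; lra.
Qed.

(** A block of square mass 4^(-2j) has mean at most 4^(-j); at level 2^(-j) the maximal inequality
    then leaves a set of measure at most 24 / 2^j, which is summable. *)
Lemma block_sequence c B : (forall N, \sum_(n < N) normc (c n) ^+ 2 <= B) ->
  exists N : nat -> nat, (forall j, (N j < N j.+1)%N) /\
    forall j (M : nat), (N j <= M)%N -> \sum_(N j <= n < M) normc (c n) ^+ 2 <= (4 ^+ j) ^- 2.
Proof.
move=> HB.
have e0 j : 0 < (4 ^+ j : R) ^- 2 by rewrite invr_gt0 !exprn_gt0.
have [T HT] := choice (fun j => bounded_sum_tail c B _ HB (e0 j)).
pose N := fix N j := if j is j'.+1 then maxn (N j').+1 (T j) else T 0%N.
have TN j : (T j <= N j)%N by case: j => [|j] //=; rewrite leq_maxr.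
exists N; split => [j /=|j M NM]; first by rewrite leq_maxl.
apply: le_trans (HT j M (leq_trans (TN j) NM)).
by rewrite [leRHS](big_cat_nat (TN j) NM) //= lerDr sumr_ge0 // => n _; exact: sqr_ge0.
Qed.

(** A Cauchy condition in place of a limit: it is used to compare two points of one Stolz angle, and
    the boundary value is never named. *)
Definition nt_cauchy alpha F theta := forall e, 0 < e -> exists2 d : R, 0 < d &
  forall z w, stolz alpha (ei theta) z -> stolz alpha (ei theta) w ->
    normc (z - ei theta) < d -> normc (w - ei theta) < d -> normc (F z - F w) < e.

(** Borel-Cantelli for the lacunary blocks. Off the null set the maximal function of block j at
    [theta] is at most 2^(-j) from some J on; these blocks sum uniformly on the Stolz angle, and the
    part before them is a polynomial, continuous at the boundary point. One null set serves all
    apertures, since [alpha] only enters the constant [K]. *)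
Theorem fatou_l2 c B : (forall N, \sum_(n < N) normc (c n) ^+ 2 <= B) ->
  exists Z : set R, [/\ measurable Z, leb Z = 0%E &
    forall alpha theta, 0 < alpha -> 0 < theta < 2 * pi -> ~ Z theta -> nt_cauchy alpha (ps c) theta].
Proof.
move=> HB; have [N [Nlt HN]] := block_sequence _ _ HB.
pose b j n := if (N j <= n)%N then c n else 0.
pose u j t := normc (trigp (b j) (N j.+1) t).
have u0 j t : 0 <= u j t by exact: normc_ge0.
have hu j : bmeas (u j) by apply: cbmeas_normc; exact: cbmeas_trigp.
have blockE (V : zmodType) j (g : nat -> V) : \sum_(n < N j.+1) (if (N j <= n)%N then g n else 0)
    = \sum_(N j <= n < N j.+1) g n.
  rewrite -(big_mkord xpredT (fun n => if (N j <= n)%N then g n else 0)).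
  rewrite (big_cat_nat (leq0n (N j)) (ltnW (Nlt j))) /= big_nat big1 ?add0r.
    by apply: eq_big_nat => n /andP[-> _].
  by move=> n /andP[_]; rewrite ltnNge => /negbTE ->.
have avgu j : avg (u j) <= (4 ^+ j)^-1.
  apply: avg_le_sqr => //; rewrite parseval_trigp.
  apply: le_trans (HN j (N j.+1) (ltnW (Nlt j))); rewrite -blockE.
  apply: ler_sum => n _; rewrite /b; case: ifP => // _.
  by rewrite (@normc0 R) expr0n.
pose A j := [set x | (HL_maximal (u j \_ arc) x > ((2 ^+ j)^-1)%:E)%E].
have mA j : measurable (A j).
  rewrite -[X in measurable X]setTI; apply: emeasurable_fun_o_infty => //.
  by apply: measurable_HL_maximal; exact: arc_locally_integrable.
have muA j : (leb (A j) <= (24 / 2 ^+ j)%:E)%E.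
  have P0 : 0 < (2 ^+ j : R) by rewrite exprn_gt0.
  apply: le_trans (maximal_measure _ _ (hu j) (u0 j) _) _; first by rewrite invr_gt0.
  rewrite lee_fin invrK -mulrA ler_pM2l // (le_trans (ler_wpM2l (ltW P0) (avgu j))) //.
  have -> : (4 ^+ j : R) = 2 ^+ j * 2 ^+ j by rewrite -exprMn; congr (_ ^+ _); ring.
  by rewrite invfM mulVKf // gt_eqF.
have ZA : leb (lim_sup_set A) = 0%E.
  apply: lim_sup_set_cvg0 => //.
  apply: (@le_lt_trans _ _ (48%:E : \bar R)); last exact: ltry.
  apply: lime_le; first exact: is_cvg_nneseries.
  apply: nearW => m; apply: (@le_trans _ _ (\sum_(0 <= j < m) (24 / 2 ^+ j)%:E)%E).
    by apply: lee_sum => j _; exact: muA.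
  rewrite sumEFin lee_fin -mulr_sumr.
  have := @geometric_partial R 2^-1 0 m (introT andP (conj (ltW (andP half01).1) (andP half01).2)) isT.
  under eq_bigr do rewrite exprVn.
  rewrite (_ : 2^-1 ^+ 0 / (1 - 2^-1) = 2 :> R); last by field.
  by set x := \sum_(_ <= _ < _) _; lra.
exists (lim_sup_set A); split => //.
  by apply: bigcap_measurable => // k _; apply: bigcup_measurable.
move=> alpha theta al0 th nZ e e0.
have [J HJ] : exists J, forall j, (J <= j)%N -> (HL_maximal (u j \_ arc) theta <= ((2 ^+ j)^-1)%:E)%E.
  apply: contrapT => h; apply: nZ => J _; apply: contrapT => h2; apply: h; exists J => j Jj.
  by rewrite leNgt; apply/negP => h3; apply: h2; exists j.
have [C C0 HC] := chord_lower _ th.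
(* In the Stolz angle |e^(i theta) - z| < (1 + alpha) (1 - |z|), and 1 - |z| <= |e^it - z|; hence
   |e^it - e^(i theta)| <= (2 + alpha) |e^it - z|. *)
pose L : R := 2 + alpha; have L0 : 0 < L by rewrite addr_gt0.
pose K := C * L; have K0 : 0 < K by rewrite mulr_gt0.
pose Q m z := \sum_(n < N m) c n * z ^+ n.
have st z : stolz alpha (ei theta) z -> normc z < 1 /\ forall t, 0 <= t <= 2 * pi -> `|t - theta| <= K * normc (ei t - z).
  move=> [z1]; rewrite /= ltr_pdivrMr ?subr_gt0 // => hz; split => // t tI.
  apply: le_trans (HC t tI) _; rewrite -mulrA ler_pM2l //.
  have D := le_ei_sub z t.
  have : normc (ei t - ei theta) <= normc (ei t - z) + normc (ei theta - z).
    rewrite [normc (ei theta - z)]normcB; apply: le_trans (le_normcD _ _).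
    by rewrite addrA subrK.
  by rewrite /L; move: hz D; set h := 1 - normc z; set D0 := normc (ei t - z); nra.
have K32 : 0 <= 32 * K by apply: mulr_ge0 => //; exact: ltW.
have Qstep z j : stolz alpha (ei theta) z -> (J <= j)%N ->
    normc (Q j.+1 z - Q j z) <= 16 * K / 2 ^+ j.
  move=> sz Jj; have [z1 Hz] := st z sz.
  have -> : Q j.+1 z - Q j z = \sum_(n < N j.+1) b j n * z ^+ n.
    rewrite -[RHS](_ : \sum_(N j <= n < N j.+1) c n * z ^+ n = _); last first.
      by rewrite -blockE; apply: eq_bigr => n _; rewrite /b; case: ifP => // _; rewrite mul0r.
    rewrite /Q -!(big_mkord xpredT (fun n => c n * z ^+ n)).
    by rewrite (big_cat_nat (leq0n (N j)) (ltnW (Nlt j))) /= addrAC subrr add0r.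
  apply: le_trans (poly_poisson _ _ _ z1) _.
  have P0 : 0 <= ((2 ^+ j)^-1 : R) by rewrite invr_ge0 exprn_ge0.
  apply: (poisson_maximal (u j) z theta K _ (hu j) (u0 j) z1 K0 P0 _ Hz).
  by move=> r r0; apply: avg_ball_maximal => //; exact: HJ.
(* The right-hand side is the telescoped sum of the bounds 16 K / 2^j. *)
have Qtail z m k : stolz alpha (ei theta) z -> (J <= m)%N ->
    normc (Q (m + k)%N z - Q m z) <= 32 * K * ((2 ^+ m)^-1 - (2 ^+ (m + k))^-1).
  move=> sz Jm; elim: k => [|k IH]; first by rewrite addn0 !subrr (@normc0 R) mulr0.
  have := Qstep z (m + k)%N sz (leq_trans Jm (leq_addr _ _)); rewrite -addnS => h.
  have -> : Q (m + k.+1)%N z - Q m z = (Q (m + k.+1)%N z - Q (m + k)%N z) + (Q (m + k)%N z - Q m z) by ring.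
  apply: le_trans (le_normcD _ _) _; apply: le_trans (lerD h IH) _.
  rewrite le_eqVlt; apply/orP; left; apply/eqP; rewrite addnS exprS.
  by field; rewrite !expf_neq0.
have cB n : normc (c n) <= Num.sqrt B.
  have := HB n.+1; rewrite big_ord_recr /= => h.
  have h2 : normc (c n) ^+ 2 <= B.
    by apply: le_trans h; rewrite lerDr sumr_ge0 // => i _; exact: sqr_ge0.
  by rewrite -[leLHS]ger0_norm ?normc_ge0 // -sqrtr_sqr ler_wsqrtr.
have psQ z m : stolz alpha (ei theta) z -> (J <= m)%N ->
    normc (ps c z - Q m z) <= 32 * K / 2 ^+ m.
  move=> sz Jm; have [z1 _] := st z sz.
  rewrite -subr_le0; apply: (le_geometric_eq0 _ (2 * Num.sqrt B / (1 - normc z)) (normc z)) => [|k].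
    exact: normc01.
  (* Block ends grow at least like their index, so the tail of the series at [N (m + k)] decays
     geometrically in [k]. *)
  have jN j : (j <= N j)%N by elim: j => // j IH; exact: leq_ltn_trans (Nlt j).
  have T := ps_bounded_tail _ _ cB z (N (m + k)%N) z1.
  rewrite -/(Q (m + k)%N z) in T.
  have h := Qtail z m k sz Jm.
  have -> : ps c z - Q m z = (ps c z - Q (m + k)%N z) + (Q (m + k)%N z - Q m z) by ring.
  have hp : 32 * K * ((2 ^+ m)^-1 - (2 ^+ (m + k))^-1) <= 32 * K / 2 ^+ m.
    by apply: (ler_wpM2l K32); rewrite gerBl invr_ge0 exprn_ge0.
  rewrite lerBlDr; apply: le_trans (le_normcD _ _) _; apply: lerD; last exact: le_trans h hp.
  apply: le_trans T _; rewrite mulrAC; apply: ler_wpM2l.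
    by rewrite divr_ge0 ?mulr_ge0 ?sqrtr_ge0 // subr_ge0 ltW.
  apply: ler_wiXn2l; rewrite ?normc_ge0 ?(ltW z1) //.
  exact: leq_trans (leq_addl m k) (jN _).
have [m0 Hm0] := geometric_small (32 * K) _ (divr_gt0 e0 (ltr0Sn R 3)).
pose m := maxn J m0.
have Hm : 32 * K / 2 ^+ m < e / 4.
  apply: le_lt_trans Hm0; rewrite exprVn; apply: (ler_wpM2l K32).
  by rewrite lef_pV2 ?posrE ?exprn_gt0 // ler_weXn2l ?ler1n // leq_maxr.
have e4 : 0 < e / 4 by rewrite divr_gt0.
have [d d0 Hd] := cdiff_ccont _ _ (cdiff_poly c (N m) (ei theta)) _ e4.
exists d => // z w sz sw zd wd.
have h1 := le_lt_trans (psQ z m sz (leq_maxl _ _)) Hm.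
have h2 := le_lt_trans (psQ w m sw (leq_maxl _ _)) Hm.
have h3 : normc (Q m z - Q m w) < e / 4 + e / 4.
  have := Hd z zd; have := Hd w wd; rewrite -/(Q m z) -/(Q m w) -/(Q m (ei theta)) => k1 k2.
  have -> : Q m z - Q m w = (Q m z - Q m (ei theta)) - (Q m w - Q m (ei theta)) by ring.
  apply: le_lt_trans (le_normcD _ _) _; rewrite normcN; exact: ltrD k2 k1.
have -> : e = e / 4 + (e / 4 + e / 4) + e / 4 by field.
exact: le_lt_trans (normc_tri3 _ _ _ _) (ltrD (ltrD h1 h3) h2).
Qed.

End Nontangential.

(** * Stolz angles and change of aperture *)

Section Approach.
Context {R : realType}.
Local Notation leb := (@lebesgue_measure R).
Implicit Types (alpha beta t theta : R) (a : set R[i]) (z w : R[i]).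

Definition approach alpha a theta := forall d, 0 < d -> exists z,
  [/\ a z, stolz alpha (ei theta) z & normc (z - ei theta) < d].

Lemma closure_stolzP alpha a theta :
  closure ((stolz alpha (ei theta) : set R[i]^o) `&` a) (ei theta) <-> approach alpha a theta.
Proof.
split=> [H d d0|H B /nbhs_normcP[d d0 Hd]].
  have [|z [[sz az] zd]] := H [set w : R[i]^o | normc (w - ei theta) < d].
    by apply/nbhs_normcP; exists d.
  by exists z.
by have [z [az sz zd]] := H d d0; exists z; split; [split|exact: Hd].
Qed.

Lemma ntlpP a theta : nontangential_limit_point (a : set R[i]^o) (expi theta) <->
  exists2 beta : R, 0 < beta & approach beta a theta.
Proof.
rewrite /nontangential_limit_point expi_ei.
by split=> -[beta b0 /closure_stolzP H]; exists beta.
Qed.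

Lemma stolzP alpha theta z : stolz alpha (ei theta) z <->
  normc z < 1 /\ normc (ei theta - z) < (1 + alpha) * (1 - normc z).
Proof.
rewrite /stolz /disk /=; split=> -[z1]; rewrite /= ltr_pdivrMr ?subr_gt0 //.
Qed.

Lemma stolz_arc alpha phi t z : 0 < alpha -> normc z < 1 -> z = (normc z)%:C * ei phi ->
  normc (ei t - ei phi) < alpha * (1 - normc z) -> stolz alpha (ei t) z.
Proof.
move=> al0 z1 zE H; apply/stolzP; split => //.
have h : normc (ei phi - z) = 1 - normc z.
  rewrite {1}zE -{1}(mul1r (ei phi)) -mulrBl normcM normc_expi mulr1.
  by rewrite -(rmorph1 (real_complex R)) -rmorphB normcR ger0_norm // subr_ge0 ltW.
have -> : ei t - z = (ei t - ei phi) + (ei phi - z) by rewrite addrA subrK.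
apply: le_lt_trans (le_normcD _ _) _; rewrite h mulrDl mul1r addrC.
by rewrite ltrD2l.
Qed.

(** The chord from e^(i phi) to e^(i theta) is at most (2 + beta) (1 - |z|), and chord and angle are
    comparable once phi is taken within pi of [theta]. *)
Lemma stolz_angle beta theta : 0 < beta -> exists2 C : R, 0 < C & forall z,
  stolz beta (ei theta) z -> exists2 phi, z = (normc z)%:C * ei phi &
    `|phi - theta| <= C * (1 - normc z).
Proof.
move=> b0; have p0 := pi_gt0 R.
have [|k k0 Hk] := @sin_lower R (pi / 2).
  by rewrite divr_gt0 //= ltr_pdivrMr // ltr_pMr // ltr1n.
exists ((2 + beta) / k); first by rewrite divr_gt0 // addr_gt0.
move=> z /stolzP[z1 H].
have [phi0 zE] := polar z.
have [s [j [s0 s1 sE _]]] := ei_mod (phi0 - theta + pi).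
(* Having reduced [phi0 - theta + pi] modulo 2 pi, [phi - theta] lies in [-pi, pi[, so half its
   modulus is in the range of [sin_lower]. *)
pose phi := theta + s - pi.
have phiE : ei phi = ei phi0.
  rewrite -(ei_period_int phi j); congr ei.
  by rewrite /phi; move: sE; set x := j%:~R * _; lra.
exists phi; first by rewrite phiE.
have dphi : phi - theta = s - pi by rewrite /phi; ring.
have ab : `|phi - theta| / 2 <= pi / 2.
  by rewrite ler_pM2r ?invr_gt0 // dphi ler_norml; move: s0 s1; lra.
have nn : 0 <= `|phi - theta| / 2 by rewrite divr_ge0.
have h1 := Hk _ (introT andP (conj nn ab)).
have h2 : normc (ei phi - z) = 1 - normc z.
  rewrite {1}zE phiE -{1}(mul1r (ei phi0)) -mulrBl normcM normc_expi mulr1.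
  by rewrite -(rmorph1 (real_complex R)) -rmorphB normcR ger0_norm // subr_ge0 ltW.
have h3 : normc (ei phi - ei theta) <= (2 + beta) * (1 - normc z).
  have -> : ei phi - ei theta = (ei phi - z) + - (ei theta - z) by ring.
  apply: le_trans (le_normcD _ _) _; rewrite normcN h2.
  by move: (ltW H); lra.
rewrite mulrAC ler_pdivlMr // mulrC.
apply: le_trans h3; rewrite normc_ei_sub.
have sE2 : `|sin ((phi - theta) / 2)| = sin (`|phi - theta| / 2).
  have [h|h] := leP 0 (phi - theta).
    rewrite [in RHS]ger0_norm // ger0_norm //; apply: sin_ge0_pi.
    by move: nn ab; rewrite ger0_norm // => -> /le_trans -> //; rewrite ler_pdivrMr // ler_pMr // ler1n.
  rewrite [in RHS]ltr0_norm // mulNr sinN ler0_norm // -oppr_ge0 -sinN -mulNr; apply: sin_ge0_pi.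
  by move: nn ab; rewrite ltr0_norm // => -> /le_trans -> //; rewrite ler_pdivrMr // ler_pMr // ler1n.
by rewrite sE2; move: h1; rewrite mulrA ler_pdivrMr // mulrC [_ * k]mulrC [sin _ * 2]mulrC.
Qed.

(** The points not approached with aperture [alpha] are covered by these countably many sets, closed
    because Stolz angles depend openly on the vertex; the density theorem applies to each. *)
Definition avoid alpha a (n : nat) : set R :=
  [set t | forall z, a z -> 1 - normc z < n.+1%:R^-1 -> ~ stolz alpha (ei t) z].

Lemma open_setC_avoid alpha a n : open (~` avoid alpha a n).
Proof.
rewrite openE => t /= Ht.
have [z [az zn sz]] : exists z, [/\ a z, 1 - normc z < n.+1%:R^-1 & stolz alpha (ei t) z].
  apply: contrapT => h; apply: Ht => z az zn sz; apply: h; by exists z.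
have /stolzP[z1 H] := sz.
pose g := (1 + alpha) * (1 - normc z) - normc (ei t - z).
have g0 : 0 < g by rewrite subr_gt0.
apply/nbhs_normP; exists (g / 2); first by rewrite /= divr_gt0.
move=> s /= ts Hs; apply: (Hs z az zn); apply/stolzP; split => //.
have -> : ei s - z = (ei s - ei t) + (ei t - z) by rewrite addrA subrK.
apply: le_lt_trans (le_normcD _ _) _.
apply: (@lt_le_trans _ _ (g + normc (ei t - z))); last by rewrite /g subrK.
rewrite ltrD2r (le_lt_trans (ei_lip s t)) // distrC mulrC -ltr_pdivlMr //.
Qed.

Lemma measurable_avoid alpha a n : measurable (avoid alpha a n).
Proof.
rewrite -[avoid _ _ _]setCK; apply: measurableC; apply: open_measurable.
exact: open_setC_avoid.
Qed.

Lemma not_avoid_approach alpha a theta : 0 < alpha -> (forall n, ~ avoid alpha a n theta) ->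
  approach alpha a theta.
Proof.
move=> al0 H d d0; have K0 : 0 < d / (1 + alpha) by rewrite divr_gt0 // addr_gt0.
pose n := Num.truncn (d / (1 + alpha))^-1.
have hn : (n.+1%:R)^-1 <= d / (1 + alpha).
  by rewrite -[leRHS]invrK lef_pV2 ?posrE ?invr_gt0 // ltW // truncnS_gt.
have [z [az zn sz]] : exists z, [/\ a z, 1 - normc z < n.+1%:R^-1 & stolz alpha (ei theta) z].
  apply: contrapT => h; apply: (H n) => z az zn sz; apply: h; by exists z.
exists z; split => //; have /stolzP[z1 hz] := sz.
rewrite normcB (lt_le_trans hz) // mulrC -ler_pdivlMr ?addr_gt0 //.
exact: le_trans (ltW zn) hn.
Qed.

(** A point z of [a] at depth h excludes from the set the arc of radius (alpha / 2) h around its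
    argument. This arc lies in the ball of radius K h around [theta] and fills the fixed fraction
    [e] of it, against density 1. The aperture [beta] only influences [C]. *)
Lemma density_avoid alpha beta a n theta : 0 < alpha -> 0 < beta ->
  (leb (avoid alpha a n `&` ball theta r) * (leb (ball theta r))^-1)%E @[r --> 0^'+] --> (1%:E : \bar R) ->
  ~ approach beta a theta.
Proof.
move=> al0 b0 Hcvg Happ.
have [C C0 HC] := stolz_angle beta theta b0.
pose K := C + alpha / 2; have K0 : 0 < K by rewrite addr_gt0 // divr_gt0.
pose e : R := alpha / (2 * K).
have e0 : 0 < e by rewrite divr_gt0 // mulr_gt0.
have : \forall r \near (0 : R)^'+, ((1 - e)%:E < leb (avoid alpha a n `&` ball theta r) * (leb (ball theta r))^-1)%E.
  apply: (Hcvg [set y | ((1 - e)%:E < y)%E]); rewrite /= /nbhs /=.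
  have : \forall y \near (1 : R), 1 - e < y by apply: lt_nbhsr; rewrite gtrBl.
  by apply: filterS => y; rewrite lte_fin.
move=> /nbhs_normP[d /= d0 Hd].
(* The first bound puts z below the truncation height of [avoid], the second makes the radius
   [K * h] small enough for the density estimate. *)
pose dl := Num.min (n.+1%:R^-1) (d / K).
have dl0 : 0 < dl by rewrite lt_min divr_gt0 // andbT.
have [z [az sz zd]] := Happ dl dl0.
have /stolzP[z1 _] := sz.
pose h := 1 - normc z; have h0 : 0 < h by rewrite subr_gt0.
have hdl : h < dl.
  apply: le_lt_trans zd; rewrite normcB /h.
  by rewrite -{1}(normc_expi theta) (le_trans (ler_norm _)) // normcBB.
have hn : h < n.+1%:R^-1 by apply: lt_le_trans hdl _; rewrite ge_min lexx.
have hd : K * h < d.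
  by rewrite mulrC -ltr_pdivlMr // (lt_le_trans hdl) // ge_min lexx orbT.
have [phi zE Hphi] := HC z sz.
pose r := K * h; have r0 : 0 < r by rewrite mulr_gt0.
pose s := alpha / 2 * h; have s0 : 0 < s by rewrite mulr_gt0 // divr_gt0.
have sub1 : ball phi s `<=` ball theta r.
  move=> t; rewrite -!ball_normE /= => pt.
  have -> : theta - t = - (phi - theta) + (phi - t) by ring.
  rewrite (le_lt_trans (ler_normD _ _)) // normrN /r /K mulrDl.
  exact: ler_ltD.
have sub2 t : ball phi s t -> ~ avoid alpha a n t.
  rewrite -ball_normE /= => pt Ht; apply: (Ht z az hn).
  apply: (stolz_arc alpha phi) => //.
  apply: le_lt_trans (ei_lip _ _) _; rewrite distrC mulrC -ltr_pdivlMr //.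
  by move: pt; rewrite /s mulrAC.
have := Hd r; rewrite /= sub0r normrN gtr0_norm // => /(_ hd r0).
apply/negP; rewrite -leNgt.
have le1 : (leb (avoid alpha a n `&` ball theta r) <= (r *+ 2 - s *+ 2)%:E)%E.
  apply: (@le_trans _ _ (leb (ball theta r `\` ball phi s))).
    apply: le_measure; rewrite ?inE.
    - by apply: measurableI; [exact: measurable_avoid|exact: measurable_ball].
    - by apply: measurableD; exact: measurable_ball.
    - by move=> t [Ht tr]; split => // /sub2.
  rewrite measureD; [|exact: measurable_ball|exact: measurable_ball|].
    rewrite (_ : ball theta r `&` ball phi s = ball phi s); last exact: setIidr.
    apply: (@le_trans _ _ (leb (ball theta r) - leb (ball phi s))%E); first exact: lexx.
    by rewrite !lebesgue_measure_ball ?(ltW r0) ?(ltW s0) // EFinB.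
  apply: (@le_lt_trans _ _ (leb (ball theta r))); first exact: lexx.
  by rewrite lebesgue_measure_ball ?(ltW r0) // ltry.
rewrite lebesgue_measure_ball ?(ltW r0) // inver gt_eqF ?pmulrn_lgt0 //.
rewrite lee_pdivrMr ?pmulrn_lgt0 //; apply: le_trans le1 _.
have er : e * r = s.
  rewrite /e /r /s; move: (h : R) => h'.
  by field; rewrite gt_eqF.
by rewrite -EFinM lee_fin mulrBl mul1r mulrnAr er.
Qed.

(** Density is used only for the countably many sets of the fixed aperture, so [beta] may vary
    freely with the point. *)
Theorem ntlp_approach_ae alpha a : 0 < alpha ->
  {ae leb, forall theta, nontangential_limit_point (a : set R[i]^o) (expi theta) -> approach alpha a theta}.
Proof.
move=> al0.
have H := ae_foralln (fun n => lebesgue_density (measurable_avoid alpha a n)).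
apply: filterS H => theta H /ntlpP[beta b0 Happ].
apply: not_avoid_approach => // n Hn.
apply: (density_avoid alpha beta a n theta al0 b0 _ Happ).
by have := H n; rewrite indicE mem_set.
Qed.

End Approach.

(** * Sufficiency *)

Section SamplingSufficient.
Context {R : realType}.
Local Notation leb := (@lebesgue_measure R).
Local Notation mu := (@dtheta2pi R).
Implicit Types (f F : R[i] -> R[i]) (alpha q r s t theta M e : R) (a : set R[i]) (z w : R[i]).

(** Bessel on the circle of radius 1 - x: Bernoulli's inequality bounds the weights (1 - x)^(2n)
    below by 1 - 2 N x, uniformly for n < N, and x tends to 0. *)
Lemma bounded_taylor F M : holo F -> (forall z, normc z < 1 -> normc (F z) <= M) ->
  forall N, \sum_(n < N) normc (taylor F n) ^+ 2 <= M ^+ 2.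
Proof.
move=> hF HM N; set S := \sum_(n < N) _.
have S0 : 0 <= S by apply: sumr_ge0 => n _; exact: sqr_ge0.
have key x : 0 < x < 1 -> S * (1 - (2 * N)%:R * x) <= M ^+ 2.
  move=> /andP[x0 x1]; have s01 : 0 < 1 - x < 1 by rewrite subr_gt0 x1 gtrBl x0.
  have [s0 s1] := andP s01.
  apply: (@le_trans _ _ (avg (fun t => normc (F ((1 - x)%:C * ei t)) ^+ 2))).
    apply: le_trans (bessel_holo _ _ N hF s01).
    rewrite mulr_suml; apply: ler_sum => n _; apply: ler_wpM2l; first exact: sqr_ge0.
    rewrite (le_trans (bernoulli_sub _ _ (ltW x0) (ltW s0))) // -exprM.
    by apply: ler_wiXn2l; rewrite ?(ltW s0) ?(ltW s1) // mulnC leq_mul2l /= ltnW.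
  apply: avg_le; first by apply: bmeas_sqr_circle => //; rewrite (ltW s0) s1.
  move=> t; rewrite lerXn2r ?nnegrE ?normc_ge0 //.
    exact: le_trans (normc_ge0 (F 0)) (HM 0 (eq_ind_r (fun x => x < 1) ltr01 (@normc0 R))).
  by apply: HM; rewrite normc_rexpi // ltW.
apply/ler_addgt0Pr => e e0; pose K : R := (2 * N)%:R * S + 1.
have K0 : 0 < K by rewrite ltr_wpDl // mulr_ge0.
pose x := Num.min 2^-1 (e / K).
have x0 : 0 < x by rewrite lt_min divr_gt0 // invr_gt0 ltr0n.
have x1 : x < 1 by rewrite gt_min invf_lt1 // ltr1n.
have xe : x * K <= e by rewrite -ler_pdivlMr // ge_min lexx orbT.
have := key x (introT andP (conj x0 x1)).
by move: xe; rewrite /K mulrBr mulrDr !mulr1; set n := (2 * N)%:R; nra.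
Qed.

(** The complement of ]0, 2 pi[ meets the arc in the single point 0, so the cut point excluded by
    [chord_lower] costs nothing. *)
Lemma ae_dtheta2pi (P : R -> Prop) : {ae leb, forall t, 0 < t < 2 * pi -> P t} -> {ae mu, forall t, P t}.
Proof.
move=> [A [mA A0 HA]].
have mI : measurable (~` `]0, 2 * pi[ : set R) by apply: measurableC; exact: measurable_itv.
exists (A `|` ~` `]0, 2 * pi[); split.
- exact: measurableU.
- rewrite /dtheta2pi /= /mscale /= /mrestr /arc_domain.
  apply/eqP; rewrite mule_eq0; apply/orP; right; rewrite eq_le measure_ge0 andbT.
  apply: (@le_trans _ _ (leb (A `|` [set 0]))).
    apply: le_measure; rewrite ?inE.
    - by apply: measurableI; [exact: measurableU|exact: measurable_itv].
    - exact: measurableU.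
    - move=> t [[At|Ht] It]; [by left|right].
      move: It Ht; rewrite /= !in_itv /= => /andP[t0 ->]; rewrite andbT => /negP.
      by rewrite -leNgt => t0'; apply/eqP; rewrite eq_le t0 t0'.
  rewrite (le_trans (measureU2 _ _ _)) //.
  apply: (@le_trans _ _ (leb A + leb [set 0%R])%E); first exact: lexx.
  by rewrite A0 lebesgue_measure_set1 add0e.
- move=> t Pt; case: (boolP (t \in `]0, 2 * pi[)) => It; last by right; exact/negP.
  by left; apply: HA => /= H; apply: Pt; apply: H; move: It; rewrite in_itv.
Qed.

Theorem fatou_bounded F M : holo F -> (forall z, normc z < 1 -> normc (F z) <= M) ->
  {ae mu, forall t, forall alpha, 0 < alpha -> nt_cauchy alpha F t}.
Proof.
move=> hF HM; have [Z [mZ Z0 HZ]] := fatou_l2 _ _ (bounded_taylor _ _ hF HM).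
apply: ae_dtheta2pi; exists Z; split => // t /= Ht; apply: contrapT => nZ; apply: Ht => t01 alpha al0 e e0.
have [d d0 Hd] := HZ alpha t al0 t01 nZ e e0; exists d => // z w sz sw zd wd.
have /stolzP[z1 _] := sz; have /stolzP[w1 _] := sw.
by rewrite (holo_ps _ _ hF z1) (holo_ps _ _ hF w1); exact: Hd.
Qed.

Section MaximalFunction.
Variables (alpha : R) (a : set R[i]) (F : R[i] -> R[i]).

Local Notation m := (fun t => maximal_fun alpha a F (ei t)).

Lemma maximal_fun_ge0 t : (0 <= m t)%E.
Proof. by rewrite /maximal_fun le_max lexx. Qed.

Lemma le_maximal_fun t z : a z -> stolz alpha (ei t) z -> ((normc (F z))%:E <= m t)%E.
Proof.
move=> az sz; rewrite /maximal_fun le_max; apply/orP; right.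
by apply: ereal_sup_ubound; exists z.
Qed.

Lemma maximal_fun_le t (x : \bar R) : (0 <= x)%E ->
  (forall z, a z -> stolz alpha (ei t) z -> ((normc (F z))%:E <= x)%E) -> (m t <= x)%E.
Proof.
move=> x0 H; rewrite /maximal_fun ge_max x0 /=; apply: ge_ereal_sup => _ [z [sz az] <-].
exact: H.
Qed.

(** The supremum may run over an uncountable set, but a point of an open Stolz angle stays in it
    when the vertex moves slightly, so the function is lower semicontinuous. *)
Lemma measurable_maximal_fun : measurable_fun [set: R] m.
Proof.
apply: lower_semicontinuous_measurable => t k kt.
have [k0|k0] := ltP k 0.
  exists setT; first exact: filterT.
  by move=> s _; apply: lt_le_trans (maximal_fun_ge0 s); rewrite lte_fin.
have [z [az sz kz]] : exists z, [/\ a z, stolz alpha (ei t) z & k < normc (F z)].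
  apply: contrapT => h; move: kt; apply/negP; rewrite -leNgt; apply: maximal_fun_le.
    by rewrite lee_fin.
  by move=> z az sz; rewrite lee_fin leNgt; apply/negP => kz; apply: h; exists z.
have /stolzP[z1 H] := sz.
pose g := (1 + alpha) * (1 - normc z) - normc (ei t - z).
have g0 : 0 < g by rewrite subr_gt0.
exists (ball t (g / 2)); first by apply: nbhsx_ballx; rewrite divr_gt0.
move=> s; rewrite -ball_normE /= => ts.
apply: lt_le_trans (_ : ((normc (F z))%:E <= _)%E); first by rewrite lte_fin.
apply: le_maximal_fun => //; apply/stolzP; split => //.
have -> : ei s - z = (ei s - ei t) + (ei t - z) by rewrite addrA subrK.
apply: le_lt_trans (le_normcD _ _) _.
apply: (@lt_le_trans _ _ (g + normc (ei t - z))); last by rewrite /g subrK.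
rewrite ltrD2r (le_lt_trans (ei_lip s t)) // distrC mulrC -ltr_pdivlMr //.
Qed.

End MaximalFunction.

Lemma powR_right (x q e : R) : 0 <= x -> 0 < q -> 0 < e ->
  exists2 d : R, 0 < d & (x + d) `^ q <= x `^ q + e.
Proof.
rewrite le_eqVlt => /orP[/eqP <- q0 e0|x0 q0 e0].
  exists (e `^ q^-1); first exact: powR_gt0.
  by rewrite add0r -powRrM mulVf ?gt_eqF // powRr1 ?(ltW e0) // lerDr powR_ge0.
have [d d0 Hd] := powR_cont x q e x0 e0; exists (d / 2); first by rewrite divr_gt0.
have := Hd (x + d / 2); rewrite addrC addKr gtr0_norm ?divr_gt0 //.
rewrite ltr_pdivrMr // ltr_pMr // ltr1n => /(_ isT); rewrite ltr_norml => /andP[_].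
by rewrite ltrBlDr addrC => /ltW; rewrite addrC [_ + e]addrC.
Qed.

Lemma stolz_radial alpha t r : 0 < alpha -> 0 <= r -> r < 1 -> stolz alpha (ei t) (r%:C * ei t).
Proof.
move=> al0 r0 r1; apply/stolzP; rewrite normc_rexpi //; split => //.
rewrite normcB realC_sub1 normcM normc_expi mulr1 normcR distrC ger0_norm ?subr_ge0 ?(ltW r1) //.
by rewrite ltr_pMl ?subr_gt0 // ltrDl.
Qed.

(** At almost every t the radial points s_k e^it share a Stolz angle with points of [a] tending to
    e^it, so the Cauchy condition bounds |F(s_k e^it)| by the maximal function up to a small error.
    Dominated convergence passes to means, and monotonicity in the radius returns to [r]. *)
Lemma bounded_sampling alpha a F M q r : 0 < alpha -> 0 < q -> holo F -> (forall z, a z -> normc z < 1) ->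
  (forall z, normc z < 1 -> normc (F z) <= M) -> {ae mu, forall t, approach alpha a t} ->
  0 <= r < 1 ->
  ((avg (fun t => normc (F (r%:C * ei t)) `^ q))%:E <= \int[mu]_t (maximal_fun alpha a F (ei t) `^ q))%E.
Proof.
move=> al0 q0 hF ha HM Happ /andP[r0 r1].
have M0 : 0 <= M.
  exact: le_trans (normc_ge0 (F 0)) (HM 0 (eq_ind_r (fun x => x < 1) ltr01 (@normc0 R))).
pose m t := maximal_fun alpha a F (ei t).
have mM t : (m t <= M%:E)%E.
  apply: maximal_fun_le; first by rewrite lee_fin.
  by move=> z az _; rewrite lee_fin HM // ha.
pose fm t := fine (m t).
have mE t : m t = (fm t)%:E.
  rewrite /fm fineK // ge0_fin_numE; first exact: le_lt_trans (mM t) (ltry _).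
  exact: maximal_fun_ge0.
have fm0 t : 0 <= fm t by rewrite -lee_fin -mE; exact: maximal_fun_ge0.
have fmM t : fm t <= M by rewrite -lee_fin -mE.
have hfm : bmeas fm.
  split; first by apply: measurableT_comp => //; exact: measurable_maximal_fun.
  by exists M => t; rewrite ger0_norm.
have hfq := bmeas_powR _ _ hfm fm0 q0.
have -> : (\int[mu]_t (maximal_fun alpha a F (ei t) `^ q) = (avg (fun t => fm t `^ q))%:E)%E.
  rewrite avg.unlock /Rintegral fineK; last exact: integrable_fin_num (bmeas_integrable _ hfq).
  by apply: eq_integral => t _; rewrite -[maximal_fun _ _ _ _]/(m t) mE poweR_EFin.
rewrite lee_fin.
pose s (k : nat) : R := 1 - (k.+2%:R)^-1.
have i0 k : 0 < (k.+2%:R : R)^-1 by rewrite invr_gt0.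
have i1 k : (k.+2%:R : R)^-1 < 1 by rewrite invf_lt1 // ltr1n.
have s01 k : 0 <= s k < 1 by rewrite subr_ge0 (ltW (i1 k)) ltrBlDr ltrDl i0.
(* Only an upper bound for |F(s_k e^it)| is available, hence the positive part. *)
pose g k t := Num.max (normc (F ((s k)%:C * ei t)) `^ q - fm t `^ q) 0.
have hFs k := bmeas_powR_circle _ _ _ hF (s01 k) q0.
have hg k : bmeas (g k) by apply: bmeas_max; exact: bmeasB.
have g0 k t : 0 <= g k t by rewrite le_max lexx orbT.
have gM k t : g k t <= M `^ q.
  rewrite ge_max powR_ge0 andbT.
  have h : normc (F ((s k)%:C * ei t)) `^ q <= M `^ q.
    have [sk0 sk1] := andP (s01 k).
    apply: ge0_ler_powR; rewrite ?nnegrE ?normc_ge0 ?(ltW q0) //.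
    by apply: HM; rewrite normc_rexpi.
  by apply: le_trans h; rewrite gerBl powR_ge0.
have lim0 : {ae mu, forall t, [set: R] t -> ((g k t)%:E @[k --> \oo] --> (0%E : \bar R))}.
  have Fmu : Filter (nbhs (almost_everywhere mu)) by exact: ae_filter_ringOfSetsType.
  apply: filterS2 (fatou_bounded _ _ hF HM) Happ => t Hnt Hap _.
  apply/fine_cvgP; split; first exact: nearW.
  apply/cvgrPdist_lt => e e0; have e2 : 0 < e / 2 by rewrite divr_gt0.
  have [d d0 Hd] := powR_right (fm t) q _ (fm0 t) q0 e2.
  have [d' d'0 Hd'] := Hnt alpha al0 d d0.
  have [z [az sz zd]] := Hap d' d'0.
  apply: filterS (near_infty_natSinv_lt (PosNum d'0)) => k /= hk.
  rewrite sub0r normrN ger0_norm //.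
  have [sk0 sk1] := andP (s01 k).
  have hs : normc (F ((s k)%:C * ei t)) <= fm t + d.
    have h1 := Hd' _ z (stolz_radial alpha t (s k) al0 sk0 sk1) sz _ zd.
    have h2 : normc (F ((s k)%:C * ei t) - F z) < d.
      apply: h1; rewrite realC_sub1 normcM normc_expi mulr1 normcR distrC /s opprB addrC subrK.
      rewrite gtr0_norm //; apply: le_lt_trans hk.
      by rewrite lef_pV2 ?posrE // ler_nat.
    have h3 : normc (F z) <= fm t by rewrite -lee_fin -mE; exact: le_maximal_fun.
    rewrite -[F _](subrK (F z)) addrC (le_trans (le_normcD _ _)) //.
    exact: lerD h3 (ltW h2).
  rewrite gt_max e0 andbT (le_lt_trans _ (_ : e / 2 < e)) //; last first.
    by rewrite ltr_pdivrMr // ltr_pMr // ltr1n.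
  rewrite lerBlDr addrC (le_trans _ Hd) //.
  apply: ge0_ler_powR; rewrite ?nnegrE ?normc_ge0 ?(ltW q0) //.
  by rewrite addr_ge0 // ltW.
have mg k : measurable_fun [set: R] (fun t => (g k t)%:E) by apply/measurable_EFinP; case: (hg k).
have m0 : measurable_fun [set: R] (cst (0%E : \bar R)) by exact: measurable_cst.
have ig : mu.-integrable setT (EFin \o cst (M `^ q)) by exact: bmeas_integrable (bmeas_cst _).
have dom : {ae mu, forall t : R, forall k, [set: R] t -> (`|(g k t)%:E| <= (M `^ q)%:E)%E}.
  by apply: aeW => t k _; rewrite /= lee_fin ger0_norm.
have [_ _ Hlim] := @dominated_convergence _ _ R mu setT measurableT
  (fun k t => (g k t)%:E) (cst 0%E) (EFin \o cst (M `^ q)) mg m0 lim0 ig dom.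
rewrite integral0 in Hlim.
apply/ler_addgt0Pr => e e0.
have [/= k [rk gk]] : exists k, r < s k /\ avg (g k) < e.
  have H1 : \forall k \near \oo, r < s k.
    have d0 : 0 < 1 - r by rewrite subr_gt0.
    apply: filterS (near_infty_natSinv_lt (PosNum d0)) => k /= hk.
    rewrite /s ltrBrDr -ltrBrDl; apply: le_lt_trans hk.
    by rewrite lef_pV2 ?posrE // ler_nat.
  have H2 : \forall k \near \oo, avg (g k) < e.
    move/fine_cvgP : Hlim => -[_ /cvgrPdist_lt /(_ e e0)]; apply: filterS => k.
    rewrite /= sub0r normrN avg.unlock /Rintegral => h.
    exact: le_lt_trans (ler_norm _) h.
  by have [k [? ?]] := filter_ex (filterI H1 H2); exists k.
apply: le_trans (hardy_mono _ _ (s k) _ hF _ _ q0) _; first by rewrite r0 rk.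
  by have /andP[] := s01 k.
apply: (@le_trans _ _ (avg (fun t => fm t `^ q + g k t))).
  apply: le_avg => // [|t]; first exact: bmeasD.
  by rewrite -lerBlDl le_max lexx.
by rewrite avgD // lerD2l ltW.
Qed.

Lemma maximal_fun_mono alpha a f F t : (forall z, a z -> normc (F z) <= normc (f z)) ->
  (maximal_fun alpha a F (ei t) <= maximal_fun alpha a f (ei t))%E.
Proof.
move=> H; apply: maximal_fun_le; first exact: maximal_fun_ge0.
by move=> z az sz; apply: le_trans (le_maximal_fun _ _ f _ _ az sz); rewrite lee_fin H.
Qed.

Lemma measurable_maximal_poweR alpha a f q :
  measurable_fun [set: R] (fun t => maximal_fun alpha a f (ei t) `^ q)%E.
Proof. exact: measurableT_comp (measurable_poweR q) (measurable_maximal_fun alpha a f). Qed.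

(** The multiplier h of [bounded_multiplier] has modulus at most 1 on [a], so the maximal function
    of f h is at most that of f, while on the circle of radius [r] the mean loses only the factor 1
    - d. *)
Lemma hardy_sampling alpha a f q A r : 0 < alpha -> 0 < q -> holo f -> (forall z, a z -> normc z < 1) ->
  (forall s, 0 < s < 1 -> avg (fun t => normc (f (s%:C * ei t)) `^ q) <= A) ->
  {ae mu, forall t, approach alpha a t} -> 0 <= r < 1 ->
  ((avg (fun t => normc (f (r%:C * ei t)) `^ q))%:E <= \int[mu]_t (maximal_fun alpha a f (ei t) `^ q))%E.
Proof.
move=> al0 q0 hf ha HA Happ r01; have [r0 r1] := andP r01.
set I := (\int[mu]_t _)%E; set Ar := avg _.
have Ar0 : 0 <= Ar by apply: avg_ge0 => t; exact: powR_ge0.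
have key d : 0 < d < 1 -> (((1 - d) * Ar)%:E <= I)%E.
  move=> /andP[d0 d1]; have d10 : 0 <= 1 - d by rewrite subr_ge0 ltW.
  (* Chosen so that (1 - e)^q = 1 - d. *)
  pose e := 1 - (1 - d) `^ q^-1.
  have e0 : 0 < e.
    have : (1 - d) `^ q^-1 < 1 `^ q^-1.
      by apply: gt0_ltr_powR; rewrite ?nnegrE ?invr_gt0 // gtrBl.
    by rewrite powR1 subr_gt0.
  have eq : (1 - e) `^ q = 1 - d.
    by rewrite /e opprB addrC subrK -powRrM mulVf ?gt_eqF // powRr1.
  have e1 : 0 <= 1 - e by rewrite /e opprB addrC subrK powR_ge0.
  have [h [hh h1 [M HM] hr]] := bounded_multiplier f q A r e hf q0 HA r1 e0.
  have hF : holo (fun z => f z * h z) by move=> z z1; apply: cdiffM; [exact: hf|exact: hh].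
  apply: le_trans (_ : ((avg (fun t => normc (f (r%:C * ei t) * h (r%:C * ei t)) `^ q))%:E <= _)%E).
    rewrite lee_fin -avgZ; last exact: bmeas_powR_circle.
    apply: le_avg => [| |t].
    - by apply: bmeasM; [exact: bmeas_cst|exact: bmeas_powR_circle].
    - exact: (bmeas_powR_circle (fun z => f z * h z)).
    rewrite normcM powRM ?normc_ge0 // mulrC ler_wpM2l ?powR_ge0 // -eq.
    apply: ge0_ler_powR; rewrite ?nnegrE ?normc_ge0 ?(ltW q0) //.
    by apply: hr; rewrite normc_rexpi.
  apply: le_trans (bounded_sampling alpha a _ M q r al0 q0 hF ha HM Happ r01) _.
  apply: ge0_le_integral => //.
  - by move=> t _; exact: poweR_ge0.
  - exact: measurable_maximal_poweR.
  - exact: measurable_maximal_poweR.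
  move=> t _; apply: gt0_ler_poweR; rewrite ?(ltW q0) //.
  - by rewrite in_itv /= leey andbT; exact: maximal_fun_ge0.
  - by rewrite in_itv /= leey andbT; exact: maximal_fun_ge0.
  apply: maximal_fun_mono => z az; rewrite normcM ler_piMr ?normc_ge0 // h1 //.
  exact: ha.
have I0 : (0 <= I)%E by apply: integral_ge0 => t _; exact: poweR_ge0.
case: I key I0 => [x| |] // key I0; last by rewrite leey.
rewrite lee_fin; apply/ler_addgt0Pr => e e0.
pose d := Num.min 2^-1 (e / (Ar + 1)).
have A1 : 0 < Ar + 1 by rewrite ltr_wpDl.
have d0 : 0 < d by rewrite lt_min divr_gt0 // invr_gt0 ltr0n.
have d1 : d < 1 by rewrite gt_min invf_lt1 // ltr1n.
have de : d * (Ar + 1) <= e by rewrite -ler_pdivlMr // ge_min lexx orbT.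
have := key d (introT andP (conj d0 d1)); rewrite lee_fin; move: de d0.
by rewrite mulrBl mul1r mulrDr mulr1; lra.
Qed.

Lemma integral_circle f r q : holo f -> 0 <= r < 1 -> 0 < q ->
  (\int[mu]_t (normc (f (r%:C * expi t)%R) `^ q)%:E)%E = (avg (fun t => normc (f (r%:C * ei t)) `^ q))%:E.
Proof.
move=> hf r01 q0; rewrite avg.unlock /Rintegral fineK.
  by apply: eq_integral => t _; rewrite expi_ei.
exact: integrable_fin_num (bmeas_integrable _ (bmeas_powR_circle _ _ _ hf r01 q0)).
Qed.

Lemma power_bound (x K s : R) : 0 <= x -> 0 <= s -> (forall k, x ^+ k.+1 <= K * s ^+ k.+1) -> x <= s.
Proof.
move=> x0 s0 H; rewrite leNgt; apply/negP => sx.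
have xp : 0 < x := le_lt_trans s0 sx.
have q01 : 0 <= s / x < 1 by rewrite divr_ge0 //= ltr_pdivrMr // mul1r.
suff : x <= 0 by rewrite leNgt xp.
apply: (le_geometric_eq0 _ (K * s) (s / x)) => // k.
rewrite expr_div_n mulrA ler_pdivlMr ?exprn_gt0 // -exprS (le_trans (H k)) //.
by rewrite exprS mulrA.
Qed.

Lemma pker_le z t : normc z < 1 -> pker z t <= 2 / (1 - normc z).
Proof.
move=> z1; have D := le_ei_sub z t; have d0 : 0 < 1 - normc z by rewrite subr_gt0.
have D0 := lt_le_trans d0 D; have n0 := normc_ge0 z.
rewrite pker_def ler_pdivrMr ?exprn_gt0 // mulrAC ler_pdivlMr //.
have : (1 - normc z) ^+ 2 <= normc (ei t - z) ^+ 2.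
  by rewrite lerXn2r ?nnegrE // ltW.
by move: n0 z1; set x := normc z; nra.
Qed.

(** Finite exponents suffice: the Poisson formula for f^(k+1) and the case of exponent k + 1 give
    |f(z)|^(k+1) <= C s^(k+1) with C depending on [z] only, and letting k grow removes C. *)
Lemma sup_sampling alpha a f M z s : 0 < alpha -> holo f -> (forall z, a z -> normc z < 1) ->
  (forall z, normc z < 1 -> normc (f z) <= M) -> {ae mu, forall t, approach alpha a t} ->
  0 <= s -> {ae mu, forall t, (maximal_fun alpha a f (ei t) <= s%:E)%E} ->
  normc z < 1 -> normc (f z) <= s.
Proof.
move=> al0 hf ha HM Happ s0 Hs z1.
pose r := (1 + normc z) / 2; have n0 := normc_ge0 z.
have r1 : r < 1 by rewrite /r ltr_pdivrMr //; lra.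
have zr : normc z < r by rewrite /r ltr_pdivlMr //; lra.
have r0 : 0 < r := le_lt_trans n0 zr.
have r01 : 0 < r < 1 by rewrite r0.
pose w := r%:C^-1 * z.
have w1 : normc w < 1.
  by rewrite normcM normcV normcR gtr0_norm // mulrC ltr_pdivrMr // mul1r.
have zE : z = r%:C * w by rewrite mulVKf // -normc_gt0 normcR gtr0_norm.
have d0 : 0 < 1 - normc w by rewrite subr_gt0.
apply: (power_bound _ (2 / (1 - normc w))); rewrite ?normc_ge0 // => k.
have k0 : 0 < (k.+1%:R : R) by rewrite ltr0n.
have hfk : holo (fun z => f z ^+ k.+1) by move=> x x1; apply: cdiffX; exact: hf.
have hb : bmeas (fun t => normc (f (r%:C * ei t)) `^ k.+1%:R).
  by apply: bmeas_powR_circle => //; rewrite (ltW r0).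
have pE t : normc (f (r%:C * ei t) ^+ k.+1) = normc (f (r%:C * ei t)) `^ k.+1%:R.
  by rewrite normcX powR_mulrn // normc_ge0.
rewrite -normcX zE (le_trans (le_poisson_circle _ _ _ hfk r01 w1)) //.
apply: (@le_trans _ _ (2 / (1 - normc w) * avg (fun t => normc (f (r%:C * ei t)) `^ k.+1%:R))).
  rewrite -avgZ //; apply: le_avg => [| |t].
  - apply: bmeasM; last exact: bmeas_pker.
    by under eq_fun do rewrite pE.
  - by apply: bmeasM => //; exact: bmeas_cst.
  by rewrite pE mulrC ler_wpM2r ?powR_ge0 // pker_le.
rewrite ler_wpM2l //; first by rewrite divr_ge0 // ltW.
have r01' : 0 <= r < 1 by rewrite ltW.
have := bounded_sampling alpha a f M k.+1%:R r al0 k0 hf ha HM Happ r01'.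
rewrite -lee_fin; move/le_trans; apply.
apply: (@le_trans _ _ (\int[mu]_t (s%:E `^ k.+1%:R))%E); last first.
  by rewrite poweR_EFin integral_cst // [mu _]dtheta2pi_setT mule1 powR_mulrn.
apply: ae_ge0_le_integral => //.
- by move=> t _; exact: poweR_ge0.
- exact: measurable_maximal_poweR.
- by move=> t _; exact: poweR_ge0.
have Fmu : Filter (nbhs (almost_everywhere mu)) by exact: ae_filter_ringOfSetsType.
apply: filterS Hs => t Ht _; apply: gt0_ler_poweR; rewrite ?ler0n //.
- by rewrite in_itv /= leey andbT; exact: maximal_fun_ge0.
- by rewrite in_itv /= leey andbT lee_fin.
Qed.

Theorem sampling_sufficient alpha (p : \bar R) (a : set R[i]^o) : 0 < alpha -> (0 < p)%E ->
  a `<=` disk -> {ae mu, forall t, approach alpha a t} -> sampling alpha p a.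
Proof.
move=> al0 p0 ha Happ; exists 1; first exact: ltr01.
move=> f [/holoP hf hp]; rewrite mul1e.
have NE x : circle_norm x (maximal_fun alpha a f) = Lnorm mu x (fun t => maximal_fun alpha a f (ei t)).
  by rewrite /circle_norm; under eq_Lnorm do rewrite expi_ei.
have absE : (abse \o (fun t => maximal_fun alpha a f (ei t))) = (fun t => maximal_fun alpha a f (ei t)).
  by apply/funext => t /=; rewrite gee0_abs // maximal_fun_ge0.
rewrite NE Lnorm.unlock; case: p p0 hp {NE} => [q| |] //.
- rewrite lte_fin => q0 hp.
  pose S := ereal_sup [set \int[mu]_t (normc (f (r%:C * expi t)%R) `^ q)%:E | r in [set r : R | (0 <= r < 1)%R]]%E.
  have S0 : (0 <= S)%E.
    apply: le_trans (ereal_sup_ubound _); last by exists 0 => //=; rewrite lexx ltr01.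
    by apply: integral_ge0 => t _; rewrite lee_fin powR_ge0.
  have Sfin : (S < +oo)%E.
    by apply: (lty_poweRy _ hp); rewrite invr_neq0 // gt_eqF.
  have SA : S \is a fin_num by rewrite ge0_fin_numE.
  have HA s : 0 < s < 1 -> avg (fun t => normc (f (s%:C * ei t)) `^ q) <= fine S.
    move=> /andP[s0 s1]; have s01 : 0 <= s < 1 by rewrite ltW.
    rewrite -lee_fin fineK // -integral_circle //.
    by apply: ereal_sup_ubound; exists s.
  rewrite /= -/S; apply: gt0_ler_poweR.
  + by rewrite invr_ge0 ltW.
  + by rewrite in_itv /= leey S0.
  + by rewrite in_itv /= leey andbT; apply: integral_ge0 => t _; exact: poweR_ge0.
  apply: ge_ereal_sup => _ [r r01 <-]; rewrite integral_circle //.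
  under eq_integral do rewrite gee0_abs ?maximal_fun_ge0 //.
  exact: (hardy_sampling alpha a f q (fine S)).
- move=> _ hp; rewrite [X in (0 < X)%E]dtheta2pi_setT lte01 absE /=.
  have [M HM] : exists M, forall z, normc z < 1 -> normc (f z) <= M.
    exists (fine (hardy_norm +oo%E f)) => z z1.
    have h : ((normc (f z))%:E <= hardy_norm +oo%E f)%E by apply: ereal_sup_ubound; exists z.
    rewrite -lee_fin fineK // ge0_fin_numE //.
    by apply: le_trans h; rewrite lee_fin normc_ge0.
  apply: ge_ereal_sup => _ [z z1 <-].
  have := ess_sup_ge mu (fun t => maximal_fun alpha a f (ei t)).
  have e0 : (0 <= ess_sup mu (fun t => maximal_fun alpha a f (ei t)))%E.
    apply: ess_sup_gee; first by rewrite [X in (0 < X)%E]dtheta2pi_setT lte01.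
    by apply: aeW => t; exact: maximal_fun_ge0.
  case: (ess_sup _ _) e0 => [s| |] // s0 Hs; last by rewrite leey.
  rewrite lee_fin; exact: (sup_sampling alpha a f M z s).
Qed.

End SamplingSufficient.

(** * Necessity *)

Section SamplingNecessary.
Context {R : realType}.
Local Notation leb := (@lebesgue_measure R).
Local Notation mu := (@dtheta2pi R).
Local Notation arc := (`[0, 2 * pi[%classic : set R).
Implicit Types (alpha q r s t theta M e : R) (a : set R[i]) (z w : R[i]).

Lemma avg_indic (A : set R) : measurable A ->
  (avg \1_A)%:E = (((2 * pi)^-1)%:E * leb (A `&` arc))%E.
Proof.
move=> mA; rewrite EFin_avg; [|exact: bmeas_indic|by []].
by rewrite integral_indic // setIC.
Qed.

Lemma avg_indic_itv (x y : R) : 0 <= x -> x <= y -> y <= 2 * pi ->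
  avg (\1_(`[x, y]%classic : set R)) = (y - x) / (2 * pi).
Proof.
move=> x0 xy y1; apply: EFin_inj; rewrite avg_indic; last exact: measurable_itv.
suff -> : leb (`[x, y] `&` arc) = (y - x)%:E by rewrite -EFinM mulrC.
have E b : leb ([set` Interval (BLeft x) (BSide b y)] : set R) = (y - x)%:E.
  rewrite lebesgue_measure_itv /= lte_fin; case: ltP => [_|yx]; first by rewrite -EFinB.
  by rewrite (_ : y = x) ?subrr //; apply/eqP; rewrite eq_le xy yx.
move: y1; rewrite le_eqVlt => /orP[/eqP yE|y1].
  rewrite (_ : `[x, y] `&` arc = `[x, y[%classic) ?E // yE; apply/seteqP; split=> t /=.
    by rewrite !in_itv /= => -[/andP[-> _] /andP[_ ->]].
  by rewrite !in_itv /= => /andP[xt ty]; rewrite xt (ltW ty) (le_trans x0 xt) ty.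
rewrite (_ : `[x, y] `&` arc = `[x, y]%classic) ?E //.
apply: setIidl => t; rewrite /= !in_itv /= => /andP[xt ty].
by rewrite (le_trans x0 xt) (le_lt_trans ty y1).
Qed.

Lemma avg_indicC (A : set R) : measurable A -> avg (\1_(~` A)) = 1 - avg (\1_A : R -> R).
Proof.
move=> mA; rewrite -{1}(avg_cst 1) -avgB; [|exact: bmeas_cst|exact: bmeas_indic].
by apply: eq_avg => t; rewrite !indicE in_setC; case: (t \in A); rewrite ?subrr ?subr0.
Qed.

Lemma pker_ge z t (k : R) : normc z < 1 -> 0 < k -> normc (ei t - z) <= k -> (1 - normc z) / k ^+ 2 <= pker z t.
Proof.
move=> z1 k0 H; have n0 := normc_ge0 z; rewrite pker_def.
have D0 : 0 < normc (ei t - z) by rewrite normc_gt0 ei_sub_neq0.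
apply: ler_pM.
- by rewrite subr_ge0 ltW.
- by rewrite invr_ge0 exprn_ge0 // ltW.
- by rewrite lerD2l lerN2 expr2 ler_piMl // ltW.
- by rewrite lef_pV2 ?posrE ?exprn_gt0 // lerXn2r ?nnegrE // ltW.
Qed.

(** * Extremal functions attached to a closed set *)

Section Extremal.
Variables (alpha : R) (a : set R[i]) (n : nat) (K : set R).
Hypothesis al0 : 0 < alpha.
Hypothesis ha : forall z, a z -> normc z < 1.
Hypothesis oK : open (~` K).
Hypothesis KI : K `<=` `[0, 2 * pi].
Hypothesis Kavoid : K `<=` avoid alpha a n.
Hypothesis Khalf : avg (\1_K : R -> R) <= 2^-1.

Let mK : measurable K.
Proof. by rewrite -[K]setCK; apply: measurableC; exact: open_measurable. Qed.

Let hu : bmeas (\1_(~` K) : R -> R).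
Proof. by apply: bmeas_indic; exact: measurableC. Qed.

Let v z := Re (herg (\1_(~` K)) z).

(** Two regimes. At depth at least h0 the kernel is at least h0 / 4 and the complement of [K]
    carries at least half of the mass. At a smaller depth h, z lies in the Stolz angle of every
    point of an arc of length m h, so this arc misses [K], and the kernel is at least 1 / ((1 +
    alpha)^2 h) on it. *)
Lemma extremal_lower : exists2 c : R, 0 < c & forall z, a z -> c <= v z.
Proof.
have p0 := pi_gt0 R; have p2 := pi_ge2 R.
pose h0 : R := n.+1%:R^-1; have h00 : 0 < h0 by rewrite invr_gt0.
(* [alpha / 4] absorbs the factor 2 of [ei_lip]; the bound 1 lets the arc fit into the period on one
   side of [phi]. *)
pose m := Num.min (alpha / 4) 1; have m0 : 0 < m by rewrite lt_min ltr01 divr_gt0.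
have m1 : m <= 1 by rewrite ge_min lexx orbT.
have ma : m <= alpha / 4 by rewrite ge_min lexx.
have L0 : 0 < 1 + alpha by rewrite addr_gt0.
pose c2 := m / (2 * pi * (1 + alpha) ^+ 2).
have c20 : 0 < c2 by rewrite divr_gt0 // mulr_gt0 ?exprn_gt0 // mulr_gt0.
exists (Num.min (h0 / 8) c2); first by rewrite lt_min c20 divr_gt0.
move=> z az; have z1 := ha z az; rewrite /v Re_herg //.
pose h := 1 - normc z; have hp : 0 < h by rewrite subr_gt0.
have hp1 : h <= 1 by rewrite gerBl normc_ge0.
have hpk := bmeas_pker _ z1.
have [hh|hh] := leP h0 h.
  apply: (@le_trans _ _ (h0 / 8)); first by rewrite ge_min lexx.
  apply: (@le_trans _ _ (avg (fun t => h0 / 4 * \1_(~` K) t))).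
    by rewrite avgZ // avg_indicC //; move: Khalf h00; nra.
  apply: le_avg => [| |t]; [by apply: bmeasM => //; exact: bmeas_cst|exact: bmeasM|].
  rewrite mulrC; apply: ler_wpM2l => //.
  have D2 : normc (ei t - z) <= 2.
    rewrite (le_trans (le_normcD _ _)) // normc_expi normcN; move: z1; lra.
  apply: le_trans (pker_ge _ _ 2 z1 _ D2) => //.
  by rewrite -/h (_ : 2 ^+ 2 = 4 :> R) ?ler_pM2r ?invr_gt0 //; ring.
apply: (@le_trans _ _ c2); first by rewrite ge_min lexx orbT.
have [phi0 zE0] := polar z.
have [phi [_ [phi_0 phi_1 _ phiE]]] := ei_mod phi0.
have zE : z = (normc z)%:C * ei phi by rewrite -phiE.
pose d := m * h; have d0 : 0 < d by rewrite mulr_gt0.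
have d1 : d <= 1 by rewrite mulr_ile1 // ltW.
have near t : `|t - phi| <= d -> 
    ~ K t /\ normc (ei t - z) <= (1 + alpha) * h.
  move=> td.
  have tz : normc (ei t - ei phi) < alpha * h.
    apply: le_lt_trans (ei_lip _ _) _.
    apply: (@le_lt_trans _ _ (2 * (alpha / 4 * h))).
      by rewrite ler_pM2l // (le_trans td) // ler_pM2r.
    have : 0 < alpha * h by rewrite mulr_gt0.
    by lra.
  have sz := stolz_arc alpha phi t z al0 z1 zE tz.
  split; first by move=> /Kavoid /(_ z az hh); apply.
  by have /stolzP[_ /ltW] := sz.
(* One side of [phi] is enough; the side is chosen so that the arc does not cross the cut point. *)
have [x [x0 x1 xI]] : exists x, [/\ 0 <= x, x + d < 2 * pi & forall t, x <= t <= x + d -> `|t - phi| <= d].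
  have [pp|pp] := leP phi pi.
    exists phi; split => //; first by move: pp d1; lra.
    by move=> t /andP[t0 t1]; rewrite ger0_norm ?subr_ge0 // lerBlDl.
  exists (phi - d); split; [by move: pp d1; lra|by rewrite subrK|].
  move=> t; rewrite subrK => /andP[t0 t1]; rewrite ler0_norm ?subr_le0 // opprB.
  by move: t0; lra.
have hI : bmeas (\1_(`[x, x + d]%classic : set R) : R -> R) by apply: bmeas_indic; exact: measurable_itv.
apply: (@le_trans _ _ (avg (fun t => ((1 + alpha) ^+ 2 * h)^-1 * \1_(`[x, x + d]%classic : set R) t))).
  rewrite avgZ // avg_indic_itv ?(ltW x1) //; last by rewrite lerDl ltW.
  rewrite [x + d]addrC addrK /d /c2 le_eqVlt; apply/orP; left; apply/eqP.
  have E (p' x' y' w' : R) : p' != 0 -> y' != 0 -> w' != 0 ->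
      x' / (2 * p' * y' ^+ 2) = (y' ^+ 2 * w')^-1 * (x' * w' / (2 * p')).
    by move=> h1 h2 h3; field; rewrite h1 h2 h3.
  by apply: E; exact: lt0r_neq0.
apply: le_avg => [| |t]; [by apply: bmeasM => //; exact: bmeas_cst|exact: bmeasM|].
rewrite indicE; case: (boolP (t \in _)) => [/set_mem|_]; last first.
  by rewrite mulr0 mulr_ge0 // pker_ge0.
rewrite /= in_itv /= => /xI /near[nK tz].
rewrite mulr1 indicE mem_set // mul1r.
have Lh : 0 < (1 + alpha) * h by rewrite mulr_gt0.
apply: le_trans (pker_ge _ _ _ z1 Lh tz).
rewrite -/h le_eqVlt; apply/orP; left; apply/eqP; field.
by rewrite !gt_eqF.
Qed.

Let far (m : nat) : set R := [set t | forall s, K s -> m.+1%:R^-1 <= normc (ei t - ei s)].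

Let mfar m : measurable (far m).
Proof.
rewrite -[far m]setCK; apply: measurableC; apply: open_measurable.
rewrite openE => t /= Ht.
have [s [Ks ts]] : exists s, K s /\ normc (ei t - ei s) < m.+1%:R^-1.
  apply: contrapT => h; apply: Ht => s Ks; rewrite leNgt; apply/negP => ts; apply: h; by exists s.
have g0 : 0 < m.+1%:R^-1 - normc (ei t - ei s) by rewrite subr_gt0.
apply/nbhs_normP; exists ((m.+1%:R^-1 - normc (ei t - ei s)) / 2); first by rewrite /= divr_gt0.
move=> t' /= tt' Ht'; have := Ht' s Ks; apply/negP; rewrite -ltNge.
have -> : ei t' - ei s = (ei t' - ei t) + (ei t - ei s) by rewrite addrA subrK.
apply: le_lt_trans (le_normcD _ _) _; rewrite -ltrBrDr (le_lt_trans (ei_lip _ _)) //.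
by rewrite distrC mulrC -ltr_pdivlMr.
Qed.

Let rest m := ~` K `&` ~` far m.

Let mrest m : measurable (rest m).
Proof. by apply: measurableI; exact: measurableC. Qed.

(** As [K] is closed, a point off [K] has a positive distance to it, which [chord_lower] turns into
    a chord distance; the decreasing sets [rest m] thus have a null intersection. *)
Let rest_cvg0 e : 0 < e -> exists m, avg (\1_(rest m) : R -> R) <= e.
Proof.
move=> e0.
have restS m k : (m <= k)%N -> rest k `<=` rest m.
  move=> mk t [nK nf]; split => // fm; apply: nf => s Ks; apply: le_trans (fm s Ks).
  by rewrite lef_pV2 ?posrE // ler_nat.
have avgE m : (avg (\1_(rest m) : R -> R))%:E = mu (rest m).
  by rewrite avg_indic.
have cap0 : mu (\bigcap_m rest m) = 0%E.
  have mcap : measurable (\bigcap_m rest m) by apply: bigcap_measurable.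
  apply/negligibleP => //.
  suff : {ae mu, forall t, ~ (\bigcap_m rest m) t}.
    by apply: negligibleS => t Ht; rewrite /= => h; exact: h.
  apply: ae_dtheta2pi; apply: aeW => t t01 Ht.
  have [nK _] := Ht 0 I.
  have /nbhs_normP[d /= d0 Hd] : nbhs t (~` K) by apply: open_nbhs_nbhs.
  have [C C0 HC] := chord_lower _ t01.
  pose m := Num.truncn (d / C)^-1.
  have dC : 0 < d / C by rewrite divr_gt0.
  have hm : m.+1%:R^-1 <= d / C.
    by rewrite -[leRHS]invrK lef_pV2 ?posrE ?invr_gt0 // ltW // truncnS_gt.
  have [_] := Ht m I; apply => s Ks.
  apply: le_trans hm _; rewrite ler_pdivrMr // mulrC normcB.
  have := KI _ Ks; rewrite /= in_itv /= => sI; apply: le_trans (HC s sI).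
  by rewrite leNgt; apply/negP => sd; apply: (Hd s) => //=; rewrite distrC.
have mu0 : (mu (rest 0) < +oo)%E by rewrite -avgE ltry.
have mcap : measurable (\bigcap_m rest m) by apply: bigcap_measurable.
have hom : {homo rest : m k / (m <= k)%N >-> (k <= m)%O}.
  by move=> m k mk; apply/subsetPset; exact: restS.
have := nonincreasing_cvg_mu mu0 mrest mcap hom; rewrite cap0.
move=> /fine_cvgP[_ /cvgrPdist_lt /(_ e e0) /filter_ex[m]].
rewrite /= sub0r normrN -avgE /= => h; exists m.
exact: le_trans (ler_norm _) (ltW h).
Qed.

Lemma herg_mean u r : bmeas u -> 0 < r < 1 ->
  avg (fun t => Re (herg u (r%:C * ei t))) = avg u.
Proof.
move=> hb r01; have z1 : normc (0 : R[i]) < 1 by rewrite (@normc0 R).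
have pk t : pker 0 t = 1 :> R.
  by rewrite pker_def subr0 normc_expi (@normc0 R) expr0n subr0 expr1n divr1.
have E := poisson_circle _ _ 0 (holo_herg _ hb) r01 z1.
rewrite -Re_cavg; transitivity (Re (herg u 0)).
  rewrite -(mulr0 r%:C) E; congr (Re _); apply: eq_cavg => t.
  by rewrite pk mulr1.
by rewrite Re_herg //; apply: eq_avg => t; rewrite pk mulr1.
Qed.

Let v_ge0 z : normc z < 1 -> 0 <= v z.
Proof.
move=> z1; rewrite /v Re_herg //; apply: avg_ge0 => t.
by rewrite mulr_ge0 // pker_ge0.
Qed.

Let hv r : 0 < r < 1 -> bmeas (fun t => v (r%:C * ei t)).
Proof. by move=> r01; have [] := holo_circle _ _ (holo_herg _ hu) r01. Qed.

(** No boundary limit of [v] is used. At points over [K] the part of the complement far from [K]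
    contributes at most e / 2 once the radius is near 1, and the Poisson integral of [rest m] has
    mean at most e / 2 on every circle. *)
Lemma extremal_mean e : 0 < e ->
  exists2 r : R, 0 < r < 1 & avg (fun t => \1_K t * v (r%:C * ei t)) <= e.
Proof.
move=> e0; have e2 : 0 < e / 2 by rewrite divr_gt0.
have [m Hm] := rest_cvg0 _ e2.
pose d : R := m.+1%:R^-1; have d0 : 0 < d by rewrite invr_gt0.
(* [rho <= d / 2] keeps the far part at distance at least d / 2, so the kernel is at most 2 rho / (d
   / 2)^2 = 8 rho / d^2; the last bound makes this at most e / 2. *)
pose rho := Num.min 2^-1 (Num.min (d / 2) (e * d ^+ 2 / 16)).
have rho0 : 0 < rho.
  by rewrite !lt_min invr_gt0 ltr0n divr_gt0 //= divr_gt0 // mulr_gt0 // exprn_gt0.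
have rho1 : rho < 1 by rewrite gt_min invf_lt1 // ltr1n.
have rhod : rho <= d / 2 by rewrite !ge_min lexx !orbT.
have rhoe : rho <= e * d ^+ 2 / 16 by rewrite !ge_min lexx !orbT.
pose r := 1 - rho.
have r0 : 0 < r by rewrite subr_gt0.
have r1 : r < 1 by rewrite gtrBl.
have r01 : 0 < r < 1 by rewrite r0.
exists r => //.
have hK : bmeas (\1_K : R -> R) by exact: bmeas_indic.
have hrest : bmeas (\1_(rest m) : R -> R) by exact: bmeas_indic.
have hfar : bmeas (\1_(far m) : R -> R) by exact: bmeas_indic.
have hw : bmeas (fun t => Re (herg (\1_(rest m)) (r%:C * ei t))).
  by have [] := holo_circle _ _ (holo_herg _ hrest) r01.
apply: (@le_trans _ _ (avg (fun t => e / 2 + Re (herg (\1_(rest m)) (r%:C * ei t))))); last first.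
  rewrite avgD //; last exact: bmeas_cst.
  by rewrite avg_cst herg_mean // [leRHS](splitr e) lerD2l.
apply: le_avg => [| |theta].
- by apply: bmeasM => //; exact: hv.
- by apply: bmeasD => //; exact: bmeas_cst.
have nz : normc (r%:C * ei theta) = r by rewrite normc_rexpi // ltW.
have z1 : normc (r%:C * ei theta) < 1 by rewrite nz.
have hpk := bmeas_pker _ z1.
have w0 : 0 <= Re (herg (\1_(rest m)) (r%:C * ei theta)).
  by rewrite Re_herg //; apply: avg_ge0 => t; rewrite mulr_ge0 // pker_ge0.
rewrite indicE; case: (boolP (theta \in K)) => [/set_mem Kt|_]; last first.
  by rewrite mul0r addr_ge0 // ltW.
rewrite mul1r /v !Re_herg // -[e / 2]avg_cst -avgD; [|exact: bmeas_cst|exact: bmeasM].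
apply: le_avg => [| |t]; first exact: bmeasM.
  by apply: bmeasD; [exact: bmeas_cst|exact: bmeasM].
have pk0 := pker_ge0 _ t z1.
have [ft|nft] := pselect (far m t); last first.
  apply: (@le_trans _ _ (\1_(rest m) t * pker (r%:C * ei theta) t)); last first.
    by rewrite lerDr ltW.
  rewrite ler_wpM2r // !indicE; case: (boolP (t \in _)) => [/set_mem nK|] //.
  by rewrite mem_set.
apply: (@le_trans _ _ (pker (r%:C * ei theta) t)).
  by rewrite ler_piMl // indicE; case: (_ \in _).
apply: (@le_trans _ _ (e / 2)); last by rewrite lerDl mulr_ge0.
have D : d / 2 <= normc (ei t - r%:C * ei theta).
  have h1 := ft _ Kt.
  have h2 : normc (ei t - ei theta) <= normc (ei t - r%:C * ei theta) + rho.
    have -> : ei t - ei theta = (ei t - r%:C * ei theta) + (r%:C * ei theta - ei theta) by ring.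
    apply: le_trans (le_normcD _ _) _; rewrite lerD2l realC_sub1 normcM normc_expi mulr1 normcR.
    by rewrite /r addrAC subrr add0r normrN gtr0_norm.
  by move: h1 h2 rhod; rewrite -/d; lra.
have D0 : 0 < normc (ei t - r%:C * ei theta) by apply: lt_le_trans D; rewrite divr_gt0.
rewrite pker_def nz ler_pdivrMr ?exprn_gt0 //.
have : (d / 2) ^+ 2 <= normc (ei t - r%:C * ei theta) ^+ 2.
  by rewrite lerXn2r ?nnegrE ?(ltW D0) // divr_ge0 // ltW.
rewrite /r; move: rhoe e0 rho0; set X := normc _ ^+ 2; move: X => X.
rewrite expr_div_n; move: (d ^+ 2) => Y h1 h2 h3 h4.
have : e * (Y / 2 ^+ 2) <= e * X by rewrite ler_wpM2l // ltW.
by nra.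
Qed.

Let FN (N : nat) z := cexp (- N%:R%:C * herg (\1_(~` K)) z).

Let holoFN N : holo (FN N).
Proof.
move=> z z1; apply: (cdiff_comp (fun x => - N%:R%:C * herg (\1_(~` K)) x) cexp); last exact: cdiff_cexp.
by apply: cdiffM; [exact: cdiff_cst|exact: holo_herg].
Qed.

Let normFN N z : normc (FN N z) = expR (- (N%:R * v z)).
Proof. by rewrite /FN normc_cexp mulNr ReNc Re_mulr. Qed.

Let FN_le1 N z : normc z < 1 -> normc (FN N z) <= 1.
Proof. by move=> z1; rewrite normFN -expR0 ler_expR oppr_le0 mulr_ge0 // v_ge0. Qed.

(** By exp (- x) >= 1 - x the mean of |F_N|^q is at least the measure of [K] minus q N times the
    mean of v over r K. The radius is chosen after N, so the supremum over radii absorbs the factor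
    q N. *)
Let mean_lower N q : 0 < q -> ((avg (\1_K : R -> R))%:E <=
  ereal_sup [set \int[mu]_t (normc (FN N (r%:C * expi t)%R) `^ q)%:E | r in [set r : R | (0 <= r < 1)%R]])%E.
Proof.
move=> q0; apply/lee_addgt0Pr => e e0.
have K0 : 0 < q * N%:R + 1 by rewrite ltr_wpDl // mulr_ge0 // ltW.
have [r r01 Hr] := extremal_mean _ (divr_gt0 e0 K0).
have [r0 r1] := andP r01; have r01' : 0 <= r < 1 by rewrite ltW.
apply: (@le_trans _ _ ((avg (fun t => normc (FN N (r%:C * ei t)) `^ q) + e)%:E)); last first.
  rewrite EFinD leeD2r // -integral_circle //; apply: ereal_sup_ubound.
  by exists r.
rewrite lee_fin -lerBlDr.
have hK : bmeas (\1_K : R -> R) by exact: bmeas_indic.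
have hKv : bmeas (fun t => \1_K t * v (r%:C * ei t)) by apply: bmeasM => //; exact: hv.
have hKv' : bmeas (fun t => q * N%:R * (\1_K t * v (r%:C * ei t))).
  by apply: bmeasM => //; exact: bmeas_cst.
apply: (@le_trans _ _ (avg (fun t => \1_K t - q * N%:R * (\1_K t * v (r%:C * ei t))))).
  rewrite avgB // avgZ // lerD2l lerN2.
  have a0 : 0 <= avg (fun t => \1_K t * v (r%:C * ei t)).
    by apply: avg_ge0 => t; rewrite mulr_ge0 // v_ge0 // normc_rexpi // ltW.
  move: Hr; rewrite ler_pdivlMr // mulrDr mulr1 mulrC => h.
  by move: a0 h; lra.
apply: le_avg => [| |t]; first exact: bmeasB.
  exact: bmeas_powR_circle.
rewrite indicE; case: (t \in K); last by rewrite mul0r mulr0 subrr powR_ge0.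
rewrite mul1r normFN -expRM mulNr; apply: le_trans (expR_ge1Dx _).
by rewrite lerD2l lerN2 mulrAC [N%:R * q]mulrC.
Qed.

Let FN_space N p : (0 < p)%E -> hardy_space p (FN N).
Proof.
move=> p0; split; first by apply/holoP; exact: holoFN.
case: p p0 => [q| |] // p0.
  rewrite /= poweR_lty // (@le_lt_trans _ _ 1%E) ?ltry //.
  apply: ge_ereal_sup => _ [r /= r01 <-]; rewrite lte_fin in p0; rewrite integral_circle // lee_fin.
  apply: avg_le; first exact: bmeas_powR_circle.
  move=> t; have [r0 r1] := andP r01.
  have : normc (FN N (r%:C * ei t)) `^ q <= 1 `^ q.
    apply: ge0_ler_powR; rewrite ?nnegrE ?normc_ge0 ?(ltW p0) //.
    by rewrite FN_le1 // normc_rexpi.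
  by rewrite powR1.
rewrite /= (@le_lt_trans _ _ 1%E) ?ltry //.
by apply: ge_ereal_sup => _ [z z1 <-]; rewrite lee_fin FN_le1.
Qed.

(** For p = +oo the supremum dominates the means of exponent 1. *)
Let norm_lower p : (0 < p)%E -> 0 < avg (\1_K : R -> R) ->
  exists2 k : R, 0 < k & forall N, (k%:E <= hardy_norm p (FN N))%E.
Proof.
case: p => [q| |] // p0 K0.
  rewrite lte_fin in p0.
  exists (avg (\1_K : R -> R) `^ q^-1); first exact: powR_gt0.
  move=> N; rewrite /= -poweR_EFin; apply: gt0_ler_poweR.
  - by rewrite invr_ge0 ltW.
  - by rewrite in_itv /= leey andbT lee_fin ltW.
  - rewrite in_itv /= leey andbT (le_trans _ (mean_lower N q p0)) // lee_fin ltW //.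
  exact: mean_lower.
exists (avg (\1_K : R -> R)) => // N.
apply: le_trans (mean_lower N 1 ltr01) _.
apply: ge_ereal_sup => _ [r /= r01 <-]; rewrite integral_circle //.
have h z : normc z < 1 -> ((normc (FN N z))%:E <= ereal_sup [set (normc (FN N z))%:E | z in disk])%E.
  by move=> z1; apply: ereal_sup_ubound; exists z.
have hle1 : (ereal_sup [set (normc (FN N z))%:E | z in disk] <= 1%E)%E.
  by apply: ge_ereal_sup => _ [z z1 <-]; rewrite lee_fin FN_le1.
have fin : ereal_sup [set (normc (FN N z))%:E | z in disk] \is a fin_num.
  rewrite ge0_fin_numE; first exact: le_lt_trans hle1 (ltry _).
  apply: le_trans (h 0 _); first by rewrite lee_fin normc_ge0.
  by rewrite (@normc0 R).
rewrite -[leRHS]fineK // lee_fin; apply: avg_le; first exact: bmeas_powR_circle.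
move=> t; have [r0 r1] := andP r01.
by rewrite powRr1 ?normc_ge0 // -lee_fin fineK // h // normc_rexpi.
Qed.

Let circle_upper p c N : (0 < p)%E -> (forall z, a z -> c <= v z) ->
  (circle_norm p (maximal_fun alpha a (FN N)) <= (expR (- c) ^+ N)%:E)%E.
Proof.
move=> p0 Hc; set x := expR (- c) ^+ N.
have x0 : 0 <= x by rewrite exprn_ge0 // expR_ge0.
have mx t : (maximal_fun alpha a (FN N) (expi t) <= x%:E)%E.
  rewrite expi_ei; apply: maximal_fun_le => [|z az _]; rewrite lee_fin //.
  by rewrite normFN /x -expRM_natl ler_expR mulrN lerN2 ler_wpM2l // Hc.
have m0 t : (0 <= maximal_fun alpha a (FN N) (expi t))%E.
  by rewrite expi_ei; exact: maximal_fun_ge0.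
rewrite /circle_norm Lnorm.unlock; case: p p0 => [q| |] // p0.
  rewrite lte_fin in p0.
  rewrite -[x](powRr1 x0) -(mulfV (lt0r_neq0 p0)) powRrM -poweR_EFin; apply: gt0_ler_poweR.
  - by rewrite invr_ge0 ltW.
  - by rewrite in_itv /= leey andbT; apply: integral_ge0 => t _; exact: poweR_ge0.
  - by rewrite in_itv /= leey andbT lee_fin powR_ge0.
  apply: (@le_trans _ _ (\int[mu]_t ((x `^ q)%:E : \bar R))%E); last first.
    by rewrite integral_cst // [mu _]dtheta2pi_setT mule1.
  under eq_integral do rewrite gee0_abs // expi_ei.
  apply: ge0_le_integral => //.
  - by move=> t _; exact: poweR_ge0.
  - exact: measurable_maximal_poweR.
  move=> t _; rewrite -poweR_EFin; apply: gt0_ler_poweR; rewrite ?(ltW p0) //.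
  - by rewrite in_itv /= leey andbT; exact: maximal_fun_ge0.
  - by rewrite in_itv /= leey andbT lee_fin.
  - by have := mx t; rewrite expi_ei.
rewrite [X in (0 < X)%E]dtheta2pi_setT lte01; apply/ess_supP; apply: aeW => t.
by rewrite /= gee0_abs.
Qed.

(** If [K] had positive measure, sampling would give C k <= exp (- c N) for every N, with C k > 0
    fixed. *)
Lemma extremal_null p : (0 < p)%E -> sampling alpha p (a : set R[i]^o) -> avg (\1_K : R -> R) = 0.
Proof.
move=> p0 [C C0 HC].
have avg0 : 0 <= avg (\1_K : R -> R) by apply: avg_ge0.
apply/eqP; rewrite eq_le avg0 andbT leNgt; apply/negP => K0.
have [c c0 Hc] := extremal_lower.
have [k k0 Hk] := norm_lower p p0 K0.
have e1 : 0 <= expR (- c) < 1 by rewrite expR_ge0 -expR0 ltr_expR oppr_lt0.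
suff : C * k <= 0 by rewrite leNgt mulr_gt0.
apply: (le_geometric_eq0 _ 1 _ e1) => N; rewrite mul1r -lee_fin.
apply: le_trans (circle_upper p c N p0 Hc).
apply: le_trans (HC _ (FN_space N p p0)).
by rewrite EFinM lee_wpmul2l // lee_fin ltW.
Qed.

End Extremal.

Theorem sampling_necessary alpha (p : \bar R) (a : set R[i]^o) : 0 < alpha -> (0 < p)%E ->
  a `<=` disk -> sampling alpha p a -> {ae mu, forall t, approach alpha a t}.
Proof.
move=> al0 p0 ha Hs.
have pg := pi_gt0 R; have p20 : 0 < 2 * pi :> R by rewrite mulr_gt0.
(* The length bound pi is what yields the hypothesis that [K] has normalized measure at most 1/2. *)
have main (x y : R) n : 0 <= x -> x <= y -> y <= 2 * pi -> y - x <= pi ->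
    leb ((avoid alpha a n `&` `[x, y]) `&` arc) = 0%E.
  move=> x0 xy y1 xyp; set K := avoid alpha a n `&` _.
  have oK : open (~` K).
    rewrite setCI; apply: openU; first exact: open_setC_avoid.
    by apply: closed_openC; exact: interval_closed.
  have mK : measurable K by apply: measurableI; [exact: measurable_avoid|exact: measurable_itv].
  have Khalf : avg (\1_K : R -> R) <= 2^-1.
    apply: (@le_trans _ _ (avg (\1_(`[x, y]%classic : set R)))).
      apply: le_avg => [| |t]; [exact: bmeas_indic|by apply: bmeas_indic; exact: measurable_itv|].
      rewrite !indicE ler_nat; case: (boolP (t \in K)) => // /set_mem[_ It].
      by rewrite mem_set.
    rewrite avg_indic_itv // ler_pdivrMr // mulKf //.
  have KI : K `<=` `[0, 2 * pi].
    move=> t [_]; rewrite /= !in_itv /= => /andP[xt ty].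
    by rewrite (le_trans x0 xt) (le_trans ty y1).
  have := extremal_null alpha a n K al0 ha oK KI (@subIsetl _ _ _) Khalf p p0 Hs.
  move=> h; have := congr1 EFin h; rewrite avg_indic // => /eqP.
  rewrite mule_eq0 => /orP[|/eqP //].
  by rewrite eqe invr_eq0 gt_eqF.
have null n : leb (avoid alpha a n `&` arc) = 0%E.
  have m1 : measurable ((avoid alpha a n `&` `[0, pi]) `&` arc).
    by do 2 (apply: measurableI; last exact: measurable_itv); exact: measurable_avoid.
  have m2 : measurable ((avoid alpha a n `&` `[pi, 2 * pi]) `&` arc).
    by do 2 (apply: measurableI; last exact: measurable_itv); exact: measurable_avoid.
  apply/eqP; rewrite eq_le measure_ge0 andbT.
  apply: (@le_trans _ _ (leb (((avoid alpha a n `&` `[0, pi]) `&` arc) `|`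
      ((avoid alpha a n `&` `[pi, 2 * pi]) `&` arc)))).
    apply: le_measure; rewrite ?inE.
    - by apply: measurableI; [exact: measurable_avoid|exact: measurable_itv].
    - exact: measurableU.
    move=> t [At It]; move: (It); rewrite /= in_itv /= => /andP[t0 t1].
    have [tp|tp] := leP t pi; [left|right]; (split => //; split => //).
      by rewrite /= in_itv /= t0.
    by rewrite /= in_itv /= (ltW tp) ltW.
  have n1 : leb ((avoid alpha a n `&` `[0, pi]) `&` arc) = 0%E.
    by apply: main; rewrite ?subr0 ?(ltW pg) //; lra.
  have n2 : leb ((avoid alpha a n `&` `[pi, 2 * pi]) `&` arc) = 0%E.
    by apply: main => //; [exact: ltW|lra|lra].
  set A1 := (X in (X `|` _)) in m1 n1 *; set A2 := (X in (_ `|` X)) in m2 n2 *.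
  rewrite (le_trans (measureU2 _ _ _)) //.
  apply: (@le_trans _ _ (leb A1 + leb A2)%E); first exact: lexx.
  by rewrite n1 n2 adde0.
have Fmu : Filter (nbhs (almost_everywhere mu)) by exact: ae_filter_ringOfSetsType.
have H : {ae mu, forall t, forall n, ~ avoid alpha a n t}.
  apply: ae_foralln => n; exists (avoid alpha a n); split.
  - exact: measurable_avoid.
  - by rewrite /dtheta2pi /= /mscale /= /mrestr null mule0.
  - by move=> t /= /contrapT.
by apply: filterS H => t; exact: not_avoid_approach.
Qed.

End SamplingNecessary.

Theorem theorem1 (R : realType) (alpha : R) (halpha : 0 < alpha)
    (p : \bar R) (hp : (0 < p)%E) (a : set R[i]^o) (ha : a `<=` disk) :
  sampling alpha p a <->
  {ae arc_length, forall t : R, nontangential_limit_point a (expi t)}.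
Proof.
split=> [Hs|[N [mN N0 HN]]].
  have [N [mN N0 HN]] := sampling_necessary alpha p a halpha hp ha Hs.
  exists N; split => //.
    apply/eqP; move/eqP: N0; rewrite /dtheta2pi /= /mscale /= mule_eq0 => /orP[|//].
    by rewrite eqe invr_eq0 gt_eqF // mulr_gt0 ?pi_gt0.
  (* The fixed aperture itself witnesses the limit point. *)
  by move=> t Ht; apply: HN => /= Hap; apply: Ht; apply/ntlpP; exists alpha.
apply: sampling_sufficient => //; apply: ae_dtheta2pi.
have Hlim := ntlp_approach_ae alpha a halpha.
have Harc : {ae (@lebesgue_measure R), forall t, 0 < t < 2 * pi -> nontangential_limit_point a (expi t)}.
  (* [N0] is a statement on [arc_length], that is, on the Lebesgue measure of this intersection; the
     premise on t confines the claim to the arc. *)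
  exists (N `&` arc_domain); split.
  - by apply: measurableI => //; exact: measurable_itv.
  - exact: N0.
  move=> t /= Ht; have [t01|t01] := boolP (0 < t < 2 * pi); last by exfalso; apply: Ht => t0; move/negP: t01.
  split; first by apply: HN => h; apply: Ht.
  by case/andP: t01 => t0 t1; rewrite /arc_domain /= in_itv /= (ltW t0).
have Fleb : Filter (nbhs (almost_everywhere (@lebesgue_measure R))) by exact: ae_filter_ringOfSetsType.
by apply: filterS2 Hlim Harc => t h1 h2 /h2 /h1.
Qed.
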